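(* Let $\psi$ be an admissible wavelet and $0\le\beta<\alpha+1$, and assume $\mathcal M(|\mathcal H_\alpha\psi|^2)(-2\beta)=\int_0^\infty a^{2\beta}|\mathcal H_\alpha\psi(a)|^2\frac{da}{a}<\infty$. Then for every $f\in\mathcal S_e(\mathbb R)$ such that $W_\psi f(a,\cdot)\in\mathcal S_e(\mathbb R)$ for every $a>0$, $$\|a^{-\beta}\,W_\psi f\|_{2,\nu_\alpha}\ \le\ C_{\alpha,\beta}(\psi)\,\|x^{\beta}\,W_\psi f\|_{2,\nu_\alpha},$$ where $$C_{\alpha,\beta}(\psi)=\sqrt{c_\psi^{-1}\,\mathcal M(|\mathcal H_\alpha\psi|^2)(-2\beta)}\;2^{-\beta}\,\frac{\Gamma\left(\frac{\alpha-\beta+1}{2}\right)}{\Gamma\left(\frac{\alpha+\beta+1}{2}\right)}.$$ Here $\|a^{-\beta}W_\psi f\|_{2,\nu_\alpha}^2=\int_{\mathcal R}a^{-2\beta}|W_\psi f(a,x)|^2d\nu_\alpha(a,x)$ and $\|x^{\beta}W_\psi f\|_{2,\nu_\alpha}^2=\int_{\mathcal R}x^{2\beta}|W_\psi f(a,x)|^2d\nu_\alpha(a,x)$.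
   Context: Fix a real number $\alpha>-1/2$. Let $\mu_\alpha$ be the measure on $\mathbb{R}_+=[0,\infty)$ given by $d\mu_\alpha(x)=\frac{x^{2\alpha+1}}{2^\alpha\Gamma(\alpha+1)}\,dx$; for $1\le p<\infty$ let $L^p_\alpha(\mathbb R_+)=L^p(\mathbb R_+,\mu_\alpha)$ with norm $\|f\|_{p,\mu_\alpha}=\left(\int_0^\infty|f|^p\,d\mu_\alpha\right)^{1/p}$, and let $L^\infty_\alpha(\mathbb R_+)$ be the essentially bounded functions. Let $j_\alpha(z)=\Gamma(\alpha+1)\sum_{n\ge0}\frac{(-1)^n}{n!\,\Gamma(n+\alpha+1)}(z/2)^{2n}$. The Hankel transform is $\mathcal H_\alpha f(\xi)=\int_0^\infty f(x)\,j_\alpha(x\xi)\,d\mu_\alpha(x)$ for $f\in L^1_\alpha(\mathbb R_+)$, extended to a unitary operator on $L^2_\alpha(\mathbb R_+)$. For $x\ge0$ the Hankel translation is $\tau_x^\alpha f(y)=\frac{\Gamma(\alpha+1)}{\Gamma(1/2)\Gamma(\alpha+1/2)}\int_0^\pi f\big(\sqrt{x^2+y^2+2xy\cos\theta}\big)\sin^{2\alpha}\theta\,d\theta$, and for $a>0$ the dilation is $D_af(x)=a^{\alpha+1}f(ax)$. A nonzero $\psi\in L^1_\alpha(\mathbb R_+)\cap L^\infty_\alpha(\mathbb R_+)$ is an admissible wavelet if $0<c_\psi:=\int_0^\infty|\mathcal H_\alpha\psi(a)|^2\,\frac{da}{a}<\infty$. For such $\psi$ and $f\in L^2_\alpha(\mathbb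 R_+)$, the Hankel wavelet transform is $W_\psi f(a,x)=c_\psi^{-1/2}\int_0^\infty f(t)\,\overline{\tau_x^\alpha(D_a\psi)(t)}\,d\mu_\alpha(t)$ for $(a,x)\in\mathcal R:=(0,\infty)\times[0,\infty)$. On $\mathcal R$ let $d\nu_\alpha(a,x)=a^{2\alpha+1}\,da\,d\mu_\alpha(x)$, $L^p_\alpha(\mathcal R)=L^p(\mathcal R,\nu_\alpha)$, with norm $\|F\|_{p,\nu_\alpha}$ (and $\|F\|_\infty$ the essential supremum). $\mathcal S_e(\mathbb R)$ denotes the space of even Schwartz functions on $\mathbb R$; such a function is identified with its restriction to $[0,\infty)$ (so $\mathcal S_e(\mathbb R)\subset L^2_\alpha(\mathbb R_+)$). The condition ''$W_\psi f(a,\cdot)\in\mathcal S_e(\mathbb R)$'' means that $x\mapsto W_\psi f(a,x)$, $x\ge0$, is the restriction of an even Schwartz function. The Mellin transform is $\mathcal M(g)(z)=\int_0^\infty x^{-z}g(x)\,\frac{dx}{x}$. *)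

(* Defs.v *)
(* reals are an arbitrary R : realType,
   complex numbers are R[i] (mathcomp-real-closed "complex"). *)
From mathcomp Require Import all_boot all_order all_algebra.
From mathcomp Require Import all_classical all_reals all_analysis.
From mathcomp Require Export complex.
Import Order.TTheory GRing.Theory Num.Theory.
Local Open Scope ring_scope.
Local Open Scope classical_set_scope.
Local Open Scope complex_scope.

Set Implicit Arguments.
Unset Strict Implicit.
Unset Printing Implicit Defensive.

Section HankelWavelet.
Variable R : realType.
Local Notation C := (R[i]).
Local Notation leb := (@lebesgue_measure R).

(* |z|^2 for a complex number z *)
Definition cabs2 (z : C) : R := (complex.Re z) ^+ 2 + (complex.Im z) ^+ 2.
(* |z| as a real number *)
Definition cmod (z : C) : R := Num.sqrt (cabs2 z).

(* Euler's Gamma function, Gamma(s) = int_0^oo t^(s-1) e^(-t) dt (used only for s > 0) *)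
Definition Gamma (s : R) : R :=
  Rintegral leb `]0, +oo[ (fun t => t `^ (s - 1) * expR (- t)).

(* density of mu_alpha with respect to Lebesgue measure on [0,oo) *)
Definition mu_dens (alpha x : R) : R :=
  x `^ (2 * alpha + 1) / (2 `^ alpha * Gamma (alpha + 1)).

Definition Rplus : set R := [set x | 0 <= x].
Definition Rpos : set R := `]0, +oo[.

(* integral of a complex-valued function: real part + i * imaginary part *)
Definition cintegral (D : set R) (g : R -> C) : C :=
  (Rintegral leb D (fun x => complex.Re (g x)))%:C
  + 'i * (Rintegral leb D (fun x => complex.Im (g x)))%:C.

(* integral over R_+ with respect to mu_alpha *)
Definition cint_mu (alpha : R) (g : R -> C) : C :=
  cintegral Rplus (fun x => g x * (mu_dens alpha x)%:C).

(* normalized Bessel function j_alpha(z) *)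
Definition j_alpha (alpha z : R) : R :=
  Gamma (alpha + 1) *
  limn (fun N => \sum_(0 <= n < N)
     ((-1) ^+ n / ((n`!)%:R * Gamma (n%:R + alpha + 1)) * (z / 2) ^+ (2 * n)%N)).

(* Hankel transform (for f in L^1_alpha) *)
Definition hankel (alpha : R) (f : R -> C) (xi : R) : C :=
  cint_mu alpha (fun x => f x * (j_alpha alpha (x * xi))%:C).

(* Hankel translation *)
Definition htrans (alpha x : R) (f : R -> C) (y : R) : C :=
  (Gamma (alpha + 1) / (Gamma (2^-1) * Gamma (alpha + 2^-1)))%:C *
  cintegral `[0, pi]
    (fun th => f (Num.sqrt (x ^+ 2 + y ^+ 2 + 2 * x * y * cos th))
               * ((sin th) `^ (2 * alpha))%:C).

(* dilation *)
Definition dil (alpha a : R) (f : R -> C) (x : R) : C :=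
  (a `^ (alpha + 1))%:C * f (a * x).

(* c_psi = int_0^oo |H psi (a)|^2 da / a, as an extended real *)
Definition c_psi (alpha : R) (psi : R -> C) : \bar R :=
  (\int[leb]_(a in Rpos) (cabs2 (hankel alpha psi a) / a)%R%:E)%E.

(* Mellin transform M(g)(z) = int_0^oo x^(-z) g(x) dx/x  (real z, g >= 0), in \bar R *)
Definition mellin (g : R -> R) (z : R) : \bar R :=
  (\int[leb]_(x in Rpos) (x `^ (- z) * g x / x)%R%:E)%E.

(* psi is a nonzero element of L^1_alpha cap L^infty_alpha with 0 < c_psi < oo *)
Definition admissible (alpha : R) (psi : R -> C) : Prop :=
  [/\ measurable_fun setT (fun x => complex.Re (psi x))
      /\ measurable_fun setT (fun x => complex.Im (psi x)),
      leb.-integrable Rplus (fun x => (cmod (psi x) * mu_dens alpha x)%:E),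
      (exists M : R, {ae lebesgue_measure, forall x : R, (Rplus x -> cmod (psi x) <= M)}),
      (\int[leb]_(x in Rplus) (cmod (psi x) * mu_dens alpha x)%R%:E != 0)%E
    & (0 < c_psi alpha psi < +oo)%E].

(* Hankel wavelet transform *)
Definition hwt (alpha : R) (psi f : R -> C) (a x : R) : C :=
  ((Num.sqrt (fine (c_psi alpha psi)))^-1)%:C *
  cint_mu alpha (fun t => f t * (htrans alpha x (dil alpha a psi) t)^*).

(* Schwartz functions R -> R and R -> C *)
Definition schwartzR (g : R -> R) : Prop :=
  (forall (n : nat) (x : R), derivable (derive1n n g) x 1) /\
  (forall k n : nat, exists M : R, forall x : R, `|x ^+ k * derive1n n g x| <= M).

Definition schwartz (g : R -> C) : Prop :=
  schwartzR (fun x => complex.Re (g x)) /\ schwartzR (fun x => complex.Im (g x)).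

(* even Schwartz functions S_e(R) *)
Definition schwartz_even (g : R -> C) : Prop :=
  schwartz g /\ forall x, g (- x) = g x.

(* h restricted to [0,oo) is the restriction of an even Schwartz function *)
Definition restr_in_Se (h : R -> C) : Prop :=
  exists g, schwartz_even g /\ forall x, 0 <= x -> h x = g x.

(* the region R = (0,oo) x [0,oo) *)
Definition Rdom : set (R * R) := [set z | 0 < z.1 /\ 0 <= z.2].

(* L^2 norm on R = (0,oo) x [0,oo) w.r.t. d nu_alpha = a^(2 alpha+1) da dmu_alpha(x) *)
Definition L2nu (alpha : R) (F : R -> R -> C) : \bar R :=
  poweR (\int[(leb \x leb)%E]_(z in Rdom)
           (cabs2 (F z.1 z.2) * z.1 `^ (2 * alpha + 1) * mu_dens alpha z.2)%R%:E)%E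
        (2^-1).

(* the constant C_{alpha,beta}(psi) *)
Definition Cab (alpha beta : R) (psi : R -> C) : R :=
  Num.sqrt ((fine (c_psi alpha psi))^-1 *
            fine (mellin (fun a => cabs2 (hankel alpha psi a)) (- (2 * beta))))
  * 2 `^ (- beta)
  * (Gamma ((alpha - beta + 1) / 2) / Gamma ((alpha + beta + 1) / 2)).

End HankelWavelet.

(* Main.v *)
Require Import Defs.
From HB Require Import structures.
From mathcomp Require Import all_boot all_order all_algebra.
From mathcomp Require Import all_classical all_reals all_analysis.
From mathcomp Require Import complex measurable_realfun.
From mathcomp Require Import ring lra zify.
Import Order.TTheory GRing.Theory Num.Theory.
Import numFieldNormedType.Exports.
Local Open Scope classical_set_scope.
Local Open Scope ring_scope.
Set Implicit Arguments.
Unset Strict Implicit.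
Unset Printing Implicit Defensive.

(* Fix a > 0 and write W(a,.) for the wavelet transform at scale a. Since translation is a Hankel
   convolution, |H(W(a,.))(xi)|^2 = |H f(xi)|^2 |H psi(xi/a)|^2 / (c_psi a^(2 alpha + 2)). Integrating this
   against a^(2 alpha + 1 - 2 beta) da gives a multiple M(|H psi|^2)(-2 beta) / c_psi of
   int xi^(-2 beta) |H f|^2 d mu on one side, which bounds the left-hand norm by the Plancherel
   inequality ||g|| <= ||H g||; with the weight xi^(-2 beta) and a^(2 alpha + 1) da it gives the same integral,
   which Pitt's inequality || xi^(-beta) H g || <= C || x^beta g ||, applied to g = W(a,.), bounds by
   the right-hand norm.

   Both inequalities come from the heat kernel k_s(x,y), the translate of the Hankel transform of
   exp(-s xi^2). It is nonnegative by definition, equals int exp(-s xi^2) j(x xi) j(y xi) d mu(xi) by the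
   product formula of j, and acts explicitly on gaussians. Hence
   int exp(-s xi^2) |H g|^2 = int int g(x) g(y) k_s(x,y). Letting s tend to 0 gives Plancherel.
   Writing xi^(-2 beta) as a superposition of the exp(-s xi^2) reduces Pitt to a Schur test with the
   function y^(-(alpha + 1 + beta)), itself a superposition of gaussians, so that all the
   integrals involved are Gamma and Beta integrals. *)

(** * Measures with a density, Fubini, changes of variables *)

(** The weight [xi^(-2 beta)] is singular and some of the norms may be infinite, so the estimates
    are carried out on nonnegative functions in the extended reals, where Tonelli applies without
    any finiteness check. Signed Fubini is used only behind an integrable majorant, and the factor
    [exp(-s xi^2)] is there to provide it. This regularisation is also why an inequality of
    Plancherel type is enough: the damped quadratic form increases to the spectral integral, and no
    inversion formula is needed.

    The constant arises from the Schur test. Averaging [y^(-(alpha + 1 + beta))] over all [s] with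
    weight [s^(beta - 1)] gives a multiple of [x^(-(alpha + 1 - beta))]; the two exponents differ by
    [2 beta], the weight on the right. The same quotient of Gamma values appears twice, hence the
    square of the constant at the level of energies. Convergence at both ends requires
    [0 < beta < alpha + 1]. At [beta = 0] the two weighted norms coincide and the constant is 1, so
    that case is settled separately.

    The geometric input is elementary: [mu_alpha] times the law of the angle is a weighted area on a
    half-plane, and symmetries of the half-plane give the symmetry and the invariance of
    translation. *)

Section density_measure.
Context d (T : measurableType d) (R : realType).
Variables (mu : {measure set T -> \bar R}) (w : T -> R).

(** The two proofs are arguments of the set function, so that its measure structure can be recovered
    from the term [mdens mw w0] itself. *)
Definition mdens of measurable_fun setT w & (forall x, 0 <= w x) :=
  fun A : set T => (\int[mu]_(x in A) (w x)%:E)%E.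

Hypotheses (mw : measurable_fun setT w) (w0 : forall x, 0 <= w x).

Let mdens0 : mdens mw w0 set0 = 0%E.
Proof. by rewrite /mdens integral_set0. Qed.

Let mdens_ge0 A : (0 <= mdens mw w0 A)%E.
Proof. by apply: integral_ge0 => x _; rewrite lee_fin. Qed.

Let mdens_sigma_additive : semi_sigma_additive (mdens mw w0).
Proof.
move=> /= F mF tF mUF; rewrite /mdens ge0_integral_bigcup//; last 2 first.
- by apply/measurable_EFinP; exact: measurable_funTS.
- by move=> x _; rewrite lee_fin.
apply: is_cvg_ereal_nneg_natsum_cond => n _ _.
by apply: integral_ge0 => x _; rewrite lee_fin.
Qed.

HB.instance Definition _ := isMeasure.Build _ _ _ (mdens mw w0)
  mdens0 mdens_ge0 mdens_sigma_additive.

Import HBNNSimple.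

(** Both sides are monotone limits along the same simple functions increasing to [f]. For a simple
    function the claim reduces by linearity to an indicator, where it is the definition of
    [mdens]. *)
Lemma ge0_integral_mdens (f : T -> \bar R) :
  (forall x, (0 <= f x)%E) -> measurable_fun setT f ->
  (\int[mdens mw w0]_x f x = \int[mu]_x (f x * (w x)%:E))%E.
Proof.
move=> f0 mf; pose h := nnsfun_approx measurableT mf.
have mEw : measurable_fun setT (EFin \o w) by exact/measurable_EFinP.
have -> : (\int[mdens mw w0]_x f x =
    lim (\int[mdens mw w0]_x (EFin \o h n) x @[n --> \oo]))%E.
  have fE x : f x = lim ((EFin \o h n) x @[n --> \oo]).
    by apply/esym/cvg_lim => //; exact: cvg_nnsfun_approx.
  under eq_integral => x _ do rewrite fE.
  apply: monotone_convergence => //.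
  - by move=> n; apply/measurable_EFinP/measurable_funP.
  - by move=> n x _ //=; rewrite lee_fin.
  - by move=> x _ a b ab; rewrite lee_fin; exact/lefP/nd_nnsfun_approx.
have -> : (\int[mu]_x (f x * (w x)%:E) =
    lim (\int[mu]_x ((EFin \o h n) x * (w x)%:E) @[n --> \oo]))%E.
  have fg x : (f x * (w x)%:E = lim (((EFin \o h n) \* (EFin \o w)) x @[n --> \oo]))%E.
    by apply/esym/cvg_lim => //; apply: cvgeZr => //; exact: cvg_nnsfun_approx.
  under eq_integral => x _ do rewrite fg.
  apply: monotone_convergence => [//| | |].
  - by move=> n; apply/emeasurable_funM => //; exact/measurable_EFinP.
  - by move=> n x _ /=; rewrite mule_ge0 ?lee_fin.
  - move=> x _ a b ab/=; rewrite lee_wpmul2r ?lee_fin//.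
    exact/lefP/nd_nnsfun_approx.
congr (limn _); apply/funext => n.
transitivity (\int[mdens mw w0]_x
   (\sum_(y \in range (h n)) (y * \1_(h n @^-1` [set y]) x)%:E))%E.
  by apply: eq_integral => t tE; rewrite /= fimfunE -fsumEFin.
have indich m r : measurable_fun setT (fun x => (r * \1_(h m @^-1` [set r]) x)%:E).
  by apply/measurable_EFinP; exact: measurable_funM.
rewrite ge0_integral_fsum//; last by move=> m y Ey; exact: nnfun_muleindic_ge0.
transitivity (\int[mu]_x (\sum_(y \in range (h n))
    (y * \1_(h n @^-1` [set y]) x)%:E * (w x)%:E))%E; last first.
  apply: eq_integral => x _.
  rewrite -ge0_mule_fsuml => [|y]; last exact: nnfun_muleindic_ge0.
  by rewrite fsumEFin // -(fimfunE _ x).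
rewrite ge0_integral_fsum//; last 2 first.
- by move=> y; exact: emeasurable_funM.
- by move=> m y Ey; apply: mule_ge0; [exact: nnfun_muleindic_ge0|rewrite lee_fin].
apply: eq_fsbigr => r rhn.
under eq_integral do rewrite EFinM.
rewrite integralZl_indic_nnsfun => //.
under [RHS]eq_integral do rewrite EFinM -muleA.
rewrite ge0_integralZl//.
- under [in RHS]eq_integral do rewrite muleC.
  rewrite [in RHS](eq_integral ((EFin \o w) \_ (h n @^-1` [set r]))); last first.
    by move=> x xE; rewrite epatch_indic.
  by rewrite -integral_mkcondr integral_indic// !setTI setIT.
- by apply: emeasurable_funM => //; exact/measurable_EFinP.
- by move=> t Et; rewrite mule_ge0 ?lee_fin.
- by move: rhn; rewrite inE => -[t _ <-]; rewrite lee_fin.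
Qed.

Lemma integral_mdens (f : T -> \bar R) : measurable_fun setT f ->
  (\int[mdens mw w0]_x f x = \int[mu]_x (f x * (w x)%:E))%E.
Proof.
move=> mf; rewrite [LHS]integralE [RHS]integralE; congr (_ - _)%E.
- rewrite ge0_integral_mdens//; last exact: measurable_funepos.
  apply: eq_integral => x _.
  by rewrite /= !funeposE muleC (muleC (f x)) maxe_pMr ?lee_fin// mule0.
- rewrite ge0_integral_mdens//; last exact: measurable_funeneg.
  apply: eq_integral => x _.
  by rewrite /= !funenegE muleC (muleC (f x)) -muleN maxe_pMr ?lee_fin// mule0.
Qed.

Lemma Rintegral_mdens (f : T -> R) : measurable_fun setT f ->
  Rintegral (mdens mw w0) setT f = Rintegral mu setT (fun x => f x * w x).
Proof.
move=> mf; rewrite /Rintegral integral_mdens//; last exact/measurable_EFinP.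
Qed.

Lemma integrable_mdens (f : T -> R) : measurable_fun setT f ->
  (mdens mw w0).-integrable setT (EFin \o f) <->
  mu.-integrable setT (fun x => (f x * w x)%:E).
Proof.
move=> mf.
have mEf : measurable_fun setT (EFin \o f) by exact/measurable_EFinP.
have E : (\int[mdens mw w0]_x `|(f x)%:E| = \int[mu]_x `|(f x * w x)%:E|)%E.
  rewrite ge0_integral_mdens//; last exact: measurableT_comp.
  by apply: eq_integral => x _; rewrite /= -EFinM normrM (ger0_norm (w0 x)).
split=> /integrableP[_ h]; apply/integrableP; split=> //.
- by apply/measurable_EFinP; exact: measurable_funM.
- by rewrite -E.
- by move: h; rewrite -E.
Qed.

End density_measure.

Section density_sigma_finite.
Context d (T : measurableType d) (R : realType).
Variables (mu : {sigma_finite_measure set T -> \bar R}) (w : T -> R).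
Hypotheses (mw : measurable_fun setT w) (w0 : forall x, 0 <= w x).

Let mdens_sigma_finite : sigma_finite setT (mdens mu mw w0).
Proof.
have /sigma_finiteP[F [TF ndF Foo]] := sigma_finiteT mu.
have mN n : measurable (F n `&` (w @^-1` `]-oo, n%:R])).
  apply: measurableI; first exact: (Foo n).1.
  by rewrite -[X in measurable X]setTI; exact: mw.
(* Cutting [F n] by the sublevel set of [w] at height [n] bounds its new measure by [n] times the
   old one. A point [x] is caught once [n] exceeds both its index in [F] and [w x]. *)
exists (fun n => F n `&` (w @^-1` `]-oo, n%:R])).
  apply/esym; rewrite -subTset => x _.
  have : setT x by []. rewrite TF => -[n _ Fnx].
  pose k := (Num.truncn (w x)).+1.
  exists (maxn n k) => //; split.
  - by have /subsetPset := ndF _ _ (leq_maxl n k); exact.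
  - rewrite /= in_itv/=; apply: le_trans (ltW (truncnS_gt _)) _.
    by rewrite ler_nat leq_maxr.
move=> n; split => //.
apply: (@le_lt_trans _ _ (\int[mu]_(x in F n `&` (w @^-1` `]-oo, n%:R])) (n%:R)%:E)%E).
  apply: ge0_le_integral => //.
  - by move=> x _; rewrite lee_fin.
  - by apply/measurable_EFinP; exact: measurable_funTS.
  - by move=> x [_]; rewrite /= in_itv/= lee_fin.
rewrite integral_cst//= lte_mul_pinfty ?lee_fin//.
apply: le_lt_trans (Foo n).2; apply: le_measure; rewrite ?inE//.
exact: (Foo n).1.
Qed.

HB.instance Definition _ := Measure_isSigmaFinite.Build _ _ _ (mdens mu mw w0)
  mdens_sigma_finite.
End density_sigma_finite.

Section Rintegral_total.
Context d (T : measurableType d) (R : realType).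
Variable mu : {measure set T -> \bar R}.

(** Integrals of the positive and negative parts cannot both be finite, so their difference is
    infinite and [fine] sends it to 0. This default value lets scaling and the triangle inequality
    below be stated for all measurable functions. *)
Lemma Rintegral_nonintegrable (f : T -> R) : measurable_fun setT f ->
  ~ mu.-integrable setT (EFin \o f) -> Rintegral mu setT f = 0.
Proof.
move=> mf nif; rewrite /Rintegral integralE.
set a := (\int[mu]_x _)%E; set b := (\int[mu]_x _)%E.
have a0 : (0 <= a)%E by exact: integral_ge0.
have b0 : (0 <= b)%E by exact: integral_ge0.
have : (a + b = +oo)%E.
  apply/eqP; rewrite -leye_eq leNgt; apply/negP => abo; apply: nif.
  apply/integrableP; split; first exact/measurable_EFinP.
  rewrite (_ : (\int[mu]_x _ = a + b)%E)//.
  rewrite -ge0_integralD//; last 2 first.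
  - by apply: measurable_funepos; exact/measurable_EFinP.
  - by apply: measurable_funeneg; exact/measurable_EFinP.
  by apply: eq_integral => x _; rewrite -/((abse \o (EFin \o f)) x) fune_abse.
by case: a a0 => [a| |]; case: b b0 => [b| |].
Qed.

Lemma Rintegral_scale (f : T -> R) (r : R) : measurable_fun setT f ->
  Rintegral mu setT (fun x => r * f x) = r * Rintegral mu setT f.
Proof.
move=> mf; have [->|r0] := eqVneq r 0.
  rewrite mul0r; under eq_Rintegral do rewrite mul0r.
  by rewrite /Rintegral integral0.
have [i|ni] := pselect (mu.-integrable setT (EFin \o f)).
  by rewrite RintegralZl.
rewrite (Rintegral_nonintegrable mf ni) mulr0 Rintegral_nonintegrable//.
  exact: measurable_funM.
move=> i; apply: ni.
have := @integrableZl _ _ _ mu setT measurableT (r^-1) _ i.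
by apply: eq_integrable => // x _ /=; rewrite -EFinM mulKf.
Qed.

Lemma Rintegral_scaler (f : T -> R) (r : R) : measurable_fun setT f ->
  Rintegral mu setT (fun x => f x * r) = Rintegral mu setT f * r.
Proof.
by move=> mf; rewrite mulrC -Rintegral_scale//; apply: eq_Rintegral => x _; rewrite mulrC.
Qed.

Lemma le_abs_Rintegral (f : T -> R) : measurable_fun setT f ->
  (`|Rintegral mu setT f|%:E <= \int[mu]_x `|f x|%:E)%E.
Proof.
move=> mf; have [i|ni] := pselect (mu.-integrable setT (EFin \o f)).
  by rewrite EFin_normr_Rintegral//; apply: le_abse_integral => //; exact/measurable_EFinP.
by rewrite Rintegral_nonintegrable// normr0; apply: integral_ge0 => x _; rewrite lee_fin.
Qed.

End Rintegral_total.

Section real_Fubini.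
Context d1 d2 (T1 : measurableType d1) (T2 : measurableType d2) (R : realType).
Variable m1 : {sigma_finite_measure set T1 -> \bar R}.
Variable m2 : {sigma_finite_measure set T2 -> \bar R}.

Lemma tonelli (F : T1 -> T2 -> \bar R) : (forall x y, (0 <= F x y)%E) ->
  measurable_fun setT (fun z => F z.1 z.2) ->
  (\int[m1]_x \int[m2]_y F x y = \int[m2]_y \int[m1]_x F x y)%E.
Proof. by move=> F0 mF; rewrite (fubini_tonelli (fun z => F z.1 z.2)). Qed.

Lemma measurable_tonelli1 (F : T1 -> T2 -> \bar R) : (forall x y, (0 <= F x y)%E) ->
  measurable_fun setT (fun z => F z.1 z.2) ->
  measurable_fun setT (fun x => \int[m2]_y F x y)%E.
Proof.
by move=> F0 mF; apply: (measurable_fun_fubini_tonelli_F (fun z => F z.1 z.2)).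
Qed.

Lemma measurable_Rintegral1 (F : T1 * T2 -> R) : measurable_fun setT F ->
  measurable_fun setT (fun x => Rintegral m2 setT (fun y => F (x, y))).
Proof.
move=> mF; rewrite /Rintegral; have mEF : measurable_fun setT (EFin \o F) by exact/measurable_EFinP.
apply: (@measurableT_comp _ _ _ _ _ _ fine _ (fun x => \int[m2]_y (EFin \o F) (x, y))%E) => //.
rewrite (_ : (fun x => _) = (fun x => \int[m2]_y ((EFin \o F)^\+ (x, y)) -
   \int[m2]_y ((EFin \o F)^\- (x, y)))%E); last first.
  apply/funext => x; rewrite integralE; congr (_ - _)%E;
  by apply: eq_integral => y _; rewrite ?funeposE ?funenegE.
apply: emeasurable_funB.
- by apply: measurable_fun_fubini_tonelli_F => //; exact: measurable_funepos.
- by apply: measurable_fun_fubini_tonelli_F => //; exact: measurable_funeneg.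
Qed.

Lemma Rintegral12_prod (F : T1 * T2 -> R) :
  (m1 \x m2)%E.-integrable setT (EFin \o F) ->
  Rintegral m1 setT (fun x => Rintegral m2 setT (fun y => F (x, y))) =
  Rintegral (m1 \x m2)%E setT F.
Proof.
move=> iF; have mF : measurable_fun setT F.
  by apply/measurable_EFinP; exact: measurable_int iF.
rewrite /Rintegral -integral12_prod_meas1//; congr fine.
(* The inner integral is finite only for almost every [x], so replacing it by its [fine] value is an
   almost everywhere identity. *)
apply: ae_eq_integral => //.
- by apply/measurable_EFinP; exact: measurable_Rintegral1.
- exact: (measurable_fubini_F iF).
- apply: filterS (ae_integrable1 iF) => x ix _ /=; rewrite fineK//.
  exact: integrable_fin_num.
Qed.

Lemma integrable_Rintegral1 (F : T1 * T2 -> R) :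
  (m1 \x m2)%E.-integrable setT (EFin \o F) ->
  m1.-integrable setT (fun x => (Rintegral m2 setT (fun y => F (x, y)))%:E).
Proof.
move=> iF; have mF : measurable_fun setT F.
  by apply/measurable_EFinP; exact: measurable_int iF.
apply/integrableP; split.
  by apply/measurable_EFinP; exact: measurable_Rintegral1.
have /integrable12ltyP : measurable_fun setT (EFin \o F) by exact/measurable_EFinP.
move=> /(_ m1 m2)[/(_ iF) h _]; apply: le_lt_trans h.
apply: ge0_le_integral => //.
- apply: measurableT_comp => //.
  by apply/measurable_EFinP; exact: measurable_Rintegral1.
- apply: (measurable_fun_fubini_tonelli_F (fun z => `|F z|%:E)) => //.
  by apply/measurable_EFinP; exact: measurableT_comp.
- by move=> x _; apply: le_abs_Rintegral; exact: measurableT_comp.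
Qed.

End real_Fubini.

Section bounded_kernel.
Context d1 d2 (T1 : measurableType d1) (T2 : measurableType d2) (R : realType).
Variable m1 : {sigma_finite_measure set T1 -> \bar R}.
Variable m2 : {sigma_finite_measure set T2 -> \bar R}.

Lemma Rintegral21_prod (F : T1 * T2 -> R) :
  (m1 \x m2)%E.-integrable setT (EFin \o F) ->
  Rintegral m2 setT (fun y => Rintegral m1 setT (fun x => F (x, y))) =
  Rintegral (m1 \x m2)%E setT F.
Proof.
move=> iF; have mF : measurable_fun setT F.
  by apply/measurable_EFinP; exact: measurable_int iF.
rewrite /Rintegral -integral21_prod_meas1//; congr fine.
apply: ae_eq_integral => //.
- apply/measurable_EFinP.
  by apply: (@measurable_Rintegral1 _ _ T2 T1 R m1 (fun z => F (z.2, z.1))); apply: measurableT_comp mF _; exact: measurable_swap.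
- exact: (measurable_fubini_G iF).
- apply: filterS (ae_integrable2 iF) => x ix _ /=; rewrite fineK//.
  exact: integrable_fin_num.
Qed.

Lemma Rintegral_Fubini (F : T1 * T2 -> R) :
  (m1 \x m2)%E.-integrable setT (EFin \o F) ->
  Rintegral m1 setT (fun x => Rintegral m2 setT (fun y => F (x, y))) =
  Rintegral m2 setT (fun y => Rintegral m1 setT (fun x => F (x, y))).
Proof. by move=> iF; rewrite Rintegral12_prod// Rintegral21_prod. Qed.

(** The majorant is [M |A x| |B y|], whose iterated integral factors. This is the form in which
    Fubini is used for the Bessel kernel, which is bounded by 1. *)
Lemma integrable_prod_kernel (A : T1 -> R) (B : T2 -> R) (K : T1 * T2 -> R) (M : R) :
  m1.-integrable setT (EFin \o A) -> m2.-integrable setT (EFin \o B) ->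
  measurable_fun setT K -> (forall z, `|K z| <= M) ->
  (m1 \x m2)%E.-integrable setT (fun z => (A z.1 * B z.2 * K z)%:E).
Proof.
move=> /integrableP[/measurable_EFinP mA iA] /integrableP[/measurable_EFinP mB iB] mK KM.
have mF : measurable_fun setT (fun z : T1 * T2 => A z.1 * B z.2 * K z).
  apply: measurable_funM => //; apply: measurable_funM.
  - exact: (measurableT_comp mA).
  - exact: (measurableT_comp mB).
apply/integrable12ltyP; first exact/measurable_EFinP.
have M0 : 0 <= M by apply: le_trans (KM point).
apply: (@le_lt_trans _ _ (\int[m1]_x (`|A x|%:E * (M%:E * \int[m2]_y `|B y|%:E)))%E).
  apply: ge0_le_integral => //.
  - by move=> x _; apply: integral_ge0.
  - apply: (measurable_fun_fubini_tonelli_F (fun z => `|A z.1 * B z.2 * K z|%:E)) => //.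
    by apply/measurable_EFinP; exact: measurableT_comp.
  - apply: emeasurable_funM => //; apply/measurable_EFinP; exact: measurableT_comp.
  - move=> x _; rewrite -(@ge0_integralZl _ _ _ m2 _ _ _ _ M%:E)//; last first.
      by apply/measurable_EFinP; exact: measurableT_comp.
    rewrite -ge0_integralZl//; last 2 first.
    + apply: emeasurable_funM => //; apply/measurable_EFinP; exact: measurableT_comp.
    + by move=> y _; rewrite mule_ge0 ?lee_fin.
    apply: ge0_le_integral => //.
    + apply/measurable_EFinP/measurableT_comp => //.
      exact: (measurableT_comp mF).
    + apply: emeasurable_funM => //; apply: emeasurable_funM => //.
      by apply/measurable_EFinP; exact: measurableT_comp.
    + move=> y _; rewrite abse_EFin -!EFinM lee_fin !normrM -mulrA.
      by rewrite ler_wpM2l// mulrC ler_wpM2r.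
have iB0 : (0 <= \int[m2]_y `|B y|%:E)%E by apply: integral_ge0 => y _; rewrite lee_fin.
rewrite ge0_integralZr//; last 2 first.
- by apply/measurable_EFinP; exact: measurableT_comp.
- by rewrite mule_ge0 ?lee_fin.
apply: lte_mul_pinfty => //; first by apply: integral_ge0 => y _; rewrite lee_fin.
  rewrite ge0_fin_numE//; apply: integral_ge0 => y _; rewrite lee_fin//.
by apply: lte_mul_pinfty => //; rewrite lee_fin.
Qed.

Lemma kernel_Fubini (A : T1 -> R) (B : T2 -> R) (K : T1 * T2 -> R) (M : R) :
  m1.-integrable setT (EFin \o A) -> m2.-integrable setT (EFin \o B) ->
  measurable_fun setT K -> (forall z, `|K z| <= M) ->
  Rintegral m1 setT (fun x => A x * Rintegral m2 setT (fun y => B y * K (x, y))) =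
  Rintegral m2 setT (fun y => B y * Rintegral m1 setT (fun x => A x * K (x, y))).
Proof.
move=> iA iB mK KM; have iF := integrable_prod_kernel iA iB mK KM.
have mA : measurable_fun setT A by apply/measurable_EFinP; exact: measurable_int iA.
have mB : measurable_fun setT B by apply/measurable_EFinP; exact: measurable_int iB.
have mK1 x : measurable_fun setT (fun y => K (x, y)) by exact: (measurableT_comp mK).
have mK2 y : measurable_fun setT (fun x => K (x, y)) by exact: (measurableT_comp mK).
transitivity (Rintegral m1 setT (fun x => Rintegral m2 setT (fun y => A x * B y * K (x, y)))).
  apply: eq_Rintegral => x _; rewrite -Rintegral_scale//; last exact: measurable_funM.
  by apply: eq_Rintegral => y _; rewrite mulrA.
rewrite (Rintegral_Fubini iF); apply: eq_Rintegral => y _.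
rewrite -Rintegral_scale; last exact: measurable_funM.
by apply: eq_Rintegral => x _ /=; rewrite mulrCA mulrA.
Qed.

End bounded_kernel.

Section substitution.
Context (R : realType).
Local Notation leb := (@lebesgue_measure R).

(** The hypothesis says that the image under [phi] of the measure [h dx] gives each half-open
    interval its length. By uniqueness of Lebesgue measure that image is Lebesgue measure, so a
    change of variables only requires computing preimages of intervals. *)
Lemma ge0_integral_substitution (phi h : R -> R) :
  measurable_fun setT phi -> measurable_fun setT h -> (forall x, 0 <= h x) ->
  (forall a b, a < b ->
     (\int[leb]_(x in phi @^-1` `]a, b]) (h x)%:E = (b - a)%:E)%E) ->
  forall f : R -> \bar R, (forall x, (0 <= f x)%E) -> measurable_fun setT f ->
  (\int[leb]_x f x = \int[leb]_x (f (phi x) * (h x)%:E))%E.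
Proof.
move=> mphi mh h0 E f f0 mf.
rewrite -(@ge0_integral_mdens _ _ _ leb h mh h0 (f \o phi)); last 2 first.
- by move=> x; exact: f0.
- exact: measurableT_comp.
have := @ge0_integral_pushforward _ _ (measurableTypeR R) (measurableTypeR R) R phi mphi (mdens leb mh h0) setT f measurableT mf.
rewrite preimage_setT => <- //.
apply: eq_measure_integral => A mA _.
apply: lebesgue_measure_unique => //.
move=> _ [[a b]] _ <-; rewrite /= /pushforward.
rewrite lebesgue_measure_itv/= lte_fin.
case: ltP => ab; first by rewrite -EFinB -E.
by rewrite set_itv_ge ?preimage_set0 ?measure0// -leNgt bnd_simp.
Qed.

Lemma ge0_integral_affine (c t : R) (f : R -> \bar R) : c != 0 ->
  (forall x, (0 <= f x)%E) -> measurable_fun setT f ->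
  (\int[leb]_x f x = \int[leb]_x (f (c * x + t)%R * `|c|%:E))%E.
Proof.
move=> c0 f0 mf; apply: (ge0_integral_substitution (phi := fun x => c * x + t) (h := fun=> `|c|)) => //.
  by apply: measurable_funD => //; exact: measurable_funM.
move=> a b ab; rewrite integral_cst//=; last first.
  rewrite -[X in measurable X]setTI.
  by apply: (_ : measurable_fun setT (fun x => c * x + t)) => //; apply: measurable_funD => //; exact: measurable_funM.
have [cp|cn|c00] := ltgtP 0 c; last by rewrite c00 eqxx in c0.
- rewrite (_ : _ @^-1` _ = `](a - t) / c, (b - t) / c]%classic); last first.
    apply/seteqP; split=> x /=; rewrite !in_itv/= ltr_pdivrMr// ler_pdivlMr// ltrBlDr lerBrDr.
      by rewrite mulrC.
    by rewrite mulrC.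
  rewrite lebesgue_measure_itv/= lte_fin ltr_pM2r ?invr_gt0// ltrD2r ab.
  by rewrite -EFinB -EFinM gtr0_norm//; congr EFin; field.
- rewrite (_ : _ @^-1` _ = `[(b - t) / c, (a - t) / c[%classic); last first.
    apply/seteqP; split=> x /=; rewrite !in_itv/= ltr_ndivlMr// ler_ndivrMr// ltrBlDr lerBrDr.
      by rewrite andbC mulrC.
    by rewrite andbC mulrC.
  rewrite lebesgue_measure_itv/= lte_fin ltr_nM2r ?invr_lt0// ltrD2r ab.
  by rewrite -EFinB -EFinM ltr0_norm//; congr EFin; field.
Qed.

Lemma integral_itv_oc_FTC (F f : R -> R) (a b : R) : a < b ->
  (forall x, a <= x <= b -> is_derive x 1 F (f x)) ->
  {within `[a, b], continuous f} ->
  (\int[leb]_(x in `]a, b]) (f x)%:E = (F b - F a)%:E)%E.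
Proof.
move=> ab dF cf.
have mf : measurable_fun `[a, b] f by apply: subspace_continuous_measurable_fun.
rewrite (@integral_itv_obnd_cbnd _ _ (BRight b)); last first.
  apply/measurable_EFinP; apply: measurable_funS mf => //; exact: subset_itv_oc_cc.
have cF x : a <= x <= b -> {for x, continuous F}.
  move=> xab; apply: differentiable_continuous; apply/derivable1_diffP.
  exact: (@ex_derive _ _ _ _ _ _ _ (dF x xab)).
rewrite (@continuous_FTC2 _ f F a b)//; last 2 first.
- split.
  + move=> x; rewrite in_itv/= => /andP[ax xb].
    by apply: (@ex_derive _ _ _ _ _ _ _ (dF x _)); rewrite !ltW.
  + by apply: cvg_at_right_filter; apply: cF; rewrite lexx ltW.
  + by apply: cvg_at_left_filter; apply: cF; rewrite lexx ltW.
- move=> x; rewrite in_itv/= => /andP[ax xb]; rewrite derive1E.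
  by apply: (@derive_val _ _ _ _ _ _ _ (dF x _)); rewrite !ltW.
Qed.

End substitution.

Lemma measurable_sin (R : realType) : measurable_fun setT (@sin R).
Proof. by apply: continuous_measurable_fun; exact: continuous_sin. Qed.

Lemma measurable_cos (R : realType) : measurable_fun setT (@cos R).
Proof. by apply: continuous_measurable_fun; exact: continuous_cos. Qed.

Lemma measurable_sqrtr (R : realType) : measurable_fun setT (@Num.sqrt R).
Proof. by apply: continuous_measurable_fun; exact: sqrt_continuous. Qed.

Lemma measurable_powR_l d (T : measurableType d) (R : realType) (f : T -> R) (p : R) :
  measurable_fun setT f -> measurable_fun setT (fun x => f x `^ p).
Proof. by move=> mf; apply: (measurableT_comp (measurable_powR _)). Qed.

(* Syntax-directed, because the canonical-structure search for measurability is slow on long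
   expressions; a function of two variables is looked up through its uncurried form. *)
Ltac meas := cbv beta; lazymatch goal with
  | |- measurable_fun _ (fun _ => ?c) => exact: measurable_cst
  | |- measurable_fun _ (fun x => x) => exact: measurable_id
  | |- measurable_fun _ (fun z => fst z) => exact: measurable_fst
  | |- measurable_fun _ (fun z => snd z) => exact: measurable_snd
  | |- measurable_fun _ (fun x => GRing.add (@?f x) (@?g x)) =>
      apply: (@measurable_funD _ _ _ _ f g); meas
  | |- measurable_fun _ (fun x => GRing.mul (@?f x) (@?g x)) =>
      apply: (@measurable_funM _ _ _ _ f g); meas
  | |- measurable_fun _ (fun x => GRing.opp (@?f x)) =>
      apply: (@measurableT_comp _ _ _ _ _ _ _ _ f (@oppr_measurable _ _)); meas
  | |- measurable_fun _ (fun x => GRing.exp (@?f x) ?n) =>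
      apply: (@measurable_funX _ _ _ _ f n); meas
  | |- measurable_fun _ (fun x => powR (@?f x) ?p) =>
      apply: (@measurable_powR_l _ _ _ f p); meas
  | |- measurable_fun _ (fun x => expR (@?f x)) =>
      apply: (@measurableT_comp _ _ _ _ _ _ _ _ f (@measurable_expR _)); meas
  | |- measurable_fun _ (fun x => sin (@?f x)) =>
      apply: (@measurableT_comp _ _ _ _ _ _ _ _ f (@measurable_sin _)); meas
  | |- measurable_fun _ (fun x => cos (@?f x)) =>
      apply: (@measurableT_comp _ _ _ _ _ _ _ _ f (@measurable_cos _)); meas
  | |- measurable_fun _ (fun x => Num.sqrt (@?f x)) =>
      apply: (@measurableT_comp _ _ _ _ _ _ _ _ f (@measurable_sqrtr _)); meas
  | |- measurable_fun _ (fun x => Num.norm (@?f x)) =>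
      apply: (@measurableT_comp _ _ _ _ _ _ _ _ f (@normr_measurable _ _)); meas
  | |- measurable_fun _ (fun x => (@?f x, @?g x)) =>
      apply: (@measurable_fun_pair _ _ _ _ _ _ f g); meas
  | |- measurable_fun _ (fun x => EFin (@?f x)) => apply/measurable_EFinP; meas
  | |- measurable_fun _ (fun x => mule (@?f x) (@?g x)) =>
      apply: (@emeasurable_funM _ _ _ _ f g); meas
  | |- measurable_fun _ (fun x => adde (@?f x) (@?g x)) =>
      apply: (@emeasurable_funD _ _ _ _ f g); meas
  | |- measurable_fun _ (fun x => fst (@?f x)) =>
      apply: (@measurableT_comp _ _ _ _ _ _ _ _ f measurable_fst); meas
  | |- measurable_fun _ (fun x => snd (@?f x)) =>
      apply: (@measurableT_comp _ _ _ _ _ _ _ _ f measurable_snd); meas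
  | H : measurable_fun _ (fun z => ?h (fst z) (snd z)) |- measurable_fun _ (fun x => ?h (@?f x) (@?g x)) =>
      let p := eval cbv beta in (fun x => (f x, g x)) in
      apply: (@measurableT_comp _ _ _ _ _ _ _ _ p H); meas
  | H : measurable_fun _ ?h |- measurable_fun _ (fun x => ?h (@?g x)) =>
      apply: (@measurableT_comp _ _ _ _ _ _ _ _ g H); meas
  | H : measurable_fun _ ?h |- measurable_fun _ ?h => exact: H
  | |- measurable_fun _ expR => exact: measurable_expR
  | |- measurable_fun _ sin => exact: measurable_sin
  | |- measurable_fun _ cos => exact: measurable_cos
  | |- measurable_fun _ fst => exact: measurable_fst
  | |- measurable_fun _ snd => exact: measurable_snd
  | |- _ => assumption
  end.

(** * Exponential, tangent and polar coordinates *)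

Section substitutions.
Context (R : realType).
Local Notation leb := (@lebesgue_measure R).

(** As a factor it turns integrals over the half-line into integrals over the whole line, so that
    all measurability and Tonelli arguments take place on [setT]. *)
Definition posind : R -> R := \1_`]0, +oo[.

Lemma measurable_posind : measurable_fun setT posind.
Proof. exact: measurable_indic. Qed.

Lemma posindE x : posind x = (0 < x)%R%:R.
Proof. by rewrite /posind indicE mem_setE in_itv/= andbT. Qed.

Lemma posind_gt0 (x : R) : 0 < x -> posind x = 1. Proof. by rewrite posindE => ->. Qed.

Lemma posind_le0 (x : R) : x <= 0 -> posind x = 0. Proof. by rewrite posindE leNgt; case: (0 < x). Qed.

Lemma posind_ge0 x : 0 <= posind x. Proof. by rewrite posindE. Qed.

Lemma integral_posind (f : R -> \bar R) :
  (\int[leb]_(x in `]0%R, +oo[) f x = \int[leb]_x (f x * (posind x)%:E))%E.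
Proof. by rewrite integral_mkcond epatch_indic. Qed.

Lemma ge0_integral_expR (f : R -> \bar R) : (forall x, (0 <= f x)%E) ->
  measurable_fun setT f ->
  (\int[leb]_x (f x * (posind x)%:E) = \int[leb]_x (f (expR x) * (expR x)%:E))%E.
Proof.
(* The substitution is applied backwards, with [phi = ln] and density [1/x]. The density is cut to 0
   for [x <= 0], where [ln] takes a default value. *)
move=> f0 mf; pose h : R -> R := (fun x : R => x^-1) \_ `]0, +oo[.
have mh : measurable_fun setT h.
  apply/(measurable_restrictT _ _).1 => //; apply: open_continuous_measurable_fun => // x.
  rewrite inE/= in_itv/= andbT => x0.
  by apply: inv_continuous; rewrite gt_eqF.
have h0 x : 0 <= h x.
  by apply: restrict_ge0 => {}x; rewrite /= in_itv/= andbT => /ltW; rewrite invr_ge0.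
rewrite [RHS](@ge0_integral_substitution _ (@ln R) h)//.
- apply: eq_integral => x _; rewrite /h patchE mem_setE in_itv/= andbT posindE.
  have [x0|x0] := ltP 0 x; last by rewrite !mule0.
  by rewrite lnK// -muleA -EFinM divff// gt_eqF.
- move=> a b ab; rewrite -[h]/((fun x : R => x^-1) \_ `]0, +oo[).
  transitivity (\int[leb]_(x in (@ln R) @^-1` `]a, b]) (((fun x : R => (x^-1)%:E) \_ `]0%R, +oo[) x))%E.
    by apply: eq_integral => x _; rewrite !patchE; case: ifP.
  rewrite -integral_mkcondr (_ : _ `&` _ = `]expR a, expR b]%classic); last first.
    apply/seteqP; split=> x /=; rewrite !in_itv/= andbT.
      by move=> [+ x0]; rewrite -ltr_expR -(ler_expR (ln x)) lnK.
    move=> /[dup] + /andP[ax _]; have x0 := lt_trans (expR_gt0 a) ax.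
    by rewrite -{1 2}(lnK x0) ltr_expR ler_expR; split.
  rewrite -{2}(expRK a) -{2}(expRK b); apply: integral_itv_oc_FTC; first by rewrite ltr_expR.
  - by move=> x /andP[ax _]; apply: is_derive1_ln; exact: lt_le_trans (expR_gt0 a) ax.
  - apply: continuous_in_subspaceT => x; rewrite inE/= in_itv/= => /andP[ax _].
    by apply: inv_continuous; rewrite gt_eqF// (lt_le_trans (expR_gt0 a) ax).
- by move=> x; rewrite mule_ge0// lee_fin expR_ge0.
- by meas.
Qed.

Definition hpi : set R := `](- (pi / 2)), (pi / 2)[.

Lemma cos_hpi x : hpi x -> 0 < cos x.
Proof. by rewrite /hpi/= => h; apply: cos_gt0_pihalf; rewrite in_itv/= in h. Qed.

Lemma ge0_integral_tan (f : R -> \bar R) : (forall x, (0 <= f x)%E) ->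
  measurable_fun setT f ->
  (\int[leb]_x f x = \int[leb]_x (f (tan x) * (((fun x : R => cos x ^- 2) \_ hpi) x)%:E))%E.
Proof.
move=> f0 mf; pose h : R -> R := (fun x => cos x ^- 2) \_ hpi.
pose t : R -> R := tan \_ hpi.
have mhpi : measurable hpi by exact: measurable_itv.
have cX x : cos x != 0 -> {for x, continuous (fun x : R => cos x ^- 2)}.
  move=> c0; apply: (@continuousV _ _ (fun x : R => cos x ^+ 2)).
    by rewrite sqrf_eq0.
  apply: (@continuous_comp _ _ _ (@cos R) (fun x => x ^+ 2)); first exact: continuous_cos.
  exact: exprn_continuous.
have mt : measurable_fun setT t.
  apply/(measurable_restrictT _ _).1 => //; apply: open_continuous_measurable_fun => // x.
  by rewrite inE => /cos_hpi c0; apply: continuous_tan; rewrite gt_eqF.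
have mh : measurable_fun setT h.
  apply/(measurable_restrictT _ _).1 => //; apply: open_continuous_measurable_fun => // x.
  by rewrite inE => /cos_hpi c0; apply: cX; rewrite gt_eqF.
have h0 x : 0 <= h x.
  by apply: restrict_ge0 => {}x _; rewrite invr_ge0 sqr_ge0.
rewrite [LHS](@ge0_integral_substitution _ t h)//.
- apply: eq_integral => x _; rewrite /h /t !patchE; case: ifP => //.
  by rewrite !mule0.
- move=> a b ab; rewrite -[h]/((fun x => cos x ^- 2) \_ hpi).
  transitivity (\int[leb]_(x in t @^-1` `]a, b]) (((fun x : R => (cos x ^- 2)%:E) \_ hpi) x))%E.
    by apply: eq_integral => x _; rewrite !patchE; case: ifP.
  rewrite -integral_mkcondr (_ : _ `&` _ = `]atan a, atan b]%classic); last first.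
    apply/seteqP; split=> x /=; rewrite !in_itv/=.
      move=> [+ hx]; rewrite /t patchE mem_set// => /andP[ax xb].
      rewrite -[x](tanK _) ?inE//; apply/andP; split; first exact: lt_atan.
      exact: le_atan.
    move=> /andP[ax xb].
    have hx : hpi x.
      rewrite /hpi /= in_itv/= (lt_trans (atan_gtNpi2 _) ax).
      exact: le_lt_trans xb (atan_ltpi2 _).
    split=> //; rewrite /t patchE mem_set//.
    have xK : atan (tan x) = x by apply: tanK; exact: hx.
    apply/andP; split; rewrite ltNge || rewrite leNgt; apply/negP => h'.
      by have := le_atan h'; rewrite xK leNgt ax.
    by have := lt_atan h'; rewrite xK ltNge xb.
  rewrite -{2}(atanK a) -{2}(atanK b); apply: integral_itv_oc_FTC; first exact: lt_atan.
  - move=> x /andP[ax xb]; apply: is_derive_tan; rewrite gt_eqF// cos_hpi//.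
    rewrite /hpi/= in_itv/= (lt_le_trans (atan_gtNpi2 _) ax).
    exact: le_lt_trans xb (atan_ltpi2 _).
  - apply: continuous_in_subspaceT => x; rewrite inE/= in_itv/= => /andP[ax xb].
    apply: cX; rewrite gt_eqF// cos_hpi//.
    rewrite /hpi/= in_itv/= (lt_le_trans (atan_gtNpi2 _) ax).
    exact: le_lt_trans xb (atan_ltpi2 _).
Qed.

Definition uhalf : R -> R := \1_`]0, pi[.

Lemma uhalfE (x : R) : uhalf x = (0 < x < pi)%R%:R.
Proof. by rewrite /uhalf indicE mem_setE in_itv/=. Qed.

Lemma uhalf_ge0 x : 0 <= uhalf x. Proof. by rewrite uhalfE. Qed.

Lemma measurable_uhalf : measurable_fun setT uhalf.
Proof. exact: measurable_indic. Qed.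

(** Polar coordinates are built from one-variable substitutions and Tonelli: [x = y tan p] at fixed
    [y], then [y = r cos p] at fixed [p], and finally [p = pi/2 - t]. The Jacobian [r] is the
    product of the one-dimensional factors. *)
Lemma polar_half_plane (F : R * R -> \bar R) : (forall z, (0 <= F z)%E) ->
  measurable_fun setT F ->
  (\int[leb]_y \int[leb]_x (F (x, y) * (posind y)%:E) =
   \int[leb]_r \int[leb]_t
     (F (r * cos t, r * sin t)%R * (r * posind r * uhalf t)%:E))%E.
Proof.
move=> F0 mF; have mP := measurable_posind.
pose h : R -> R := (fun x : R => cos x ^- 2) \_ hpi.
have mtan : measurable_fun setT (tan \_ hpi : R -> R).
  apply/(measurable_restrictT _ _).1 => //; first exact: measurable_itv.
  apply: open_continuous_measurable_fun => // x.
  by rewrite inE => /cos_hpi c0; apply: continuous_tan; rewrite gt_eqF.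
have mh : measurable_fun setT h.
  apply/(measurable_restrictT _ _).1 => //; first exact: measurable_itv.
  apply: open_continuous_measurable_fun => // x.
  rewrite inE => /cos_hpi c0; apply: (@continuousV _ _ (fun x : R => cos x ^+ 2)).
    by rewrite sqrf_eq0 gt_eqF.
  apply: (@continuous_comp _ _ _ (@cos R) (fun x => x ^+ 2)); first exact: continuous_cos.
  exact: exprn_continuous.
have h0 x : 0 <= h x.
  by apply: restrict_ge0 => {}x _; rewrite invr_ge0 sqr_ge0.
have ypos0 (y : R) : 0 <= y * posind y.
  by rewrite posindE; case: ltP => [/ltW|]; rewrite ?mulr1 ?mulr0.
pose t : R -> R := tan \_ hpi.
transitivity (\int[leb]_y \int[leb]_p
    (F (y * t p, y)%R * (y * posind y * h p)%:E))%E.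
  apply: eq_integral => y _; have [y0|y0] := ltP 0 y; last first.
    under eq_integral do rewrite posind_le0// mule0.
    by under [RHS]eq_integral do rewrite posind_le0// mulr0 mul0r mule0.
  rewrite [LHS](@ge0_integral_affine _ y 0) ?gt_eqF//; last 2 first.
  - by move=> x; rewrite mule_ge0// lee_fin posind_ge0.
  - by meas.
  rewrite ge0_integral_tan; last 2 first.
  - by move=> x; rewrite !mule_ge0// lee_fin ?posind_ge0.
  - by meas.
  apply: eq_integral => p _; rewrite -/h addr0 /h /t !patchE; case: ifP => // _.
    by rewrite -!muleA -!EFinM gtr0_norm//; congr (_ * _%:E)%E; rewrite mulrCA mulrA.
  by rewrite (_ : point = 0 :> R)// !mulr0 !mule0.
rewrite tonelli; last 2 first.
- by move=> y p; rewrite mule_ge0// lee_fin mulr_ge0.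
- by meas.
(* With [y = r cos p] the point [(y tan p, y)] becomes [(r sin p, r cos p)], and the factors [y],
   [cos p ^- 2] and [cos p] combine to [r]. *)
transitivity (\int[leb]_p \int[leb]_r
    (F (r * sin p, r * cos p)%R * (r * posind r * \1_hpi p)%:E))%E.
  apply: eq_integral => p _; have [hp|nhp] := pselect (hpi p); last first.
    under eq_integral do rewrite /h patchE memNset// mulr0 mule0.
    by under [RHS]eq_integral do rewrite indicE memNset// mulr0 mule0.
  have c0 := cos_hpi hp.
  rewrite [LHS](@ge0_integral_affine _ (cos p) 0) ?gt_eqF//; last 2 first.
  - by move=> x; rewrite mule_ge0// lee_fin mulr_ge0.
  - by meas.
  apply: eq_integral => r _; rewrite addr0 /h /t !patchE indicE !mem_set//.
  rewrite -muleA -EFinM; congr (F _ * _%:E)%E.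
    by congr pair; rewrite /tan; [field|rewrite mulrC]; rewrite ?gt_eqF.
  rewrite (_ : true%:R = 1 :> R)// !posindE pmulr_rgt0// gtr0_norm//; field; by rewrite gt_eqF.
(* The reflection [p = pi/2 - t] exchanges sine and cosine and carries the interval [hpi] onto []0,
   pi[]. *)
rewrite [LHS](@ge0_integral_affine _ (-1) (pi / 2)); last 3 first.
- by rewrite oppr_eq0 oner_eq0.
- by move=> x; apply: integral_ge0 => r _; rewrite mule_ge0// lee_fin mulr_ge0.
- apply: measurable_tonelli1; last first.
    have m1 : measurable_fun setT (\1_hpi : R -> R).
      by apply: measurable_indic; exact: measurable_itv.
    by meas.
  by move=> x y; rewrite mule_ge0// lee_fin mulr_ge0.
rewrite [RHS]tonelli; last 2 first.
- by move=> r p; rewrite mule_ge0// lee_fin mulr_ge0// uhalf_ge0.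
- have m1 := measurable_uhalf; by meas.
apply: eq_integral => p _; rewrite normrN1 mule1.
apply: eq_integral => r _; rewrite mulN1r addrC sinB cosB sin_pihalf cos_pihalf.
rewrite !mul1r !mul0r subr0 add0r; congr (_ * (_ * _)%:E)%E.
rewrite uhalfE indicE mem_setE in_itv/=; congr (_%:R).
by congr nat_of_bool; apply/idP/idP => /andP[? ?]; apply/andP; split; lra.
Qed.

End substitutions.

(** * Gamma and Beta integrals *)

Section Gamma_function.
Context (R : realType).
Local Notation leb := (@lebesgue_measure R).
Implicit Types p q s t x y : R.

Lemma powR_expR x p : 0 < x -> x `^ p = expR (p * ln x).
Proof. by move=> x0; rewrite /powR gt_eqF. Qed.

Lemma powR_exp p x : (expR x) `^ p = expR (p * x).
Proof. by rewrite powR_expR ?expR_gt0// expRK. Qed.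

Lemma ge0_integralZEFin (f : R -> \bar R) (k : R) : (forall x, (0 <= f x)%E) ->
  measurable_fun setT f -> 0 <= k ->
  (\int[leb]_x (k%:E * f x) = k%:E * \int[leb]_x f x)%E.
Proof. by move=> f0 mf k0; rewrite ge0_integralZl// lee_fin. Qed.

Lemma integral_expN_posind : (\int[leb]_x (expR (- x) * posind x)%:E = 1)%E.
Proof.
under eq_integral do rewrite EFinM.
rewrite -integral_posind integral_itv_obnd_cbnd; last first.
  by apply/measurable_funTS; meas.
rewrite (@ge0_continuous_FTC2y _ (fun x => expR (- x)) (fun x => - expR (- x)) 0 0).
- by rewrite oppr0 expR0 sub0e EFinN oppeK.
- by move=> x _; exact: expR_ge0.
- apply: continuous_subspaceT => x.
  apply: (@continuous_comp _ _ _ (@GRing.opp R) (@expR R)); first exact: opp_continuous.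
  exact: continuous_expR.
- rewrite -oppr0; apply: cvgN; exact: cvgr_expR.
- by [].
- apply: cvg_at_right_filter; apply: cvgN.
  apply: (@continuous_comp _ _ _ (@GRing.opp R) (@expR R)); first exact: opp_continuous.
  exact: continuous_expR.
- move=> x _; rewrite derive1E.
  have h : is_derive x 1 (fun x : R => - expR (- x)) (expR (- x)).
    by apply: is_derive_eq; rewrite /GRing.scale/=; ring.
  exact: derive_val.
Qed.

Lemma integral_expN_tail t : (\int[leb]_x (expR (- x) * posind (x - t))%:E = (expR (- t))%:E)%E.
Proof.
have mP := @measurable_posind R.
rewrite (@ge0_integral_affine _ 1 t) ?oner_eq0//; last 2 first.
- by move=> x; rewrite lee_fin mulr_ge0 ?expR_ge0 ?posind_ge0.
- by meas.
transitivity ((expR (- t))%:E * (\int[leb]_x (expR (- x) * posind x)%:E))%E; last first.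
  by rewrite integral_expN_posind mule1.
rewrite -ge0_integralZEFin ?expR_ge0//; last 2 first.
- by move=> x; rewrite lee_fin mulr_ge0 ?expR_ge0 ?posind_ge0.
- by meas.
apply: eq_integral => x _; rewrite normr1 mule1 -EFinM mul1r addrK opprD expRD.
by rewrite (mulrC (expR (- x))) mulrA.
Qed.

Lemma integral_powR_seg p t : 0 < p -> 0 < t ->
  (\int[leb]_x (x `^ (p - 1) * posind (t - x) * posind x)%:E = (t `^ p / p)%:E)%E.
Proof.
move=> p0 t0; have mP := @measurable_posind R.
under eq_integral do rewrite EFinM.
rewrite ge0_integral_expR; last 2 first.
- by move=> x; rewrite lee_fin mulr_ge0 ?powR_ge0 ?posind_ge0.
- by meas.
transitivity (\int[leb]_x (expR (p * x) * posind (ln t - x))%:E)%E.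
  apply: eq_integral => x _; rewrite -EFinM powR_exp mulrAC -expRD mulrBl mul1r subrK.
  by rewrite !posindE !subr_gt0 -[in LHS](lnK t0) ltr_expR.
rewrite (@ge0_integral_affine _ (- p^-1) (ln t)); last 3 first.
- by rewrite oppr_eq0 invr_eq0 gt_eqF.
- by move=> x; rewrite lee_fin mulr_ge0 ?expR_ge0 ?posind_ge0.
- by meas.
transitivity ((t `^ p / p)%:E * (\int[leb]_x (expR (- x) * posind x)%:E))%E; last first.
  by rewrite integral_expN_posind mule1.
rewrite -ge0_integralZEFin//; last 3 first.
- by move=> x; rewrite lee_fin mulr_ge0 ?expR_ge0 ?posind_ge0.
- by meas.
- by rewrite divr_ge0 ?powR_ge0// ltW.
apply: eq_integral => x _; rewrite normrN gtr0_norm ?invr_gt0// -!EFinM.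
rewrite powR_expR// !posindE subr_gt0 mulrDr expRD mulrA mulrN divff ?gt_eqF//.
rewrite mulN1r gtrDr mulNr oppr_lt0 pmulr_rgt0 ?invr_gt0//.
by congr EFin; ring.
Qed.

Lemma square_substitution (f : R -> \bar R) : (forall x, (0 <= f x)%E) ->
  measurable_fun setT f ->
  (\int[leb]_x (f x * (posind x)%:E) =
   \int[leb]_x (f (x ^+ 2)%R * (2 * x * posind x)%:E))%E.
Proof.
move=> f0 mf; have mP := @measurable_posind R.
rewrite ge0_integral_expR//.
transitivity (\int[leb]_x (f (x ^+ 2)%R * (2 * `|x|)%:E * (posind x)%:E))%E; last first.
  apply: eq_integral => x _; rewrite -muleA -EFinM posindE.
  by case: ltP => x0; rewrite ?mulr0// gtr0_norm.
rewrite ge0_integral_expR; last 2 first.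
- by move=> x; rewrite mule_ge0// lee_fin mulr_ge0.
- by meas.
rewrite [LHS](@ge0_integral_affine _ 2 0); last 3 first.
- by rewrite pnatr_eq0.
- by move=> x; rewrite mule_ge0// lee_fin expR_ge0.
- by meas.
apply: eq_integral => x _; rewrite addr0 ger0_norm// ger0_norm ?expR_ge0//.
rewrite mulrC expRM_natr -muleA -EFinM -muleA -EFinM expr2.
by congr (_ * _%:E)%E; ring.
Qed.

Lemma mule_EFin_eq (k r : R) (I : \bar R) : 0 < k -> (k%:E * I = r%:E -> I = (r / k)%:E)%E.
Proof.
move=> k0; case: I => [i| |].
- by rewrite -EFinM => -[<-]; rewrite mulrC mulKf// gt_eqF.
- by rewrite gt0_muley ?lte_fin.
- by rewrite gt0_muleNy ?lte_fin.
Qed.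

(** The extended value of the Gamma integral: identities can be proved for it by Tonelli before the
    integral is known to converge. *)
Definition EGamma p := (\int[leb]_x (x `^ (p - 1) * expR (- x) * posind x)%:E)%E.

Lemma EGamma_ge0 p : (0 <= EGamma p)%E.
Proof.
by apply: integral_ge0 => x _; rewrite lee_fin !mulr_ge0 ?powR_ge0 ?expR_ge0 ?posind_ge0.
Qed.

Lemma GammaE p : Gamma p = fine (EGamma p).
Proof.
by rewrite /Gamma /Rintegral integral_posind; congr fine.
Qed.

Lemma EGammaS p : 0 < p -> EGamma (p + 1) = (p%:E * EGamma p)%E.
Proof.
move=> p0; have mP := @measurable_posind R.
(* On the half-line [x^p] is the integral of [p y^(p - 1)] over [0 < y < x]. Exchanging the order
   leaves the tail of [exp(-x)] beyond [y], which is [exp(-y)]; this replaces integration by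
   parts. *)
pose F x y := (p * y `^ (p - 1) * posind y * (expR (- x) * posind (x - y)))%:E : \bar R.
have F0 x y : (0 <= F x y)%E.
  by rewrite lee_fin !mulr_ge0 ?powR_ge0 ?expR_ge0 ?posind_ge0 ?ltW.
have mF : measurable_fun setT (fun z => F z.1 z.2) by rewrite /F; meas.
transitivity (\int[leb]_x \int[leb]_y F x y)%E.
  apply: eq_integral => x _; rewrite addrK; have [x0|x0] := ltP 0 x; last first.
    rewrite posind_le0// mulr0 integral0_eq// => y _; rewrite /F !posindE.
    rewrite subr_gt0; case: ltP => y0; rewrite ?mulr0 ?mul0r//.
    by rewrite ltNge (le_trans x0 (ltW y0)) !mulr0.
  transitivity ((p * expR (- x))%:E * (\int[leb]_y (y `^ (p - 1) * posind (x - y) * posind y)%:E))%E.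
    rewrite integral_powR_seg// posind_gt0// mulr1 -EFinM; congr EFin; field.
    by rewrite gt_eqF.
  rewrite -ge0_integralZEFin ?mulr_ge0 ?expR_ge0 ?ltW//.
  - by apply: eq_integral => y _; rewrite /F -EFinM; congr EFin; ring.
  - by move=> y; rewrite lee_fin !mulr_ge0 ?powR_ge0 ?posind_ge0.
  - by meas.
rewrite tonelli// -ge0_integralZEFin ?ltW//; last 2 first.
- by move=> x; rewrite lee_fin !mulr_ge0 ?powR_ge0 ?expR_ge0 ?posind_ge0.
- by meas.
apply: eq_integral => y _; under eq_integral do rewrite /F EFinM.
rewrite ge0_integralZEFin; last 3 first.
- by move=> x; rewrite lee_fin !mulr_ge0 ?expR_ge0 ?posind_ge0.
- by meas.
- by rewrite !mulr_ge0 ?powR_ge0 ?posind_ge0 ?ltW.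
by rewrite integral_expN_tail -!EFinM; congr EFin; ring.
Qed.

Lemma EGamma1 : EGamma 1 = 1%E.
Proof.
rewrite /EGamma -[RHS]integral_expN_posind; apply: eq_integral => x _.
by rewrite subrr powRr0 mul1r.
Qed.

Lemma EGamma_nat n : (EGamma n.+1%:R < +oo)%E.
Proof.
elim: n => [|n IH]; first by rewrite EGamma1 ltry.
by rewrite -natr1 EGammaS// lte_mul_pinfty.
Qed.

(** Finiteness at positive integers follows from the recurrence, and for [q >= 1] from
    [x^(q - 1) <= 1 + x^n] with an integer [n >= q - 1]. For [0 < p < 1] the recurrence is read
    backwards: an infinite [EGamma p] would make [EGamma (p + 1)] infinite. *)
Lemma EGamma_lty p : 0 < p -> (EGamma p < +oo)%E.
Proof.
have mP := @measurable_posind R.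
have E1 q : 1 <= q -> (EGamma q < +oo)%E.
  move=> q1; pose n := Num.truncn q.
  have qn : q <= n.+1%:R by rewrite ltW// truncnS_gt.
  apply: (@le_lt_trans _ _ (EGamma 1 + EGamma n.+1%:R)%E); last first.
    by rewrite EGamma1; apply: lte_add_pinfty; [exact: ltry|exact: EGamma_nat].
  rewrite /EGamma -ge0_integralD//=; last 4 first.
  - by move=> x _; rewrite lee_fin !mulr_ge0 ?powR_ge0 ?expR_ge0 ?posind_ge0.
  - by meas.
  - by move=> x _; rewrite lee_fin !mulr_ge0 ?powR_ge0 ?expR_ge0 ?posind_ge0.
  - by meas.
  apply: ge0_le_integral => //.
  - by move=> x _; rewrite lee_fin !mulr_ge0 ?powR_ge0 ?expR_ge0 ?posind_ge0.
  - by meas.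
  - by apply: emeasurable_funD; meas.
  - move=> x _; rewrite -EFinD lee_fin -!mulrDl.
    have [x0|x0] := ltP 0 x; last by rewrite posind_le0// !mulr0.
    rewrite ler_wpM2r ?posind_ge0// ler_wpM2r ?expR_ge0// subrr powRr0.
    have [x1|x1] := leP x 1.
      rewrite ler_wpDr ?powR_ge0// powR_expR// -[leRHS]expR0 ler_expR.
      by rewrite mulr_ge0_le0 ?subr_ge0// ln_le0.
    by rewrite ler_wpDl// ler_powR ?lerD2r// ltW.
move=> p0; have := E1 (p + 1); rewrite lerDr EGammaS// => /(_ (ltW p0)).
have := EGamma_ge0 p; case: (EGamma p) => // [r _ _|_]; first exact: ltry.
by rewrite gt0_muley ?lte_fin.
Qed.

Lemma EGamma_gt0 p : (0 < EGamma p)%E.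
Proof.
have mP := @measurable_posind R.
(* A lower bound of the integrand on [[1, 2]]: there [0 <= ln x <= 2], so
   [x^(p - 1) >= exp(-2 |p - 1|)] whatever the sign of [p - 1]. *)
pose c := expR (- (`|p - 1| * 2)) * expR (- 2).
have c0 : 0 < c by rewrite mulr_gt0 ?expR_gt0.
apply: (@lt_le_trans _ _ (\int[leb]_(x in `[1%R, 2%R]) c%:E)%E).
  rewrite integral_cst//= lebesgue_measure_itv/= lte_fin ltr1n -EFinB -EFinM lte_fin.
  by rewrite mulr_gt0// subr_gt0 ltr1n.
rewrite integral_mkcond; apply: ge0_le_integral => //.
- by move=> x _; rewrite patchE; case: ifP => // _; rewrite lee_fin ltW.
- apply/(measurable_restrictT _ _).1 => //; exact: measurable_itv.
- by meas.
- move=> x _; rewrite patchE mem_setE in_itv/=; case: ifPn => [/andP[x1 x2]|_]; last first.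
    by rewrite lee_fin !mulr_ge0 ?powR_ge0 ?expR_ge0 ?posind_ge0.
  have x0 : 0 < x by rewrite (lt_le_trans _ x1).
  rewrite lee_fin posind_gt0// mulr1 /c ler_pM ?expR_ge0// ?ler_expR ?lerN2//.
  rewrite powR_expR// ler_expR.
  have l0 : 0 <= ln x by rewrite ln_ge0.
  have lx : ln x <= 2.
    by rewrite (le_trans _ x2)// ltW// -ltr_expR lnK// (lt_le_trans _ (expR_ge1Dx _))// ltrDr.
  apply: (@le_trans _ _ (- (`|p - 1| * ln x))).
    by rewrite lerN2 ler_wpM2l.
  by rewrite -mulNr ler_wpM2r// lerNl -normrN ler_norm.
Qed.

Lemma EFin_Gamma p : 0 < p -> (Gamma p)%:E = EGamma p.
Proof. by move=> p0; rewrite GammaE fineK// ge0_fin_numE ?EGamma_ge0// EGamma_lty. Qed.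

Lemma Gamma_gt0 p : 0 < p -> 0 < Gamma p.
Proof. by move=> p0; rewrite -lte_fin EFin_Gamma// EGamma_gt0. Qed.

Lemma Gamma_ge0 p : 0 <= Gamma p.
Proof. by rewrite GammaE fine_ge0// EGamma_ge0. Qed.

Lemma GammaS p : 0 < p -> Gamma (p + 1) = p * Gamma p.
Proof. by move=> p0; rewrite !GammaE EGammaS// fineM// -EFin_Gamma. Qed.

Lemma Gamma_scaled p c : 0 < p -> 0 < c ->
  (\int[leb]_x (x `^ (p - 1) * expR (- (c * x)) * posind x)%:E = (c `^ (- p) * Gamma p)%:E)%E.
Proof.
move=> p0 c0; have mP := @measurable_posind R.
rewrite EFinM EFin_Gamma// /EGamma -ge0_integralZEFin ?powR_ge0//; last 2 first.
- by move=> x; rewrite lee_fin !mulr_ge0 ?powR_ge0 ?expR_ge0 ?posind_ge0.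
- by meas.
rewrite [RHS](@ge0_integral_affine _ c 0) ?gt_eqF//; last 2 first.
- by move=> x; rewrite -EFinM lee_fin !mulr_ge0 ?powR_ge0 ?expR_ge0 ?posind_ge0.
- by meas.
apply: eq_integral => x _; rewrite addr0 -!EFinM gtr0_norm// !posindE pmulr_rgt0//.
case: ltP => x0; rewrite ?mulr0 ?mul0r// !mulr1; congr EFin.
rewrite powRM ?ltW// powRN (_ : c `^ (p - 1) = c `^ p / c); last first.
  by rewrite !powR_expR// mulrBl mul1r expRB lnK.
by field; rewrite !gt_eqF// powR_gt0.
Qed.

Lemma gauss_moment p s : 0 < p -> 0 < s ->
  (\int[leb]_x (x `^ (2 * p - 1) * expR (- (s * x ^+ 2)) * posind x)%:E =
   (2^-1 * s `^ (- p) * Gamma p)%:E)%E.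
Proof.
move=> p0 s0; have mP := @measurable_posind R.
transitivity (2^-1%:E * (\int[leb]_x (x `^ (p - 1) * expR (- (s * x)) * posind x)%:E))%E; last first.
  by rewrite Gamma_scaled// -EFinM mulrA.
under [in RHS]eq_integral do rewrite EFinM.
rewrite square_substitution; last 2 first.
- by move=> x; rewrite lee_fin mulr_ge0 ?powR_ge0 ?expR_ge0.
- by meas.
rewrite -ge0_integralZEFin; last 3 first.
- move=> x; rewrite -EFinM lee_fin; apply: mulr_ge0.
    by rewrite mulr_ge0 ?powR_ge0 ?expR_ge0.
  by rewrite posindE; case: ltP => [/ltW x0|]; rewrite ?mulr0 ?mulr1 ?mulr_ge0.
- by meas.
- by [].
apply: eq_integral => x _; rewrite -!EFinM posindE; case: ltP => x0; rewrite ?mulr0// !mulr1.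
congr EFin; rewrite -[x ^+ 2]powR_mulrn ?ltW// -powRrM.
rewrite (_ : 2 * p - 1 = 2%:R * (p - 1) + 1); last by ring.
rewrite powRD ?(gt_eqF x0) ?implybT//.
by rewrite powRr1 ?ltW//; field.
Qed.

(** Multiplied by [Gamma p], the factor [(1 + x)^(-p)] becomes a Gamma integral in [r]. Integrating
    in [x] first leaves [Gamma b] times [r^(-b)], and then a Gamma integral of order [p - b]. *)
Lemma Beta_second_kind p b : 0 < b -> b < p ->
  (\int[leb]_x (x `^ (b - 1) * (1 + x) `^ (- p) * posind x)%:E =
   (Gamma b * Gamma (p - b) / Gamma p)%:E)%E.
Proof.
move=> b0 bp; have mP := @measurable_posind R.
have p0 : 0 < p by apply: lt_trans bp.
have pb0 : 0 < p - b by rewrite subr_gt0.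
pose F x r := (x `^ (b - 1) * (r `^ (p - 1) * expR (- ((1 + x) * r))) * posind r * posind x)%:E : \bar R.
have F0 x r : (0 <= F x r)%E.
  by rewrite lee_fin !mulr_ge0 ?powR_ge0 ?expR_ge0 ?posind_ge0.
have mF : measurable_fun setT (fun z => F z.1 z.2) by rewrite /F; meas.
have E : (\int[leb]_x \int[leb]_r F x r = (Gamma b * Gamma (p - b))%:E)%E.
  rewrite tonelli// [in RHS]EFinM (EFin_Gamma pb0) -ge0_integralZEFin ?Gamma_ge0//; last 2 first.
  - by move=> x; rewrite lee_fin !mulr_ge0 ?powR_ge0 ?expR_ge0 ?posind_ge0.
  - by meas.
  apply: eq_integral => r _; have [r0|r0] := ltP 0 r; last first.
    rewrite posind_le0// mulr0 mule0; under eq_integral do rewrite /F posind_le0// mulr0 mul0r.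
    by rewrite integral0.
  transitivity ((r `^ (p - 1) * expR (- r))%:E * (\int[leb]_x (x `^ (b - 1) * expR (- (r * x)) * posind x)%:E))%E.
    rewrite -ge0_integralZEFin ?mulr_ge0 ?powR_ge0 ?expR_ge0//; last 2 first.
    - by move=> x; rewrite lee_fin !mulr_ge0 ?powR_ge0 ?expR_ge0 ?posind_ge0.
    - by meas.
    apply: eq_integral => x _; rewrite -EFinM /F posind_gt0// mulrDl mul1r opprD expRD (mulrC x r).
    by congr EFin; ring.
  rewrite Gamma_scaled// -!EFinM posind_gt0// mulr1; congr EFin.
  rewrite (_ : p - b - 1 = (p - 1) + - b); last by ring.
  by rewrite (@powRD _ r (p - 1) (- b)) ?(gt_eqF r0) ?implybT//; ring.
have {}E : ((Gamma p)%:E * (\int[leb]_x (x `^ (b - 1) * (1 + x) `^ (- p) * posind x)%:E) = (Gamma b * Gamma (p - b))%:E)%E.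
  rewrite -E -ge0_integralZEFin ?Gamma_ge0//; last 2 first.
  - by move=> x; rewrite lee_fin !mulr_ge0 ?powR_ge0 ?expR_ge0 ?posind_ge0.
  - by meas.
  apply: eq_integral => x _; have [x0|x0] := ltP 0 x; last first.
    rewrite (posind_le0 x0) mulr0 mule0; under eq_integral do rewrite /F (posind_le0 x0) mulr0.
    by rewrite integral0.
  transitivity ((x `^ (b - 1))%:E * (\int[leb]_r (r `^ (p - 1) * expR (- ((1 + x) * r)) * posind r)%:E))%E.
    by rewrite Gamma_scaled ?addr_gt0// -!EFinM posind_gt0//; congr EFin; ring.
  rewrite -ge0_integralZEFin ?powR_ge0//; last 2 first.
  - by move=> y; rewrite lee_fin !mulr_ge0 ?powR_ge0 ?expR_ge0 ?posind_ge0.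
  - by meas.
  apply: eq_integral => r _; rewrite -EFinM /F (posind_gt0 x0) mulr1.
  by congr EFin; ring.
exact: mule_EFin_eq (Gamma_gt0 p0) E.
Qed.

Lemma integral_even (f : R -> \bar R) : (forall x, (0 <= f x)%E) -> measurable_fun setT f ->
  (forall x, f (- x) = f x) ->
  (\int[leb]_x f x = 2%:E * \int[leb]_x (f x * (posind x)%:E))%E.
Proof.
move=> f0 mf fN; have mP := @measurable_posind R.
have fP0 x : (0 <= f x * (posind x)%:E)%E by rewrite mule_ge0// lee_fin posind_ge0.
have mfP : measurable_fun setT (fun x => f x * (posind x)%:E)%E by meas.
transitivity (\int[leb]_x (f x * (posind x)%:E + f (- x)%R * (posind (- x))%:E))%E.
  apply: ae_eq_integral => //.
    apply: emeasurable_funD => //.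
    apply: (measurableT_comp mfP); exact: oppr_measurable.
  exists [set 0]; split => //; first exact: lebesgue_measure_set1.
  move=> x /= h; apply/eqP/negPn/negP => x0; apply: h => _.
  rewrite !posindE oppr_gt0 fN; case: ltgtP x0 => //= _ _.
    by rewrite mule0 adde0 mule1.
  by rewrite mule0 add0e mule1.
rewrite ge0_integralD//; last by apply: (measurableT_comp mfP); exact: oppr_measurable.
rewrite (_ : 2%:E = 1%:E + 1%:E :> \bar R)%E; last by rewrite -EFinD.
rewrite ge0_muleDl ?lee_fin// !mul1e; congr (_ + _)%E.
rewrite [RHS](@ge0_integral_affine _ (-1) 0) ?oppr_eq0 ?oner_eq0//.
by apply: eq_integral => x _; rewrite mulN1r addr0 normrN1 mule1.
Qed.

(** The integral of [x^(2n) y^(2p) exp(-x^2 - y^2)] over the upper half-plane is computed twice: it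
    factors in Cartesian coordinates, and in polar coordinates it is a Gaussian moment times the
    angular integral. *)
Lemma integral_cos_sin (p : R) n : - 2^-1 < p ->
  (\int[leb]_x (cos x ^+ (2 * n) * sin x `^ (2 * p) * uhalf x)%:E =
   (Gamma (n%:R + 2^-1) * Gamma (p + 2^-1) / Gamma (n%:R + p + 1))%:E)%E.
Proof.
set I := (\int[leb]_x _)%E => p12; have mP := @measurable_posind R; have mU := @measurable_uhalf R.
have p0 : 0 < p + 2^-1 by rewrite -ltrBlDr sub0r.
have n0 : 0 < n%:R + 2^-1 :> R by rewrite ltr_wpDl.
have np0 : 0 < n%:R + p + 1 :> R.
  by have := ler0n R n; lra.
pose F (z : R * R) := (expR (- (z.1 ^+ 2 + z.2 ^+ 2)) * (z.1 ^+ (2 * n) * z.2 `^ (2 * p)))%:E : \bar R.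
have even_ge0 x : 0 <= x ^+ (2 * n) :> R by rewrite exprM exprn_ge0// sqr_ge0.
have F0 z : (0 <= F z)%E by rewrite lee_fin !mulr_ge0 ?expR_ge0 ?powR_ge0.
have mF : measurable_fun setT F by rewrite /F; meas.
have := polar_half_plane F0 mF.
have X0 x : (0 <= (x ^+ (2 * n) * expR (- x ^+ 2))%:E)%E by rewrite lee_fin mulr_ge0 ?expR_ge0.
have mX : measurable_fun setT (fun x : R => (x ^+ (2 * n) * expR (- x ^+ 2))%:E) by meas.
have XE : (\int[leb]_x (x ^+ (2 * n) * expR (- x ^+ 2))%:E = (Gamma (n%:R + 2^-1))%:E)%E.
  rewrite integral_even//; last by move=> x; rewrite sqrrN exprM sqrrN -exprM.
  have -> : (\int[leb]_x ((x ^+ (2 * n) * expR (- x ^+ 2))%:E * (posind x)%:E) =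
      \int[leb]_x (x `^ (2 * (n%:R + 2^-1) - 1) * expR (- (1 * x ^+ 2)) * posind x)%:E)%E.
    apply: eq_integral => x _; rewrite -EFinM posindE; case: ltP => x0; rewrite ?mulr0// !mulr1.
    rewrite mul1r (_ : 2 * (n%:R + 2^-1) - 1 = (2 * n)%:R); last by rewrite natrM; field.
    by rewrite powR_mulrn// ltW.
  by rewrite gauss_moment// powR1 -EFinM mulr1 mulrA divff// mul1r.
have -> : (\int[leb]_y \int[leb]_x (F (x, y) * (posind y)%:E) =
    (2^-1 * (Gamma (n%:R + 2^-1) * Gamma (p + 2^-1)))%:E)%E.
  transitivity (\int[leb]_y ((Gamma (n%:R + 2^-1))%:E * (y `^ (2 * (p + 2^-1) - 1) * expR (- (1 * y ^+ 2)) * posind y)%:E))%E.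
    apply: eq_integral => y _; rewrite -XE muleC -ge0_integralZEFin; last 3 first.
    - by [].
    - by [].
    - by rewrite !mulr_ge0 ?powR_ge0 ?expR_ge0 ?posind_ge0.
    apply: eq_integral => x _; rewrite /F/= -!EFinM mul1r opprD expRD.
    by rewrite (_ : 2 * (p + 2^-1) - 1 = 2 * p); [congr EFin; ring|field].
  rewrite ge0_integralZEFin ?Gamma_ge0//; last 2 first.
  - by move=> y; rewrite lee_fin !mulr_ge0 ?powR_ge0 ?expR_ge0 ?posind_ge0.
  - by meas.
  by rewrite gauss_moment// powR1 -EFinM; congr EFin; ring.
have I0 : (0 <= I)%E.
  apply: integral_ge0 => x _; rewrite lee_fin mulr_ge0 ?uhalf_ge0// mulr_ge0 ?powR_ge0//.
have -> : (\int[leb]_r \int[leb]_t (F ((r * cos t)%R, (r * sin t)%R) * (r * posind r * uhalf t)%:E) =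
   (2^-1 * Gamma (n%:R + p + 1))%:E * I)%E.
  transitivity (\int[leb]_r (I * (r `^ (2 * (n%:R + p + 1) - 1) * expR (- (1 * r ^+ 2)) * posind r)%:E))%E.
    apply: eq_integral => r _; rewrite muleC -ge0_integralZEFin; last 3 first.
    - move=> x; rewrite lee_fin mulr_ge0 ?uhalf_ge0// mulr_ge0 ?powR_ge0//.
    - by meas.
    - by rewrite !mulr_ge0 ?powR_ge0 ?expR_ge0 ?posind_ge0.
    apply: eq_integral => t _; rewrite /F/= -!EFinM; congr EFin.
    rewrite posindE; case: ltP => r0; last by rewrite !(mulr0, mul0r).
    rewrite uhalfE; case: (boolP (0 < t < pi)) => [/andP[t0 tpi]|_]; last by rewrite !mulr0.
    have s0 : 0 < sin t by apply: sin_gt0_pi; rewrite t0.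
    rewrite !exprMn -mulrDr cos2Dsin2 mulr1 mul1r powRM ?ltW//.
    rewrite (_ : 2 * (n%:R + p + 1) - 1 = (2 * n)%:R + 2 * p + 1); last by rewrite natrM; ring.
    rewrite (@powRD _ r (_ + _) 1) ?(gt_eqF r0) ?implybT//.
    rewrite (@powRD _ r (_ %:R) _) ?(gt_eqF r0) ?implybT// powR_mulrn ?ltW// powRr1 ?ltW//.
    by rewrite !mulr1; ring.
  rewrite ge0_integralZl//; last 2 first.
  - by meas.
  - by move=> y _; rewrite lee_fin !mulr_ge0 ?powR_ge0 ?expR_ge0 ?posind_ge0.
  by rewrite gauss_moment// powR1 mulr1 muleC.
have c0 : 0 < 2^-1 * Gamma (n%:R + p + 1) :> R by rewrite mulr_gt0 ?invr_gt0// Gamma_gt0.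
move=> /esym/(mule_EFin_eq c0) ->; congr EFin.
by rewrite invfM invrK mulrACA mulVf ?mul1r.
Qed.

End Gamma_function.

(** * Cauchy products and a Chu-Vandermonde sum *)

Section Cauchy_product.
Context (R : realType).
Implicit Types u v : nat -> R.

Definition cauchy_conv u v n := \sum_(k < n.+1) u k * v (n - k)%N.

Lemma series_cauchy_conv u v N : \sum_(n < N) cauchy_conv u v n =
  \sum_(k < N) \sum_(l < N | (k + l < N)%N) u k * v l.
Proof.
under eq_bigr do rewrite /cauchy_conv.
transitivity (\sum_(n < N) \sum_(k < N | (k <= n)%N) u k * v (n - k)%N).
  apply: eq_bigr => n _.
  rewrite (big_ord_widen_cond N xpredT (fun k => u k * v (n - k)%N))//.
rewrite (exchange_big_dep xpredT)//=; apply: eq_bigr => k _.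
rewrite -(big_mkord (fun n => k <= n)%N (fun n => u k * v (n - k)%N)).
rewrite -(big_mkord (fun l => k + l < N)%N (fun l => u k * v l)).
rewrite (@big_cat_nat _ _ _ k)//=; last exact: ltnW.
rewrite big_nat_cond big1 ?add0r; last by move=> i /andP[/andP[_ ik]]; rewrite leqNgt ik.
rewrite [RHS](@big_cat_nat _ _ _ (N - k))//=; last exact: leq_subr.
rewrite [X in _ = _ + X]big_nat_cond [X in _ = _ + X]big1 ?addr0; last first.
  by move=> i /andP[/andP[Ni _]]; rewrite -ltn_subRL ltnNge Ni.
rewrite -{1}(add0n k) big_addn.
rewrite big_nat_cond [RHS]big_nat_cond; apply: eq_big => i.
  by rewrite leq_addl andbT -ltn_subRL /= andbb.
by rewrite addnK.
Qed.

Lemma cauchy_conv_ge0 u v n : (forall k, 0 <= u k) -> (forall k, 0 <= v k) -> 0 <= cauchy_conv u v n.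
Proof. by move=> u0 v0; apply: sumr_ge0 => k _; rewrite mulr_ge0. Qed.

(** The error between the product of partial sums (a square of indices) and the partial sum of the
    convolution (a triangle) is at most the same error for absolute values. The latter tends to 0,
    since the square lies between two triangles. *)
Lemma Cauchy_product u v (su sv : R) :
  (exists M : R, forall N, \sum_(n < N) `|u n| <= M) ->
  (exists M : R, forall N, \sum_(n < N) `|v n| <= M) ->
  (\sum_(n < N) u n) @[N --> \oo] --> su ->
  (\sum_(n < N) v n) @[N --> \oo] --> sv ->
  (\sum_(n < N) cauchy_conv u v n) @[N --> \oo] --> su * sv.
Proof.
move=> [Mu hu] [Mv hv] cu cv.
pose U N : R := \sum_(n < N) `|u n|; pose V N : R := \sum_(n < N) `|v n|.
pose W N : R := \sum_(n < N) cauchy_conv (fun k => `|u k|) (fun k => `|v k|) n.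
have ndU : {homo U : n m / (n <= m)%N >-> n <= m}.
  by move=> n m nm; rewrite /U -(subnKC nm) big_split_ord/= lerDl sumr_ge0.
have ndV : {homo V : n m / (n <= m)%N >-> n <= m}.
  by move=> n m nm; rewrite /V -(subnKC nm) big_split_ord/= lerDl sumr_ge0.
have cU : cvgn U.
  by apply: nondecreasing_is_cvgn => //; exists Mu => _ [N _ <-]; exact: hu.
have cV : cvgn V.
  by apply: nondecreasing_is_cvgn => //; exists Mv => _ [N _ <-]; exact: hv.
have prodE (a b : nat -> R) N : (\sum_(n < N) a n) * (\sum_(n < N) b n) =
    \sum_(k < N) \sum_(l < N) a k * b l.
  by rewrite mulr_suml; apply: eq_bigr => k _; rewrite mulr_sumr.
have WUV N : W N <= U N * V N.
  rewrite (prodE (fun k => `|u k|) (fun k => `|v k|) N) /W series_cauchy_conv; apply: ler_sum => k _.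
  by rewrite big_mkcond; apply: ler_sum => l _; case: ifP => // _; rewrite mulr_ge0.
(* The square of side [N] is contained in the triangle of side [2N]; with [WUV] this forces [W] and
   [U V] to have the same limit. *)
have UVW N : U N * V N <= W (N + N)%N.
  rewrite (prodE (fun k => `|u k|) (fun k => `|v k|) N) /W series_cauchy_conv.
  rewrite big_split_ord/= ler_wpDr//.
    by apply: sumr_ge0 => k _; apply: sumr_ge0 => l _; rewrite mulr_ge0.
  apply: ler_sum => k _; rewrite [leRHS]big_split_ord/= ler_wpDr//.
    by apply: sumr_ge0 => l _; rewrite mulr_ge0.
  rewrite [leRHS](eq_bigl xpredT)// => l /=.
  by rewrite -addnS leq_add// ltnW.
have W0 : U N * V N - W N @[N --> \oo] --> 0.
  have cUV : U N * V N @[N --> \oo] --> limn U * limn V by apply: cvgM.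
  have ndW : {homo W : n m / (n <= m)%N >-> n <= m}.
    move=> n m nm; rewrite /W -(subnKC nm) big_split_ord/= lerDl sumr_ge0// => i _.
    exact: cauchy_conv_ge0.
  have cW : cvgn W.
    apply: nondecreasing_is_cvgn => //; exists (Mu * Mv) => _ [N _ <-].
    by apply: le_trans (WUV N) _; apply: ler_pM; [exact: sumr_ge0|exact: sumr_ge0|exact: hu|exact: hv].
  have c2 : W (N + N)%N @[N --> \oo] --> limn W.
    apply: (@cvg_comp _ _ _ (fun N => N + N)%N W) cW.
    apply/cvgnyPge => A; near=> N; rewrite (leq_trans _ (leq_addr _ _))//.
    by near: N; exact: nbhs_infty_ge.
  have E : limn W = limn U * limn V.
    apply/eqP; rewrite eq_le; apply/andP; split.
      by apply: ler_cvg_to cW cUV _; apply: nearW.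
    by apply: ler_cvg_to cUV c2 _; apply: nearW.
  rewrite -(subrr (limn U * limn V)) -{2}E; apply: cvgB => //.
have cuv : (\sum_(n < N) u n) * (\sum_(n < N) v n) @[N --> \oo] --> su * sv by apply: cvgM.
rewrite -[su * sv]subr0.
apply: (@cvg_trans _ ((fun N => (\sum_(n < N) u n) * (\sum_(n < N) v n) -
   ((\sum_(n < N) u n) * (\sum_(n < N) v n) - \sum_(n < N) cauchy_conv u v n)) @ \oo)).
  by apply: near_eq_cvg; apply: nearW => N; rewrite opprB addrC subrK.
apply: cvgB => //; apply/cvgr0Pnorm_lt => e e0.
move/cvgr0Pnorm_lt : W0 => /(_ e e0); apply: filterS => N; apply: le_lt_trans.
have WN : 0 <= U N * V N - W N by rewrite subr_ge0.
rewrite (ger0_norm WN) (prodE (fun k => `|u k|) (fun k => `|v k|) N) /W !series_cauchy_conv prodE -!sumrB.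
apply: le_trans (ler_norm_sum _ _ _) _; apply: ler_sum => k _.
rewrite [X in `|_ - X|]big_mkcond/= -sumrB [X in _ <= _ - X]big_mkcond/= -sumrB.
apply: le_trans (ler_norm_sum _ _ _) _; apply: ler_sum => l _.
by case: ifP => _; rewrite ?subrr ?normr0// !subr0 normrM.
Unshelve. all: by end_near. Qed.

End Cauchy_product.

Section Gamma_Vandermonde.
Context (R : realType).

(** The Chu-Vandermonde identity in Gamma form, by induction on [k]. Pascal's rule splits the sum
    into the case [k] with the same parameters and, after a shift of [m], the case [k] with [a]
    raised and [l] lowered by one; [GammaS] recombines the two. *)
Lemma Gamma_Vandermonde (a : R) k l : 0 < a ->
  \sum_(m < k.+1) 'C(k, m)%:R * (l ^_ m)%:R / Gamma (a + m%:R) =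
  Gamma (a + (k + l)%:R) / (Gamma (a + k%:R) * Gamma (a + l%:R)).
Proof.
elim: k l a => [|k IH] l a a0.
  have G1 : Gamma (a + 0%:R) != 0 by rewrite gt_eqF// Gamma_gt0// ltr_wpDr.
  have G2 : Gamma (a + l%:R) != 0 by rewrite gt_eqF// Gamma_gt0// ltr_wpDr.
  rewrite big_ord1 bin0 ffactn0 add0n /=; move: (Gamma (a + 0%:R)) (Gamma (a + l%:R)) G1 G2.
  by move=> x y x0 y0; field; rewrite ?x0 ?y0.
have a0' m : 0 < a + m%:R by rewrite ltr_wpDr.
rewrite big_ord_recl/= bin0 ffactn0.
under eq_bigr do rewrite /bump/= add1n binS natrD mulrDl mulrDl.
rewrite big_split/= addrA.
have -> : 1%:R * 1%:R / Gamma (a + 0%:R) + \sum_(i < k.+1) 'C(k, i.+1)%:R * (l ^_ i.+1)%:R / Gamma (a + i.+1%:R) =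
   \sum_(m < k.+1) 'C(k, m)%:R * (l ^_ m)%:R / Gamma (a + m%:R).
  rewrite big_ord_recr/= bin_small// !mul0r [X in _ + X = _]addr0.
  by rewrite [RHS]big_ord_recl/= bin0 ffactn0.
rewrite IH//.
case: l => [|l].
  rewrite big1 ?addr0; last by move=> i _; rewrite ffact0n mulr0 mul0r.
  have G1 := Gamma_gt0 (a0' k); have G2 := Gamma_gt0 (a0' k.+1).
  have G3 := Gamma_gt0 a0; move: G1 G2 G3; rewrite !addn0 ?addr0.
  move: (Gamma (a + k%:R)) (Gamma (a + k.+1%:R)) (Gamma a) => x y z x0 y0 z0.
  by field; rewrite ?(gt_eqF x0) ?(gt_eqF y0) ?(gt_eqF z0).
have -> : \sum_(i < k.+1) 'C(k, i)%:R * (l.+1 ^_ i.+1)%:R / Gamma (a + i.+1%:R) =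
   l.+1%:R * \sum_(m < k.+1) 'C(k, m)%:R * (l ^_ m)%:R / Gamma ((a + 1) + m%:R).
  rewrite mulr_sumr; apply: eq_bigr => i _; rewrite ffactSS natrM -addrA nat1r; ring.
rewrite IH ?addr_gt0//.
have e1 : a + 1 + (k + l)%:R = a + (k + l.+1)%:R by rewrite addnS -natr1; ring.
have e2 : a + 1 + k%:R = a + k%:R + 1 by ring.
have e3 : a + 1 + l%:R = a + l.+1%:R by rewrite -natr1; ring.
have e4 : a + k.+1%:R = a + k%:R + 1 by rewrite -natr1; ring.
have e5 : a + (k.+1 + l.+1)%:R = a + (k + l.+1)%:R + 1 by rewrite addSn -natr1; ring.
rewrite e1 e2 e3 e4 e5 !GammaS//.
have G1 : Gamma (a + k%:R) != 0 by rewrite gt_eqF// Gamma_gt0.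
have G2 : Gamma (a + l.+1%:R) != 0 by rewrite gt_eqF// Gamma_gt0.
move: (Gamma (a + k%:R)) (Gamma (a + l.+1%:R)) (Gamma (a + (k + l.+1)%:R)) G1 G2 => x y z x0 y0.
have k0 : a + k%:R != 0 by rewrite gt_eqF.
by rewrite natrD; field; rewrite x0 y0 k0.
Qed.

End Gamma_Vandermonde.

Lemma measurable_ord_sum d (T : measurableType d) (R : realType) (f_ : nat -> T -> R) N :
  (forall n, measurable_fun setT (f_ n)) -> measurable_fun setT (fun x => \sum_(n < N) f_ n x).
Proof.
move=> mf; elim: N => [|N IH].
  by under eq_fun do rewrite big_ord0; exact: measurable_cst.
by under eq_fun do rewrite big_ord_recr/=; exact: measurable_funD.
Qed.

Section dominated_real.
Context d (T : measurableType d) (R : realType).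
Variable mu : {measure set T -> \bar R}.

Lemma Rintegral_dominated_cvg (f_ : nat -> T -> R) (f G : T -> R) :
  (forall n, measurable_fun setT (f_ n)) -> measurable_fun setT f ->
  (forall x, f_ n x @[n --> \oo] --> f x) ->
  mu.-integrable setT (EFin \o G) -> (forall n x, `|f_ n x| <= G x) ->
  Rintegral mu setT (f_ n) @[n --> \oo] --> Rintegral mu setT f.
Proof.
move=> mf_ mf cf iG fG.
have cE : {ae mu, forall x, setT x -> (fun n => (f_ n x)%:E) @ \oo --> (f x)%:E}.
  by apply: aeW => x _; apply: cvg_EFin; [exact: nearW|exact: cf].
have fE : {ae mu, forall x n, setT x -> (`|(f_ n x)%:E| <= (EFin \o G) x)%E}.
  by apply: aeW => x n _ /=; rewrite lee_fin.
have mE n : measurable_fun setT (fun x => (f_ n x)%:E) by apply/measurable_EFinP.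
have mfE : measurable_fun setT (fun x => (f x)%:E) by apply/measurable_EFinP.
have [i1 _ h] := dominated_convergence measurableT mE mfE cE iG fE.
by apply: fine_cvg; rewrite fineK//; exact: integrable_fin_num.
Qed.

Lemma Rintegral_sum (f_ : nat -> T -> R) N : (forall n, mu.-integrable setT (EFin \o f_ n)) ->
  Rintegral mu setT (fun x => \sum_(n < N) f_ n x) = \sum_(n < N) Rintegral mu setT (f_ n).
Proof.
move=> i_.
have iN M : mu.-integrable setT (EFin \o (fun x => \sum_(n < M) f_ n x)).
  elim: M => [|M IH].
    rewrite (_ : EFin \o _ = cst 0%E); first exact: integrable0.
    by apply/funext => x /=; rewrite big_ord0.
  have := integrableD measurableT IH (i_ M); apply: eq_integrable => // x _ /=.
  by rewrite big_ord_recr.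
elim: N => [|N IH].
  by under eq_Rintegral do rewrite big_ord0; rewrite big_ord0 /Rintegral integral0.
under eq_Rintegral do rewrite big_ord_recr/=.
by rewrite (RintegralD measurableT (iN N) (i_ N)) IH big_ord_recr.
Qed.

End dominated_real.

Section even_power_series.
Context (R : realType).
Implicit Types x y z : R.

Lemma sum_even_le_exp y N : 0 <= y -> \sum_(n < N) y ^+ (2 * n) / (2 * n)`!%:R <= expR y.
Proof.
move=> y0.
have H M : \sum_(n < M) y ^+ n / n`!%:R <= expR y.
  rewrite /expR -(big_mkord xpredT (fun n => y ^+ n / n`!%:R)).
  apply: (@nondecreasing_cvgn_le _ (series (exp_coeff y))).
    apply: nondecreasing_series => n _ _; rewrite /exp_coeff/=.
    by rewrite divr_ge0 ?exprn_ge0.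
  exact: is_cvg_series_exp_coeff.
apply: le_trans (H (2 * N)%N).
elim: N => [|N IH]; first by rewrite muln0 !big_ord0.
rewrite mulnS !big_ord_recr/= ler_wpDr ?divr_ge0 ?exprn_ge0//.
by rewrite lerD.
Qed.

End even_power_series.

(** * The Bessel function and its product formula *)

Section sine_measure.
Context (R : realType) (alpha : R).
Local Notation leb := (@lebesgue_measure R).
Hypothesis ha : - 2^-1 < alpha.

(** The factor [posind] is essential: powers of negative numbers do not vanish here. The measure
    built from this weight lives on the whole line but only sees [x > 0]. *)
Definition hankel_weight (x : R) := mu_dens alpha x * posind x.

Lemma measurable_hankel_weight : measurable_fun setT hankel_weight.
Proof.
rewrite /hankel_weight /mu_dens; have mP := @measurable_posind R; meas.
Qed.

Lemma hankel_weight_ge0 x : 0 <= hankel_weight x.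
Proof.
by rewrite /hankel_weight /mu_dens mulr_ge0 ?posind_ge0// divr_ge0 ?powR_ge0// mulr_ge0 ?powR_ge0 ?Gamma_ge0.
Qed.

Definition sine_const : R := Gamma (alpha + 1) / (Gamma 2^-1 * Gamma (alpha + 2^-1)).

(** The density of the normalised angular law. Both the Bessel function and the Hankel translation
    are averages against it, which is what ties them together. *)
Definition sine_weight (t : R) := sine_const * sin t `^ (2 * alpha) * uhalf t.

Lemma measurable_sine_weight : measurable_fun setT sine_weight.
Proof. rewrite /sine_weight; have mP := @measurable_uhalf R; meas. Qed.

Lemma sine_const_ge0 : 0 <= sine_const.
Proof. by rewrite divr_ge0 ?mulr_ge0 ?Gamma_ge0. Qed.

Lemma sine_weight_ge0 x : 0 <= sine_weight x.
Proof. by rewrite /sine_weight mulr_ge0 ?uhalf_ge0// mulr_ge0 ?powR_ge0// sine_const_ge0. Qed.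

Definition hankel_measure : {sigma_finite_measure set (measurableTypeR R) -> \bar R} :=
  mdens leb measurable_hankel_weight hankel_weight_ge0.

Definition sine_measure : {sigma_finite_measure set (measurableTypeR R) -> \bar R} :=
  mdens leb measurable_sine_weight sine_weight_ge0.

Local Notation mA := hankel_measure.
Local Notation mS := sine_measure.

Lemma ge0_integral_hankel (f : R -> \bar R) : (forall x, (0 <= f x)%E) ->
  measurable_fun setT f -> (\int[mA]_x f x = \int[leb]_x (f x * (hankel_weight x)%:E))%E.
Proof. exact: (@ge0_integral_mdens _ (measurableTypeR R) R leb _ measurable_hankel_weight hankel_weight_ge0 f). Qed.

Lemma ge0_integral_sine (f : R -> \bar R) : (forall x, (0 <= f x)%E) ->
  measurable_fun setT f -> (\int[mS]_x f x = \int[leb]_x (f x * (sine_weight x)%:E))%E.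
Proof. exact: (@ge0_integral_mdens _ (measurableTypeR R) R leb _ measurable_sine_weight sine_weight_ge0 f). Qed.

Lemma Rintegral_hankel (f : R -> R) : measurable_fun setT f ->
  Rintegral mA setT f = Rintegral leb setT (fun x => f x * hankel_weight x).
Proof. exact: (@Rintegral_mdens _ (measurableTypeR R) R leb _ measurable_hankel_weight hankel_weight_ge0 f). Qed.

Lemma Rintegral_sine (f : R -> R) : measurable_fun setT f ->
  Rintegral mS setT f = Rintegral leb setT (fun x => f x * sine_weight x).
Proof. exact: (@Rintegral_mdens _ (measurableTypeR R) R leb _ measurable_sine_weight sine_weight_ge0 f). Qed.

Lemma integrable_hankel (f : R -> R) : measurable_fun setT f ->
  mA.-integrable setT (EFin \o f) <->
  leb.-integrable setT (fun x => (f x * hankel_weight x)%:E).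
Proof. exact: (@integrable_mdens _ (measurableTypeR R) R leb _ measurable_hankel_weight hankel_weight_ge0 f). Qed.

Let a0 : 0 < alpha + 2^-1. Proof. by rewrite -ltrBlDr sub0r. Qed.
Let a1 : 0 < alpha + 1. Proof. by move: a0; lra. Qed.
Let an n : 0 < n%:R + alpha + 1. Proof. by have := ler0n R n; move: a0; lra. Qed.

Definition cos_moment n : R := Gamma (n%:R + 2^-1) * Gamma (alpha + 1) / (Gamma 2^-1 * Gamma (n%:R + alpha + 1)).

Lemma integral_cos_moment n :
  (\int[mS]_t (cos t ^+ (2 * n))%:E = (cos_moment n)%:E)%E.
Proof.
have mU := @measurable_uhalf R.
have c0 (t : R) : 0 <= cos t ^+ (2 * n) by rewrite exprM exprn_ge0// sqr_ge0.
rewrite ge0_integral_sine; last 2 first.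
- by move=> t; rewrite lee_fin.
- by meas.
transitivity (sine_const%:E * (\int[leb]_x (cos x ^+ (2 * n) * sin x `^ (2 * alpha) * uhalf x)%:E))%E.
  rewrite -ge0_integralZEFin ?sine_const_ge0//; last 2 first.
  - by move=> t; rewrite lee_fin !mulr_ge0 ?powR_ge0 ?uhalf_ge0.
  - by meas.
  by apply: eq_integral => t _; rewrite -!EFinM /sine_weight; congr EFin; ring.
rewrite integral_cos_sin// -EFinM /sine_const /cos_moment; congr EFin.
have : Gamma (alpha + 2^-1) != 0 by rewrite gt_eqF// Gamma_gt0.
have : Gamma (n%:R + alpha + 1) != 0 by rewrite gt_eqF// Gamma_gt0.
have : Gamma (2^-1 : R) != 0 by rewrite gt_eqF// Gamma_gt0.
move: (Gamma (alpha + 2^-1)) (Gamma (n%:R + alpha + 1)) (Gamma (n%:R + 2^-1)) (Gamma (2^-1)) (Gamma (alpha + 1)).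
by move=> x y z v w v0 y0 x0; field; rewrite x0 y0 v0.
Qed.

Lemma cos_moment0 : cos_moment 0 = 1.
Proof.
rewrite /cos_moment !add0r divff// mulf_neq0// gt_eqF// Gamma_gt0//.
Qed.

(** The moment of order 0: the angular law is a probability measure, which gives all uniform bounds
    below. *)
Lemma mS_setT : mS setT = 1%E.
Proof.
have := integral_cos_moment 0; rewrite cos_moment0 => <-.
by rewrite -[LHS]mul1e -integral_cst.
Qed.

Lemma integrable_mS (f : R -> R) : measurable_fun setT f ->
  (exists M : R, forall x, `|f x| <= M) -> mS.-integrable setT (EFin \o f).
Proof.
move=> mf [M fM]; apply: measurable_bounded_integrable => //.
  by apply: (@le_lt_trans _ _ 1%E); [rewrite le_eqVlt; apply/orP; left; apply/eqP; exact: mS_setT|exact: ltry].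
exists M; split; first exact: num_real.
by move=> x Mx y _ /=; rewrite (le_trans (fM y))// ltW.
Qed.

Lemma Rintegral_mS_cst (c : R) : Rintegral mS setT (fun=> c) = c.
Proof. by rewrite Rintegral_cst// [X in fine X](_ : _ = 1%E) ?mulr1//; exact: mS_setT. Qed.

Lemma le_Rintegral_mS (f : R -> R) (M : R) : measurable_fun setT f ->
  (forall x, `|f x| <= M) -> `|Rintegral mS setT f| <= M.
Proof.
move=> mf fM; have iF : mS.-integrable setT (EFin \o f) by apply: integrable_mS => //; exists M.
apply: le_trans (le_normr_Rintegral _ iF) _ => //.
rewrite -[leRHS](Rintegral_mS_cst M); apply: le_Rintegral => //.
- by apply: integrable_mS; [exact: measurableT_comp|exists M => x; rewrite normr_id].
- by apply: integrable_mS => //; exists `|M|.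
Qed.

Lemma Rintegral_cos_moment n : Rintegral mS setT (fun t => cos t ^+ (2 * n)) = cos_moment n.
Proof. by rewrite /Rintegral integral_cos_moment. Qed.

Lemma norm_cos_le1 (x : R) : `|cos x| <= 1.
Proof. by rewrite ler_norml cos_geN1 cos_le1. Qed.

Lemma cos_moment_ge0 n : 0 <= cos_moment n.
Proof. by rewrite divr_ge0 ?mulr_ge0 ?Gamma_ge0. Qed.

Lemma cos_moment_le1 n : cos_moment n <= 1.
Proof.
rewrite -[leLHS]ger0_norm ?cos_moment_ge0// -Rintegral_cos_moment.
apply: le_Rintegral_mS; first by meas.
by move=> x; rewrite normrX exprn_ile1 ?norm_cos_le1.
Qed.

(** The map [t -> pi - t] preserves [sin] and []0, pi[]; it changes the sign of [cos], so the odd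
    moments of the cosine vanish. *)
Lemma sine_measure_reflect (F : R -> R) : measurable_fun setT F ->
  Rintegral mS setT F = Rintegral mS setT (fun t => F (pi - t)).
Proof.
move=> mF; have mw := measurable_sine_weight.
have H (G : R -> \bar R) : (forall x, (0 <= G x)%E) -> measurable_fun setT G ->
    (\int[mS]_x G x = \int[mS]_x G (pi - x)%R)%E.
  move=> G0 mG; rewrite ge0_integral_sine// ge0_integral_sine//; last by meas.
  rewrite [LHS](@ge0_integral_affine _ (-1) pi); last 3 first.
  - by rewrite oppr_eq0 oner_eq0.
  - by move=> x; rewrite mule_ge0// lee_fin sine_weight_ge0.
  - by meas.
  apply: eq_integral => x _; rewrite normrN1 mule1 mulN1r addrC /sine_weight.
  rewrite (_ : sin (pi - x) = sin x); last by rewrite sinB sinpi cospi mul0r sub0r mulN1r opprK.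
  rewrite !uhalfE (_ : (0 < pi - x < pi)%R = (0 < x < pi)%R)//.
  by apply/idP/idP => /andP[? ?]; apply/andP; split; lra.
rewrite /Rintegral integralE [in RHS]integralE; congr (fine (_ - _)%E).
- rewrite H//; last by apply: measurable_funepos; exact/measurable_EFinP.
  by apply: eq_integral => x _; rewrite !funeposE.
- rewrite H//; last by apply: measurable_funeneg; exact/measurable_EFinP.
  by apply: eq_integral => x _; rewrite !funenegE.
Qed.

Lemma Rintegral_cos_odd n : Rintegral mS setT (fun t => cos t ^+ (2 * n).+1) = 0.
Proof.
have mc : measurable_fun setT (fun t : R => cos t ^+ (2 * n).+1) by meas.
have := sine_measure_reflect mc.
have -> : Rintegral mS setT (fun t => cos (pi - t) ^+ (2 * n).+1) =
   - Rintegral mS setT (fun t => cos t ^+ (2 * n).+1).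
  rewrite -mulN1r -Rintegral_scale//; apply: eq_Rintegral => t _.
  rewrite cosB cospi sinpi mul0r addr0 mulN1r exprNn -signr_odd oddS oddM/=.
  by rewrite expr1.
by move=> /eqP; rewrite -subr_eq0 opprK -mulr2n mulrn_eq0/= => /eqP.
Qed.

Definition bessel_coef n : R := Gamma (alpha + 1) / (n`!%:R * Gamma (n%:R + alpha + 1)).

Lemma Gamma_half n : Gamma (n%:R + 2^-1) = Gamma (2^-1) * (2 * n)`!%:R / (4 ^+ n * n`!%:R) :> R.
Proof.
elim: n => [|n IH]; first by rewrite muln0 add0r !fact0 expr0 !mulr1 invr1 mulr1.
rewrite -natr1 addrAC GammaS; last by have := ler0n R n; lra.
rewrite IH mulnS !factS !natrM exprS.
have f0 : (n`!%:R : R) != 0 by rewrite pnatr_eq0 -lt0n fact_gt0.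
have n1 : (n%:R + 1 : R) != 0 by rewrite natr1 pnatr_eq0.
have p4 : (4 ^+ n : R) != 0 by rewrite expf_neq0// pnatr_eq0.
rewrite -[(2 * n).+2%:R]natr1 -[(2 * n).+1%:R]natr1 -[n.+1%:R]natr1 natrM.
by field; rewrite f0 n1 p4.
Qed.

(** By the duplication formula at half-integers, the Bessel coefficients are the cosine coefficients
    weighted by [cos_moment]. Poisson's representation follows termwise, and since the moments lie
    in [[0, 1]] the Bessel series is dominated by an exponential. *)
Lemma bessel_coefE n z : bessel_coef n * (z / 2) ^+ (2 * n) =
  cos_moment n * (z ^+ (2 * n) / (2 * n)`!%:R).
Proof.
rewrite /bessel_coef /cos_moment Gamma_half.
have : Gamma (n%:R + alpha + 1) != 0 by rewrite gt_eqF// Gamma_gt0.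
have : Gamma (2^-1 : R) != 0 by rewrite gt_eqF// Gamma_gt0.
move: (Gamma (n%:R + alpha + 1)) (Gamma 2^-1) (Gamma (alpha + 1)) => x y w y0 x0.
have f0 : (n`!%:R : R) != 0 by rewrite pnatr_eq0 -lt0n fact_gt0.
have g0 : ((2 * n)`!%:R : R) != 0 by rewrite pnatr_eq0 -lt0n fact_gt0.
have p4 : (4 ^+ n : R) != 0 by rewrite expf_neq0// pnatr_eq0.
rewrite expr_div_n (exprM 2) (_ : 2 ^+ 2 = 4 :> R); last by ring.
by field; rewrite f0 g0 p4 x0 y0.
Qed.

Definition bessel_term z n : R := (-1) ^+ n * bessel_coef n * (z / 2) ^+ (2 * n).

Lemma norm_bessel_term z n : `|bessel_term z n| <= `|z| ^+ (2 * n) / (2 * n)`!%:R.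
Proof.
rewrite /bessel_term -mulrA bessel_coefE normrM normrX normrN1 expr1n mul1r normrM.
rewrite (ger0_norm (cos_moment_ge0 _)) normrM normrX normfV normr_nat.
rewrite ler_piMl ?cos_moment_le1//.
Qed.

Lemma sum_norm_bessel_term z N : \sum_(n < N) `|bessel_term z n| <= expR `|z|.
Proof.
apply: le_trans (sum_even_le_exp N (normr_ge0 z)); apply: ler_sum => n _.
exact: norm_bessel_term.
Qed.

(* Poisson's integral representation of j_alpha. *)
Definition bessel z := Rintegral mS setT (fun t => cos (z * cos t)).

(** The Taylor series of [cos (z cos t)] is averaged term by term. All its partial sums are bounded
    by [exp |z|], which is integrable for a probability measure. *)
Lemma bessel_series z : \sum_(n < N) bessel_term z n @[N --> \oo] --> bessel z.
Proof.
pose f_ n (t : R) : R := (-1) ^+ n * ((z * cos t) ^+ (2 * n) / (2 * n)`!%:R).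
have fb n t : `|f_ n t| <= `|z| ^+ (2 * n) / (2 * n)`!%:R.
  rewrite /f_ normrM normrX normrN1 expr1n mul1r normrM normfV normr_nat.
  rewrite ler_wpM2r ?invr_ge0// normrX lerXn2r ?nnegrE//.
  by rewrite normrM ler_piMr// norm_cos_le1.
have mf n : measurable_fun setT (f_ n) by rewrite /f_; meas.
have if_ n : mS.-integrable setT (EFin \o f_ n).
  by apply: integrable_mS => //; exists (`|z| ^+ (2 * n) / (2 * n)`!%:R).
have E N : \sum_(n < N) bessel_term z n = Rintegral mS setT (fun t => \sum_(n < N) f_ n t).
  rewrite Rintegral_sum//; apply: eq_bigr => n _.
  rewrite /bessel_term -mulrA bessel_coefE -Rintegral_cos_moment.
  transitivity (Rintegral mS setT (fun t => ((-1) ^+ n * (z ^+ (2 * n) / (2 * n)`!%:R)) * cos t ^+ (2 * n))).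
    by rewrite Rintegral_scale; [ring|meas].
  by apply: eq_Rintegral => t _; rewrite /f_ exprMn; ring.
under eq_fun do rewrite E.
apply: (@Rintegral_dominated_cvg _ _ R mS _ _ (fun=> expR `|z|)).
- by move=> n; exact: measurable_ord_sum.
- by meas.
- move=> t; have := @cvg_cos_coeff' R (z * cos t); apply: cvg_trans.
  apply: near_eq_cvg; apply: nearW => N; rewrite /series/= big_mkord.
  by apply: eq_bigr => n _; rewrite /cos_coeff' /f_ -muln2 mulnC mulrA.
- by apply: integrable_mS => //; exists (expR `|z|) => _; rewrite ger0_norm ?expR_ge0.
- move=> n t; apply: le_trans (ler_norm_sum _ _ _) _.
  by apply: le_trans (sum_even_le_exp n (normr_ge0 z)); apply: ler_sum.
Qed.

Lemma j_alphaE z : j_alpha alpha z = bessel z.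
Proof.
have G0 : Gamma (alpha + 1) != 0 by rewrite gt_eqF// Gamma_gt0.
rewrite /j_alpha.
set u := (fun N => \sum_(0 <= n < N) _).
have -> : u = (fun N => (Gamma (alpha + 1))^-1 * \sum_(n < N) bessel_term z n).
  apply/funext => N; rewrite /u big_mkord mulr_sumr; apply: eq_bigr => n _.
  rewrite /bessel_term /bessel_coef; move: (Gamma (alpha + 1)) G0 => x x0.
  set y := (_ * Gamma _)^-1; set b := _ ^+ (2 * n).
  by rewrite [RHS](_ : _ = (x^-1 * x) * ((-1) ^+ n * y * b)); [rewrite mulVf// mul1r|ring].
have c : (Gamma (alpha + 1))^-1 * \sum_(n < N) bessel_term z n @[N --> \oo] -->
    (Gamma (alpha + 1))^-1 * bessel z.
  by apply: cvgM; [exact: cvg_cst|exact: bessel_series].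
by rewrite (cvg_lim _ c)// mulrA mulfV// mul1r.
Qed.

Lemma bessel_le1 z : `|bessel z| <= 1.
Proof.
by apply: le_Rintegral_mS; [meas|move=> t; exact: norm_cos_le1].
Qed.

Lemma measurable_bessel : measurable_fun setT bessel.
Proof.
have mF : measurable_fun setT (fun z : R * R => cos (z.1 * cos z.2)) by meas.
exact: (@measurable_Rintegral1 _ _ _ _ R mS _ mF).
Qed.

End sine_measure.

Section Rintegral_line.
Context (R : realType) (mu : {measure set (measurableTypeR R) -> \bar R}).

Lemma RintegralZl_line (f : R -> R) (r : R) : measurable_fun setT f ->
  Rintegral mu setT (fun x => r * f x) = r * Rintegral mu setT f.
Proof. exact: (@Rintegral_scale _ (measurableTypeR R)). Qed.

Lemma RintegralZr_line (f : R -> R) (r : R) : measurable_fun setT f ->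
  Rintegral mu setT (fun x => f x * r) = Rintegral mu setT f * r.
Proof. exact: (@Rintegral_scaler _ (measurableTypeR R)). Qed.

Lemma Rintegral_sum_line (f_ : nat -> R -> R) N : (forall n, mu.-integrable setT (EFin \o f_ n)) ->
  Rintegral mu setT (fun x => \sum_(n < N) f_ n x) = \sum_(n < N) Rintegral mu setT (f_ n).
Proof. exact: (@Rintegral_sum _ (measurableTypeR R)). Qed.

End Rintegral_line.

Section product_formula.
Context (R : realType) (alpha : R).
Hypothesis ha : - 2^-1 < alpha.
Local Notation leb := (@lebesgue_measure R).
Local Notation mA := (hankel_measure alpha).
Local Notation mS := (sine_measure alpha).
Local Notation J := (bessel alpha).

Let a1 : 0 < alpha + 1. Proof. by move: ha; lra. Qed.
Let an n : 0 < n%:R + alpha + 1. Proof. by have := ler0n R n; move: ha; lra. Qed.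

Let fact_neq0 n : n`!%:R != 0 :> R. Proof. by rewrite pnatr_eq0 -lt0n fact_gt0. Qed.

Definition gamma_ratio n : R := Gamma (alpha + 1) / Gamma (n%:R + alpha + 1).

Let e := gamma_ratio.

Lemma bessel_coef_ratio n : bessel_coef alpha n = e n / n`!%:R.
Proof. by rewrite /bessel_coef /e /gamma_ratio invfM; ring. Qed.

Lemma cos_moment_ratio m : cos_moment alpha m = e m / (4 ^+ m * m`!%:R) * (2 * m)`!%:R.
Proof.
have := bessel_coefE ha m 1; rewrite bessel_coef_ratio expr1n.
rewrite expr_div_n expr1n exprM (_ : 2 ^+ 2 = 4 :> R); last by ring.
rewrite !mul1r => E; rewrite -[LHS](mulfVK (fact_neq0 (2 * m))) -E invfM; ring.
Qed.

(** Up to the factor [(n - 2m)!], the coefficient of [p^(n - l) q^l] in [(p + q)^(n - 2m) (p q)^m].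
    The guard makes it 0 outside the range where both subtractions are genuine. *)
Definition trinomial_inv n l m : R :=
  if (m <= l)%N && (l + m <= n)%N then ((l - m)`!%:R * (n - l - m)`!%:R)^-1 else 0.

Lemma sum_range_shift (F : nat -> R) n m : (2 * m <= n)%N ->
  \sum_(i < (n - 2 * m).+1) F (m + i)%N = \sum_(l < n.+1 | (m <= l)%N && (l + m <= n)%N) F l.
Proof.
move=> mn.
rewrite -(big_mkord xpredT (fun i => F (m + i)%N)).
rewrite -(big_mkord (fun l => (m <= l)%N && (l + m <= n)%N) F).
have -> : (n - 2 * m).+1 = ((n - m).+1 - m)%N by lia.
under eq_bigr do rewrite addnC.
rewrite -(big_addn 0 (n - m).+1 m xpredT F) add0n.
rewrite (big_nat_widen _ _ n.+1); last by lia.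
rewrite (big_nat_widenl _ 0)//.
rewrite big_nat_cond [RHS]big_nat_cond; apply: eq_bigl => l.
by apply/idP/idP => /andP[? /andP[? ?]]; apply/andP; split => //; lia.
Qed.

Lemma binomial_trinomial (p q : R) n m : (m <= n)%N ->
  'C(n, 2 * m)%:R * (p + q) ^+ (n - 2 * m) * (p * q) ^+ m * (2 * m)`!%:R =
  n`!%:R * \sum_(l < n.+1) trinomial_inv n l m * p ^+ (n - l) * q ^+ l.
Proof.
move=> mn; case: (leqP (2 * m) n) => mn2; last first.
  rewrite bin_small// !mul0r big1 ?mulr0// => l _; rewrite /trinomial_inv ifF ?mul0r//.
  by apply/negbTE/negP => /andP[? ?]; lia.
have C : 'C(n, 2 * m)%:R * (2 * m)`!%:R * (n - 2 * m)`!%:R = n`!%:R :> R.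
  by rewrite -!natrM -mulnA bin_fact.
rewrite -C -[RHS]mulrA.
rewrite [LHS](_ : _ = 'C(n, 2 * m)%:R * (2 * m)`!%:R * ((p + q) ^+ (n - 2 * m) * (p * q) ^+ m)); last by ring.
congr (_ * _).
rewrite (bigID (fun l : 'I_n.+1 => (m <= l)%N && (l + m <= n)%N))/= [X in _ = _ * (_ + X)]big1 ?addr0; last first.
  by move=> l /negbTE h; rewrite /trinomial_inv h !mul0r.
rewrite -(@sum_range_shift (fun l => trinomial_inv n l m * p ^+ (n - l) * q ^+ l))//.
rewrite exprDn mulr_suml mulr_sumr; apply: eq_bigr => i _.
have im : (i <= n - 2 * m)%N by rewrite -ltnS.
rewrite /trinomial_inv ifT; last by apply/andP; split; lia.
rewrite addKn (_ : (n - (m + i) - m = n - 2 * m - i)%N); last by lia.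
rewrite (_ : (n - (m + i) = m + (n - 2 * m - i))%N); last by lia.
rewrite -mulr_natr exprMn !exprD.
have B : 'C(n - 2 * m, i)%:R = (n - 2 * m)`!%:R * (i`!%:R * (n - 2 * m - i)`!%:R)^-1 :> R.
  by rewrite -(bin_fact im) !natrM; field; rewrite !fact_neq0.
rewrite B; set Y := (_ * _)^-1; ring.
Qed.

(* The n-th degree parts of j(x xi) j(t xi) and of the average of j(rho xi) agree by this identity. *)
Lemma ratio_Vandermonde n l : (l <= n)%N ->
  e n * \sum_(m < n.+1) e m / m`!%:R * trinomial_inv n l m = e (n - l) * e l / ((n - l)`!%:R * l`!%:R).
Proof.
move=> ln; have kn : ((n - l).+1 <= n.+1)%N by rewrite ltnS leq_subr.
have V := Gamma_Vandermonde (n - l) l a1; rewrite subnK// in V.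
have E : \sum_(m < n.+1) e m / m`!%:R * trinomial_inv n l m =
   Gamma (alpha + 1) / ((n - l)`!%:R * l`!%:R) *
   \sum_(m < (n - l).+1) 'C(n - l, m)%:R * (l ^_ m)%:R / Gamma (alpha + 1 + m%:R).
  rewrite (bigID (fun m : 'I_n.+1 => (m < (n - l).+1)%N))/= [X in _ + X]big1 ?addr0; last first.
    move=> m; rewrite -leqNgt => h; rewrite /trinomial_inv ifF ?mulr0//.
    by apply/negbTE/negP => /andP[? ?]; lia.
  rewrite -(big_ord_widen _ (fun m => e m / m`!%:R * trinomial_inv n l m) kn) mulr_sumr.
  apply: eq_bigr => m _; have mk : (m <= n - l)%N by rewrite -ltnS.
  rewrite /trinomial_inv; case: (leqP m l) => ml /=; last first.
    by rewrite ffact_small// !(mulr0, mul0r).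
  rewrite ifT; last by lia.
  have -> : 'C(n - l, m)%:R = (n - l)`!%:R / (m`!%:R * (n - l - m)`!%:R) :> R.
    by rewrite -(bin_fact mk) !natrM; field; rewrite !fact_neq0.
  have -> : (l ^_ m)%:R = l`!%:R / (l - m)`!%:R :> R.
    by rewrite -(ffact_fact ml) natrM; field; rewrite fact_neq0.
  rewrite /e /gamma_ratio (_ : alpha + 1 + m%:R = m%:R + alpha + 1); last by ring.
  by field; rewrite !fact_neq0 gt_eqF ?Gamma_gt0.
rewrite E V /e /gamma_ratio.
have ee k : alpha + 1 + k%:R = k%:R + alpha + 1 by ring.
rewrite !ee.
have := Gamma_gt0 (an n); have := Gamma_gt0 (an l); have := Gamma_gt0 (an (n - l)).
move: (Gamma (n%:R + alpha + 1)) (Gamma (l%:R + alpha + 1)) (Gamma ((n - l)%:R + alpha + 1)) => x y z z0 y0 x0.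
by field; rewrite !fact_neq0 !gt_eqF.
Qed.

Lemma Rintegral_cos_affine (X Z : R) n :
  Rintegral mS setT (fun t => (X + Z * cos t) ^+ n) =
  \sum_(m < n.+1) 'C(n, 2 * m)%:R * X ^+ (n - 2 * m) * (Z ^+ 2) ^+ m * cos_moment alpha m.
Proof.
pose G j (t : R) : R := 'C(n, j)%:R * X ^+ (n - j) * Z ^+ j * cos t ^+ j.
have mc j : measurable_fun setT (fun t : R => cos t ^+ j) by meas.
have iG j : mS.-integrable setT (EFin \o G j).
  apply: integrable_mS => //; first by rewrite /G; meas.
  exists `|'C(n, j)%:R * X ^+ (n - j) * Z ^+ j| => t.
  by rewrite normrM ler_piMr// normrX exprn_ile1 ?norm_cos_le1.
(* The binomial sum is padded to an even number of terms, the new binomial coefficients being 0, so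
   that even and odd powers can be paired; odd moments vanish. *)
transitivity (Rintegral mS setT (fun t => \sum_(j < 2 * n.+1) G j t)).
  apply: eq_Rintegral => t _; rewrite exprDn.
  have nn : (n.+1 <= 2 * n.+1)%N by lia.
  rewrite (big_ord_widen _ (fun i => X ^+ (n - i) * (Z * cos t) ^+ i *+ 'C(n, i)) nn).
  rewrite big_mkcond; apply: eq_bigr => j _; rewrite /G; case: ifPn => jn.
    by rewrite -mulr_natr exprMn; ring.
  by rewrite bin_small ?mul0r// ltnNge -ltnS.
rewrite Rintegral_sum_line//.
have E M : \sum_(j < 2 * M) Rintegral mS setT (G j) = \sum_(m < M) Rintegral mS setT (G (2 * m)%N).
  elim: M => [|M IH]; first by rewrite !big_ord0.
  rewrite mulnS !big_ord_recr/= IH -addrA [X in _ + X]addrC; congr (_ + _).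
  have -> : Rintegral mS setT (G (2 * M).+1) = 0.
    transitivity ('C(n, (2 * M).+1)%:R * X ^+ (n - (2 * M).+1) * Z ^+ (2 * M).+1 *
        Rintegral mS setT (fun t => cos t ^+ (2 * M).+1)).
      exact: (@RintegralZl_line R mS (fun t => cos t ^+ (2 * M).+1)).
    by rewrite Rintegral_cos_odd mulr0.
  by rewrite add0r.
rewrite E; apply: eq_bigr => m _.
transitivity ('C(n, 2 * m)%:R * X ^+ (n - 2 * m) * Z ^+ (2 * m) *
    Rintegral mS setT (fun t => cos t ^+ (2 * m))).
  exact: (@RintegralZl_line R mS (fun t => cos t ^+ (2 * m))).
by rewrite Rintegral_cos_moment// exprM.
Qed.

Lemma bessel_termE z n : bessel_term alpha z n = (-1) ^+ n * (e n / (4 ^+ n * n`!%:R)) * (z ^+ 2) ^+ n.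
Proof.
rewrite /bessel_term bessel_coef_ratio expr_div_n exprM (exprM 2) (_ : 2 ^+ 2 = 4 :> R); last by ring.
by rewrite invfM; ring.
Qed.

(** The law of cosines: the length of the sum of two plane vectors of lengths [|x|] and [|t|] at
    angle [th], up to the signs of [x] and [t]. *)
Definition rho (x t th : R) := Num.sqrt (x ^+ 2 + t ^+ 2 + 2 * x * t * cos th).

Lemma rho_arg_ge0 (x t th : R) : 0 <= x ^+ 2 + t ^+ 2 + 2 * x * t * cos th.
Proof.
have -> : x ^+ 2 + t ^+ 2 + 2 * x * t * cos th = (x + t * cos th) ^+ 2 + t ^+ 2 * (1 - cos th ^+ 2) by ring.
by rewrite -sin2cos2 addr_ge0 ?sqr_ge0// mulr_ge0 ?sqr_ge0.
Qed.

Lemma sqr_rho x t th : rho x t th ^+ 2 = x ^+ 2 + t ^+ 2 + 2 * x * t * cos th.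
Proof. by rewrite sqr_sqrtr// rho_arg_ge0. Qed.

Lemma rho_ge0 x t th : 0 <= rho x t th. Proof. exact: sqrtr_ge0. Qed.

Lemma rho_le x t th : rho x t th <= `|x| + `|t|.
Proof.
rewrite -(@ler_pXn2r _ 2)// ?nnegrE ?rho_ge0 ?addr_ge0// sqr_rho sqrrD !real_normK ?num_real//.
have h : x * t * cos th <= `|x| * `|t|.
  by apply: le_trans (ler_norm _) _; rewrite !normrM ler_piMr ?mulr_ge0// norm_cos_le1.
by rewrite -mulr_natr; lra.
Qed.

(** The product formula degree by degree. The [n]-th term is the [n]-th power of
    [p + q + 2 (x xi) (t xi) cos th]; averaging keeps the even powers of the cosine and leaves a
    polynomial in [p], [q]. Its coefficients are those of the Cauchy product by
    [ratio_Vandermonde]. *)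
Lemma Rintegral_bessel_term_rho (x t xi : R) n :
  Rintegral mS setT (fun th => bessel_term alpha (rho x t th * xi) n) =
  cauchy_conv (bessel_term alpha (t * xi)) (bessel_term alpha (x * xi)) n.
Proof.
pose p := (x * xi) ^+ 2; pose q := (t * xi) ^+ 2.
have mA n' : measurable_fun setT (fun th : R => (p + q + 2 * (x * xi) * (t * xi) * cos th) ^+ n') by meas.
transitivity (Rintegral mS setT (fun th => ((-1) ^+ n * (e n / (4 ^+ n * n`!%:R))) *
   (p + q + 2 * (x * xi) * (t * xi) * cos th) ^+ n)).
  apply: eq_Rintegral => th _; rewrite bessel_termE [(rho x t th * xi) ^+ 2]exprMn sqr_rho.
  by congr (_ * _ ^+ _); rewrite /p /q; ring.
transitivity (((-1) ^+ n * (e n / (4 ^+ n * n`!%:R))) *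
   Rintegral mS setT (fun th => (p + q + 2 * (x * xi) * (t * xi) * cos th) ^+ n)).
  exact: (@RintegralZl_line R mS (fun th => (p + q + 2 * (x * xi) * (t * xi) * cos th) ^+ n)).
rewrite Rintegral_cos_affine.
transitivity ((-1) ^+ n * (e n / 4 ^+ n) * \sum_(m < n.+1) e m / m`!%:R *
    \sum_(l < n.+1) trinomial_inv n l m * p ^+ (n - l) * q ^+ l).
  rewrite mulr_sumr mulr_sumr; apply: eq_bigr => m _.
  rewrite cos_moment_ratio.
  have h := @binomial_trinomial p q n m (ltn_ord m : (m <= n)%N).
  have -> : \sum_(l < n.+1) trinomial_inv n l m * p ^+ (n - l) * q ^+ l =
     'C(n, 2 * m)%:R * (p + q) ^+ (n - 2 * m) * (p * q) ^+ m * (2 * m)`!%:R / n`!%:R.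
    by rewrite h mulrC mulKf.
  have -> : ((2 * (x * xi) * (t * xi)) ^+ 2) ^+ m = 4 ^+ m * (p * q) ^+ m.
    by rewrite -exprMn; congr (_ ^+ _); rewrite /p /q; ring.
  have f4 k : 4 ^+ k != 0 :> R by rewrite expf_neq0// pnatr_eq0.
  by field; rewrite !fact_neq0 !f4.
under eq_bigr do rewrite mulr_sumr.
rewrite exchange_big/= mulr_sumr /cauchy_conv; apply: eq_bigr => l _.
have ln : (l <= n)%N by rewrite -ltnS.
transitivity ((-1) ^+ n / 4 ^+ n * (e n * \sum_(m < n.+1) e m / m`!%:R * trinomial_inv n l m) * (p ^+ (n - l) * q ^+ l)).
  by rewrite !mulr_sumr mulr_suml; apply: eq_bigr => m _; ring.
rewrite ratio_Vandermonde// !bessel_termE -/p -/q.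
have -> : (-1) ^+ n = (-1) ^+ l * (-1) ^+ (n - l) :> R by rewrite -exprD subnKC.
have -> : 4 ^+ n = 4 ^+ l * 4 ^+ (n - l) :> R by rewrite -exprD subnKC.
have f4 k : 4 ^+ k != 0 :> R by rewrite expf_neq0// pnatr_eq0.
by field; rewrite !fact_neq0 !f4.
Qed.

(** The termwise identity is summed: dominated convergence on the averaged side, the Cauchy product
    on the other. Since [rho <= |x| + |t|], one exponential dominates all angles at once. *)
Lemma bessel_product (x t xi : R) :
  Rintegral mS setT (fun th => J (rho x t th * xi)) = J (x * xi) * J (t * xi).
Proof.
have mb n : measurable_fun setT (fun th => bessel_term alpha (rho x t th * xi) n).
  by rewrite /bessel_term /rho; meas.
have bd n th : `|bessel_term alpha (rho x t th * xi) n| <= expR (`|x * xi| + `|t * xi|).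
  apply: le_trans (_ : expR `|rho x t th * xi| <= _); last first.
    by rewrite ler_expR !normrM -mulrDl ler_wpM2r// ger0_norm ?rho_ge0// rho_le.
  apply: le_trans (sum_norm_bessel_term ha _ n.+1).
  by rewrite big_ord_recr/= lerDr sumr_ge0.
have c1 : Rintegral mS setT (fun th => \sum_(n < N) bessel_term alpha (rho x t th * xi) n) @[N --> \oo]
    --> Rintegral mS setT (fun th => J (rho x t th * xi)).
  apply: (@Rintegral_dominated_cvg _ _ R mS _ _ (fun=> expR (`|x * xi| + `|t * xi|))).
  - by move=> n; apply: (@measurable_ord_sum _ _ R (fun n th => bessel_term alpha (rho x t th * xi) n)).
  - have mJ := measurable_bessel alpha; by rewrite /rho; meas.
  - by move=> th; exact: bessel_series.
  - by apply: integrable_mS => //; exists (expR (`|x * xi| + `|t * xi|)) => _; rewrite ger0_norm ?expR_ge0.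
  - move=> n th; apply: le_trans (ler_norm_sum _ _ _) _.
    apply: le_trans (sum_norm_bessel_term ha _ n) _.
    by rewrite ler_expR !normrM -mulrDl ler_wpM2r// ger0_norm ?rho_ge0// rho_le.
have c2 : \sum_(n < N) cauchy_conv (bessel_term alpha (t * xi)) (bessel_term alpha (x * xi)) n @[N --> \oo]
    --> J (t * xi) * J (x * xi).
  apply: Cauchy_product; try exact: bessel_series.
  - by exists (expR `|t * xi|) => N; exact: sum_norm_bessel_term.
  - by exists (expR `|x * xi|) => N; exact: sum_norm_bessel_term.
have E : (fun N => Rintegral mS setT (fun th => \sum_(n < N) bessel_term alpha (rho x t th * xi) n)) =
    (fun N => \sum_(n < N) cauchy_conv (bessel_term alpha (t * xi)) (bessel_term alpha (x * xi)) n).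
  apply/funext => N.
  transitivity (\sum_(n < N) Rintegral mS setT (fun th => bessel_term alpha (rho x t th * xi) n)).
    apply: (@Rintegral_sum_line R mS (fun n th => bessel_term alpha (rho x t th * xi) n)) => n.
    by apply: integrable_mS => //; exists (expR (`|x * xi| + `|t * xi|)).
  by apply: eq_bigr => n _; exact: Rintegral_bessel_term_rho.
rewrite E in c1; rewrite mulrC; exact: (cvg_unique _ c1 c2).
Qed.

End product_formula.

(** * Gaussians and their Hankel transforms *)

Section gaussian.
Context (R : realType) (alpha : R).
Hypothesis ha : - 2^-1 < alpha.
Local Notation leb := (@lebesgue_measure R).
Local Notation mA := (hankel_measure alpha).
Local Notation mS := (sine_measure alpha).
Local Notation J := (bessel alpha).

Let a1 : 0 < alpha + 1. Proof. by move: ha; lra. Qed.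
Let an n : 0 < n%:R + alpha + 1. Proof. by have := ler0n R n; move: ha; lra. Qed.

Lemma hankel_weight_gt0 (x : R) : 0 < x -> hankel_weight alpha x = mu_dens alpha x.
Proof. by move=> x0; rewrite /hankel_weight posind_gt0// mulr1. Qed.

Lemma hankel_weight_le0 (x : R) : x <= 0 -> hankel_weight alpha x = 0.
Proof. by move=> x0; rewrite /hankel_weight posind_le0// mulr0. Qed.

Lemma eq_integral_hankel (f g : R -> \bar R) : (forall x, 0 <= f x)%E -> (forall x, 0 <= g x)%E ->
  measurable_fun setT f -> measurable_fun setT g -> (forall x, 0 < x -> f x = g x) ->
  (\int[mA]_x f x = \int[mA]_x g x)%E.
Proof.
move=> f0 g0 mf mg fg; rewrite !ge0_integral_hankel//; apply: eq_integral => x _.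
by have [x0|x0] := ltP 0 x; [rewrite fg|rewrite hankel_weight_le0// !mule0].
Qed.

Lemma le_integral_hankel (f g : R -> \bar R) : (forall x, 0 <= f x)%E -> (forall x, 0 <= g x)%E ->
  measurable_fun setT f -> measurable_fun setT g -> (forall x, 0 < x -> (f x <= g x)%E) ->
  (\int[mA]_x f x <= \int[mA]_x g x)%E.
Proof.
move=> f0 g0 mf mg fg; rewrite !ge0_integral_hankel//.
have mw := measurable_hankel_weight alpha.
have w0 := @hankel_weight_ge0 R alpha.
apply: ge0_le_integral => //.
- by move=> x _; rewrite mule_ge0 ?lee_fin.
- by meas.
- by meas.
- move=> x _; have [x0|x0] := ltP 0 x; last by rewrite hankel_weight_le0// !mule0.
  by rewrite lee_wpmul2r ?lee_fin// fg.
Qed.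

Lemma eq_Rintegral_hankel (f g : R -> R) : measurable_fun setT f -> measurable_fun setT g ->
  (forall x, 0 < x -> f x = g x) -> Rintegral mA setT f = Rintegral mA setT g.
Proof.
move=> mf mg fg; rewrite !Rintegral_hankel//; apply: eq_Rintegral => x _.
by have [x0|x0] := ltP 0 x; [rewrite fg|rewrite hankel_weight_le0// !mulr0].
Qed.

Lemma integral_gauss_hankel n (s : R) : 0 < s ->
  (\int[mA]_x (x ^+ (2 * n) * expR (- (s * x ^+ 2)))%:E =
   ((2 * s) `^ (- (alpha + 1)) * (Gamma (n%:R + alpha + 1) / (s ^+ n * Gamma (alpha + 1))))%:E)%E.
Proof.
move=> s0; have mP := @measurable_posind R.
have G0 := Gamma_gt0 a1.
have c0 : 0 < (2 `^ alpha * Gamma (alpha + 1))^-1 by rewrite invr_gt0 mulr_gt0// powR_gt0.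
rewrite ge0_integral_hankel; last 2 first.
- by move=> x; rewrite lee_fin mulr_ge0 ?expR_ge0// exprM exprn_ge0// sqr_ge0.
- by meas.
transitivity ((2 `^ alpha * Gamma (alpha + 1))^-1%:E *
   (\int[leb]_x (x `^ (2 * (n%:R + alpha + 1) - 1) * expR (- (s * x ^+ 2)) * posind x)%:E))%E.
  rewrite -ge0_integralZEFin ?ltW//; last 2 first.
  - by move=> x; rewrite lee_fin !mulr_ge0 ?powR_ge0 ?expR_ge0 ?posind_ge0.
  - by meas.
  apply: eq_integral => x _; have [x0|x0] := ltP 0 x; last first.
    by rewrite hankel_weight_le0// posind_le0// !mulr0 !mule0.
  rewrite hankel_weight_gt0// posind_gt0// -!EFinM /mu_dens.
  have -> : x `^ (2 * (n%:R + alpha + 1) - 1) = x ^+ (2 * n) * x `^ (2 * alpha + 1).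
    rewrite -powR_mulrn ?ltW// -powRD; last by apply/implyP => _; rewrite gt_eqF.
    by congr (_ `^ _); rewrite natrM; ring.
  by congr EFin; ring.
rewrite gauss_moment// -EFinM; congr EFin.
rewrite powRM ?ltW// (_ : - (n%:R + alpha + 1) = - n%:R - (alpha + 1)); last by ring.
rewrite powRD; last by apply/implyP => _; rewrite gt_eqF.
rewrite [s `^ - n%:R]powRN powR_mulrn ?ltW//.
have -> : 2 `^ (- (alpha + 1)) = 2^-1 * (2 `^ alpha)^-1 :> R.
  rewrite opprD powRD ?powRN; last by apply/implyP => _; rewrite pnatr_eq0.
  by rewrite powRr1// mulrC.
by rewrite !invfM; ring.
Qed.

Lemma integral_gauss_hankel0 (s : R) : 0 < s ->
  (\int[mA]_x (expR (- (s * x ^+ 2)))%:E = ((2 * s) `^ (- (alpha + 1)))%:E)%E.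
Proof.
move=> s0; have := integral_gauss_hankel 0 s0.
rewrite expr0 mul1r add0r divff ?mulr1 ?gt_eqF ?Gamma_gt0// => <-.
by apply: eq_integral => x _; rewrite muln0 expr0 mul1r.
Qed.

Lemma integrable_gauss_hankel n (s : R) : 0 < s ->
  mA.-integrable setT (fun x => (x ^+ (2 * n) * expR (- (s * x ^+ 2)))%:E).
Proof.
move=> s0; apply/integrableP; split; first by meas.
under eq_integral => x _.
  rewrite /= ger0_norm; last by rewrite mulr_ge0 ?expR_ge0// exprM exprn_ge0// sqr_ge0.
  over.
by rewrite integral_gauss_hankel// ltry.
Qed.

Lemma integrable_gauss (s : R) : 0 < s -> mA.-integrable setT (fun x => (expR (- (s * x ^+ 2)))%:E).
Proof.
move=> s0; have := integrable_gauss_hankel 0 s0; apply: eq_integrable => // x _.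
by rewrite muln0 expr0 mul1r.
Qed.

(** Integrating the Bessel series against the gaussian term by term, the Gamma value of each moment
    cancels the one in the coefficient; what remains is the exponential series at
    [- z^2 / (4 s)]. *)
Lemma hankel_gauss (s z : R) : 0 < s ->
  Rintegral mA setT (fun x => expR (- (s * x ^+ 2)) * J (x * z)) =
  (2 * s) `^ (- (alpha + 1)) * expR (- (z ^+ 2 / (4 * s))).
Proof.
move=> s0; have s20 : 0 < s / 2 by rewrite divr_gt0.
pose c n : R := (-1) ^+ n * bessel_coef alpha n * (z / 2) ^+ (2 * n).
pose f_ n (x : R) : R := c n * (x ^+ (2 * n) * expR (- (s * x ^+ 2))).
(* Half of the gaussian decay absorbs [exp |x z|]: the exponents differ by
   [(s |x| - |z|)^2 / (2 s) >= 0]. *)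
pose D (x : R) := expR (z ^+ 2 / (2 * s)) * expR (- (s / 2 * x ^+ 2)).
have f_E n x : f_ n x = expR (- (s * x ^+ 2)) * bessel_term alpha (x * z) n.
  rewrite /f_ /c /bessel_term -[x * z / 2]mulrA [in RHS]exprMn.
  by move: ((z / 2) ^+ _) (expR _) => v w; ring.
have bd N x : `|\sum_(n < N) f_ n x| <= D x.
  under eq_bigr do rewrite f_E.
  rewrite -mulr_sumr normrM ger0_norm ?expR_ge0// /D -expRD.
  apply: (@le_trans _ _ (expR (- (s * x ^+ 2)) * expR `|x * z|)).
    rewrite ler_wpM2l ?expR_ge0//; apply: le_trans (ler_norm_sum _ _ _) _.
    exact: sum_norm_bessel_term.
  rewrite -expRD ler_expR normrM -(real_normK (num_real x)) -(real_normK (num_real z)).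
  move: (`|x|) (`|z|) => u v.
  have h : 0 <= (s * u - v) ^+ 2 / (2 * s) by rewrite divr_ge0 ?sqr_ge0// mulr_ge0// ltW.
  rewrite -subr_ge0; apply: le_trans h _; rewrite le_eqVlt; apply/orP; left; apply/eqP.
  by field; rewrite gt_eqF.
have mf n : measurable_fun setT (f_ n) by rewrite /f_; meas.
have if_ n : mA.-integrable setT (EFin \o f_ n).
  have := @integrableZl _ _ _ mA setT measurableT (c n) _ (integrable_gauss_hankel n s0).
  by apply: eq_integrable => // x _.
have c1 : Rintegral mA setT (fun x => \sum_(n < N) f_ n x) @[N --> \oo]
    --> Rintegral mA setT (fun x => expR (- (s * x ^+ 2)) * J (x * z)).
  apply: (@Rintegral_dominated_cvg _ (measurableTypeR R) R mA _ _ D).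
  - by move=> N; exact: (@measurable_ord_sum _ (measurableTypeR R)).
  - have mJ := measurable_bessel alpha; by meas.
  - move=> x; rewrite (_ : (fun N => _) = (fun N => expR (- (s * x ^+ 2)) * \sum_(n < N) bessel_term alpha (x * z) n)).
      by apply: cvgM; [exact: cvg_cst|exact: bessel_series].
    by apply/funext => N; under eq_bigr do rewrite f_E; rewrite mulr_sumr.
  - have := @integrableZl _ _ _ mA setT measurableT (expR (z ^+ 2 / (2 * s))) _ (integrable_gauss s20).
    by apply: eq_integrable => // x _.
  - by move=> N x; exact: bd.
have E : (fun N => Rintegral mA setT (fun x => \sum_(n < N) f_ n x)) =
    (fun N => (2 * s) `^ (- (alpha + 1)) * series (exp_coeff (- (z ^+ 2 / (4 * s)))) N).
  apply/funext => N; transitivity (\sum_(n < N) Rintegral mA setT (f_ n)).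
    exact: (@Rintegral_sum_line R mA f_ N if_).
  rewrite /series/= big_mkord mulr_sumr; apply: eq_bigr => n _.
  transitivity (c n * Rintegral mA setT (fun x => x ^+ (2 * n) * expR (- (s * x ^+ 2)))).
    by apply: RintegralZl_line; meas.
  rewrite /Rintegral integral_gauss_hankel//= /c /bessel_coef /exp_coeff/=.
  have := Gamma_gt0 (an n); have := Gamma_gt0 a1.
  move: (Gamma (n%:R + alpha + 1)) (Gamma (alpha + 1)) => u v v0 u0.
  have -> : (- (z ^+ 2 / (4 * s))) ^+ n = (-1) ^+ n * (z / 2) ^+ (2 * n) / s ^+ n.
    rewrite exprM -exprMn -expr_div_n; congr (_ ^+ _); field; by rewrite gt_eqF.
  move: ((2 * s) `^ _) ((z / 2) ^+ _) => w b.
  by field; rewrite !gt_eqF ?exprn_gt0// ltr0n fact_gt0.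
rewrite E in c1; 
have c2 : (2 * s) `^ (- (alpha + 1)) * series (exp_coeff (- (z ^+ 2 / (4 * s)))) N @[N --> \oo] -->
    (2 * s) `^ (- (alpha + 1)) * expR (- (z ^+ 2 / (4 * s))).
  apply: cvgM; first exact: cvg_cst.
  exact: is_cvg_series_exp_coeff.
exact: (cvg_unique _ c1 c2).
Qed.

End gaussian.

(** * Hankel translation *)

Section translation.
Context (R : realType) (alpha : R).
Hypothesis ha : - 2^-1 < alpha.
Local Notation leb := (@lebesgue_measure R).
Local Notation mA := (hankel_measure alpha).
Local Notation mS := (sine_measure alpha).
Local Notation J := (bessel alpha).

Lemma rhoC (x t th : R) : rho x t th = rho t x th.
Proof. by rewrite /rho; congr Num.sqrt; ring. Qed.

(** Since [x^(2 alpha + 1) sin^(2 alpha) th = (x sin th)^(2 alpha) x], the product of the two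
    measures is the area of the upper half-plane with weight a multiple of [y^(2 alpha)], a function
    of the height only. *)
Lemma integral_polar_hankel (G : R * R -> \bar R) : (forall z, (0 <= G z)%E) -> measurable_fun setT G ->
  (\int[mA]_x \int[mS]_th G (x * cos th, x * sin th)%R =
   \int[leb]_y \int[leb]_x (G (x, y) * (sine_const alpha / (2 `^ alpha * Gamma (alpha + 1)) * y `^ (2 * alpha))%:E * (posind y)%:E))%E.
Proof.
move=> G0 mG; have mP := @measurable_posind R.
have mU := @measurable_uhalf R.
have mw := measurable_sine_weight alpha; have mv := measurable_hankel_weight alpha.
have w0 := @sine_weight_ge0 R alpha; have v0 := @hankel_weight_ge0 R alpha.
have S0 := sine_const_ge0 alpha.
have c0 : 0 <= sine_const alpha / (2 `^ alpha * Gamma (alpha + 1)).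
  by rewrite divr_ge0// mulr_ge0 ?powR_ge0 ?Gamma_ge0.
have F0 z : (0 <= G z * (sine_const alpha / (2 `^ alpha * Gamma (alpha + 1)) * z.2 `^ (2 * alpha))%:E)%E.
  by rewrite mule_ge0// lee_fin mulr_ge0// powR_ge0.
have mF : measurable_fun setT (fun z : R * R => G z * (sine_const alpha / (2 `^ alpha * Gamma (alpha + 1)) * z.2 `^ (2 * alpha))%:E)%E by meas.
rewrite [RHS](polar_half_plane F0 mF).
have mGp : measurable_fun setT (fun z : R * R => G (z.1 * cos z.2, z.1 * sin z.2)) by meas.
rewrite ge0_integral_hankel; last 2 first.
- by move=> x; apply: integral_ge0.
- exact: (@measurable_tonelli1 _ _ (measurableTypeR R) (measurableTypeR R) R mS (fun x th => G (x * cos th, x * sin th))).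
apply: eq_integral => x _.
rewrite ge0_integral_sine//; last by meas.
rewrite -ge0_integralZr//=; last 3 first.
- by meas.
- by move=> t _; rewrite mule_ge0// lee_fin.
- by rewrite lee_fin.
apply: eq_integral => t _ /=.
rewrite -!muleA; congr (_ * _)%E; rewrite -!EFinM; congr EFin.
have [x0|x0] := ltP 0 x; last by rewrite hankel_weight_le0// posind_le0// !(mulr0, mul0r).
rewrite hankel_weight_gt0// posind_gt0// /sine_weight uhalfE.
have [/andP[t0 tpi]|_] := boolP (0 < t < pi); last by rewrite !(mulr0, mul0r).
have st : 0 <= sin t by apply: sin_ge0_pi; rewrite !ltW.
rewrite /mu_dens powRM// ?ltW// powRD; last by apply/implyP => _; rewrite gt_eqF.
rewrite powRr1 ?ltW//; move: (x `^ _) (sin t `^ _) ((2 `^ alpha * _)^-1) => u v w; ring.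
Qed.

(* The point X of the plane with polar coordinates (x, th) satisfies |X + (t, 0)| = rho x t th,
   and X -> - X - (t, 0), followed by a reflection, exchanges |X| and |X + (t, 0)|. *)
Lemma translation_swap (Phi : R * R -> \bar R) (t : R) :
  (forall z, (0 <= Phi z)%E) -> measurable_fun setT Phi ->
  (\int[mA]_x \int[mS]_th Phi (rho x t th, x) = \int[mA]_x \int[mS]_th Phi (x, rho x t th))%E.
Proof.
move=> P0 mP0.
pose nr (x y : R) := Num.sqrt (x ^+ 2 + y ^+ 2).
have mnr : measurable_fun setT (fun z : R * R => nr z.1 z.2) by rewrite /nr; meas.
have nrP (x th : R) : 0 < x -> nr (x * cos th) (x * sin th) = x.
  move=> x0; rewrite /nr !exprMn -mulrDr cos2Dsin2 mulr1 sqrtr_sqr gtr0_norm//.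
have nrt (x th : R) : nr (x * cos th + t) (x * sin th) = rho x t th.
  rewrite /nr /rho; congr Num.sqrt.
  by rewrite [(x * sin th) ^+ 2]exprMn sin2cos2; ring.
have mr : measurable_fun setT (fun z : R * R => rho z.1 t z.2) by rewrite /rho; meas.
pose G1 (z : R * R) : \bar R := Phi (nr (z.1 + t) z.2, nr z.1 z.2).
pose G2 (z : R * R) : \bar R := Phi (nr z.1 z.2, nr (z.1 + t) z.2).
have mG1 : measurable_fun setT G1 by rewrite /G1 /nr; meas.
have mG2 : measurable_fun setT G2 by rewrite /G2 /nr; meas.
transitivity (\int[mA]_x \int[mS]_th G1 (x * cos th, x * sin th)%R)%E.
  apply: eq_integral_hankel.
  - by move=> x; apply: integral_ge0 => th _; exact: P0.
  - by move=> x; apply: integral_ge0 => th _; exact: P0.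
  - apply: (@measurable_tonelli1 _ _ (measurableTypeR R) (measurableTypeR R) R mS (fun x th => Phi (rho x t th, x))) => //.
    by rewrite /rho; meas.
  - apply: (@measurable_tonelli1 _ _ (measurableTypeR R) (measurableTypeR R) R mS (fun x th => G1 (x * cos th, x * sin th))).
      by move=> x th; exact: P0.
    by meas.
  - by move=> x x0; apply: eq_integral => th _; rewrite /G1/= nrt nrP.
transitivity (\int[mA]_x \int[mS]_th G2 (x * cos th, x * sin th)%R)%E; last first.
  apply: eq_integral_hankel.
  - by move=> x; apply: integral_ge0 => th _; exact: P0.
  - by move=> x; apply: integral_ge0 => th _; exact: P0.
  - apply: (@measurable_tonelli1 _ _ (measurableTypeR R) (measurableTypeR R) R mS (fun x th => G2 (x * cos th, x * sin th))).
      by move=> x th; exact: P0.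
    by meas.
  - apply: (@measurable_tonelli1 _ _ (measurableTypeR R) (measurableTypeR R) R mS (fun x th => Phi (x, rho x t th))) => //.
    by rewrite /rho; meas.
  - by move=> x x0; apply: eq_integral => th _; rewrite /G2/= nrt nrP.
rewrite [LHS](@integral_polar_hankel G1 (fun z => P0 _) mG1).
rewrite [RHS](@integral_polar_hankel G2 (fun z => P0 _) mG2).
apply: eq_integral => y _.
have mp := @measurable_posind R.
(* At fixed height the abscissa is replaced by [- x - t]. The weight depends only on [y], and the
   distances to the origin and to [(-t, 0)] are exchanged. *)
rewrite [LHS](@ge0_integral_affine _ (-1) (- t)); last 3 first.
- by rewrite oppr_eq0 oner_eq0.
- move=> x; rewrite mule_ge0 ?lee_fin ?posind_ge0// mule_ge0 ?P0// lee_fin.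
  by rewrite mulr_ge0 ?powR_ge0// divr_ge0 ?sine_const_ge0// mulr_ge0 ?powR_ge0 ?Gamma_ge0.
- by meas.
apply: eq_integral => x _; rewrite normrN1 mule1 mulN1r /G1 /G2/=.
congr (_ * _ * _)%E; congr (Phi (_, _)); rewrite /nr; congr Num.sqrt; ring.
Qed.

Lemma translation_swap_prod (Phi : R * R -> \bar R) (t : R) :
  (forall z, (0 <= Phi z)%E) -> measurable_fun setT Phi ->
  (\int[(mA \x mS)%E]_z Phi (rho z.1 t z.2, z.1) = \int[(mA \x mS)%E]_z Phi (z.1, rho z.1 t z.2))%E.
Proof.
move=> P0 mP.
have m1 : measurable_fun setT (fun z : R * R => Phi (rho z.1 t z.2, z.1)) by rewrite /rho; meas.
have m2 : measurable_fun setT (fun z : R * R => Phi (z.1, rho z.1 t z.2)) by rewrite /rho; meas.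
rewrite (@fubini_tonelli1 _ _ (measurableTypeR R) (measurableTypeR R) R mA mS _ m1)//.
rewrite (@fubini_tonelli1 _ _ (measurableTypeR R) (measurableTypeR R) R mA mS _ m2)//.
exact: translation_swap.
Qed.

(** The nonnegative swap is applied to positive and negative parts on the product space; the assumed
    finiteness makes both iterated integrals product integrals. *)
Lemma Rintegral_translation_swap (Phi : R * R -> R) (t : R) : measurable_fun setT Phi ->
  (\int[mA]_x \int[mS]_th `|Phi (x, rho x t th)|%:E < +oo)%E ->
  Rintegral mA setT (fun x => Rintegral mS setT (fun th => Phi (rho x t th, x))) =
  Rintegral mA setT (fun x => Rintegral mS setT (fun th => Phi (x, rho x t th))).
Proof.
move=> mP fin.
have m1 : measurable_fun setT (fun z : R * R => Phi (rho z.1 t z.2, z.1)) by rewrite /rho; meas.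
have m2 : measurable_fun setT (fun z : R * R => Phi (z.1, rho z.1 t z.2)) by rewrite /rho; meas.
have i2 : (mA \x mS)%E.-integrable setT (fun z : R * R => (Phi (z.1, rho z.1 t z.2))%:E).
  by apply/integrable12ltyP => //; exact/measurable_EFinP.
have i1 : (mA \x mS)%E.-integrable setT (fun z : R * R => (Phi (rho z.1 t z.2, z.1))%:E).
  apply/integrable12ltyP => //; first exact/measurable_EFinP.
  rewrite /= (@translation_swap (fun z => `|Phi z|%:E))//.
  by meas.
rewrite (@Rintegral12_prod _ _ (measurableTypeR R) (measurableTypeR R) R mA mS (fun z => Phi (rho z.1 t z.2, z.1)) i1).
rewrite (@Rintegral12_prod _ _ (measurableTypeR R) (measurableTypeR R) R mA mS (fun z => Phi (z.1, rho z.1 t z.2)) i2).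
rewrite /Rintegral integralE [in RHS]integralE; congr (fine (_ - _)%E).
- transitivity (\int[(mA \x mS)%E]_z (fun w => maxe (Phi w)%:E 0) (rho z.1 t z.2, z.1))%E.
    by apply: eq_integral => z _; rewrite funeposE.
  rewrite (@translation_swap_prod (fun w => maxe (Phi w)%:E 0))%E.
  + by apply: eq_integral => z _; rewrite funeposE.
  + by move=> z; rewrite le_max lexx orbT.
  + by apply: measurable_maxe => //; exact/measurable_EFinP.
- transitivity (\int[(mA \x mS)%E]_z (fun w => maxe (- (Phi w)%:E) 0) (rho z.1 t z.2, z.1))%E.
    by apply: eq_integral => z _; rewrite funenegE.
  rewrite (@translation_swap_prod (fun w => maxe (- (Phi w)%:E) 0))%E.
  + by apply: eq_integral => z _; rewrite funenegE.
  + by move=> z; rewrite le_max lexx orbT.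
  + by apply: measurable_maxe => //; apply: measurableT_comp => //; exact/measurable_EFinP.
Qed.

Definition translate (x : R) (v : R -> R) (t : R) := Rintegral mS setT (fun th => v (rho x t th)).

Definition rhankel (u : R -> R) (xi : R) := Rintegral mA setT (fun x => u x * J (x * xi)).

Lemma translateC (x t : R) v : translate x v t = translate t v x.
Proof. by rewrite /translate; under eq_Rintegral do rewrite rhoC. Qed.

Lemma measurable_translate (v : R -> R) : measurable_fun setT v ->
  measurable_fun setT (fun z : R * R => translate z.1 v z.2).
Proof.
move=> mv; rewrite /translate.
have mF : measurable_fun setT (fun z : R * R * R => v (rho z.1.1 z.1.2 z.2)) by rewrite /rho; meas.
exact: (@measurable_Rintegral1 _ _ _ (measurableTypeR R) R mS _ mF).
Qed.

(** The swap with a function of the first coordinate alone: the angle then integrates to 1. This is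
    the invariance of the Hankel measure under translation. *)
Lemma integral_translation (w : R -> \bar R) (t : R) : (forall x, (0 <= w x)%E) -> measurable_fun setT w ->
  (\int[mA]_x \int[mS]_th w (rho x t th) = \int[mA]_x w x)%E.
Proof.
move=> w0 mw; rewrite (@translation_swap (fun z => w z.1))//; last by meas.
apply: eq_integral => x _; rewrite /= [LHS](@integral_cst _ (measurableTypeR R))//=.
by rewrite [X in (_ * X)%E](_ : _ = 1%E) ?mule1//; exact: mS_setT.
Qed.

Lemma integral_abs_translate (v : R -> R) (t : R) : measurable_fun setT v ->
  (\int[mA]_x `|translate x v t|%:E <= \int[mA]_x `|v x|%:E)%E.
Proof.
move=> mv; rewrite -(@integral_translation (fun x => `|v x|%:E) t)//; last by meas.
have mr : measurable_fun setT (fun z : R * R => v (rho z.1 t z.2)) by rewrite /rho; meas.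
apply: ge0_le_integral => //.
- have mT := measurable_translate mv.
  by apply/measurable_EFinP/measurableT_comp => //; apply: (measurableT_comp mT (_ : measurable_fun setT (fun x : R => (x, t)))); meas.
- by apply: (@measurable_tonelli1 _ _ (measurableTypeR R) (measurableTypeR R) R mS (fun x th => `|v (rho x t th)|%:E)) => //; rewrite /rho; meas.
- move=> x _; apply: le_abs_Rintegral.
  by apply: (measurableT_comp mr (_ : measurable_fun setT (fun th : R => (x, th)))); meas.
Qed.

(** The swap moves the translation from [v] to the Bessel function, where the product formula
    evaluates it. *)
Lemma hankel_translate (v : R -> R) (t xi : R) : measurable_fun setT v ->
  mA.-integrable setT (EFin \o v) ->
  rhankel (fun x => translate x v t) xi = J (t * xi) * rhankel v xi.
Proof.
move=> mv iv; have mJ := measurable_bessel alpha.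
pose Phi (z : R * R) := v z.1 * J (z.2 * xi).
have mPhi : measurable_fun setT Phi by rewrite /Phi; meas.
transitivity (Rintegral mA setT (fun x => Rintegral mS setT (fun th => Phi (rho x t th, x)))).
  apply: eq_Rintegral => x _; rewrite /translate /Phi/= -RintegralZr_line//.
  by rewrite /rho; meas.
rewrite Rintegral_translation_swap//.
  rewrite /rhankel -RintegralZl_line; last by meas.
  apply: eq_Rintegral => x _; rewrite /Phi/= RintegralZl_line; last by rewrite /rho; meas.
  by rewrite bessel_product//; ring.
have /integrableP[_] := iv; apply: le_lt_trans.
have mPr : measurable_fun setT (fun z : R * R => Phi (z.1, rho z.1 t z.2)) by rewrite /rho; meas.
apply: ge0_le_integral => //.
- by move=> x _; exact: integral_ge0.
- by apply: (@measurable_tonelli1 _ _ (measurableTypeR R) (measurableTypeR R) R mS (fun x th => `|Phi (x, rho x t th)|%:E)) => //; rewrite /rho; meas.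
- by apply/measurable_EFinP; meas.
move=> x _; apply: (@le_trans _ _ (\int[mS]_th `|v x|%:E)%E); last first.
  rewrite [leLHS](@integral_cst _ (measurableTypeR R))//= [X in (_ * X <= _)%E](_ : _ = 1%E) ?mule1//; exact: mS_setT.
apply: ge0_le_integral => //.
  by apply/measurable_EFinP/measurableT_comp => //; apply: (measurableT_comp mPr (_ : measurable_fun setT (fun th : R => (x, th)))); meas.
by move=> th _; rewrite lee_fin /Phi/= normrM ler_piMr// bessel_le1.
Qed.

End translation.

(** * Heat kernel, Plancherel and Pitt inequalities *)

Section kernel_line.
Context (R : realType) (m1 m2 : {sigma_finite_measure set (measurableTypeR R) -> \bar R}).

Lemma kernel_Fubini_line (A B : R -> R) (K : R -> R -> R) (M : R) :
  m1.-integrable setT (EFin \o A) -> m2.-integrable setT (EFin \o B) ->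
  measurable_fun setT (fun z : R * R => K z.1 z.2) -> (forall x y, `|K x y| <= M) ->
  Rintegral m1 setT (fun x => A x * Rintegral m2 setT (fun y => B y * K x y)) =
  Rintegral m2 setT (fun y => B y * Rintegral m1 setT (fun x => A x * K x y)).
Proof.
move=> iA iB mK KM.
exact: (@kernel_Fubini _ _ (measurableTypeR R) (measurableTypeR R) R m1 m2 A B (fun z => K z.1 z.2) M).
Qed.

End kernel_line.

Section heat.
Context (R : realType) (alpha : R).
Hypothesis ha : - 2^-1 < alpha.
Local Notation leb := (@lebesgue_measure R).
Local Notation mA := (hankel_measure alpha).
Local Notation mS := (sine_measure alpha).
Local Notation J := (bessel alpha).

Let a1 : 0 < alpha + 1. Proof. by move: ha; lra. Qed.

(** The Hankel transform of [exp(-s xi^2)] in closed form, see [heat_gaussE]. It is positive and has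
    total mass 1, hence so does each of its translates. *)
Definition heat (s z : R) : R := (2 * s) `^ (- (alpha + 1)) * expR (- (z ^+ 2 / (4 * s))).

Lemma measurable_heat (s : R) : measurable_fun setT (heat s).
Proof. by rewrite /heat; meas. Qed.

Lemma heat_ge0 (s z : R) : 0 <= heat s z.
Proof. by rewrite /heat mulr_ge0 ?powR_ge0 ?expR_ge0. Qed.

Lemma heat_le (s z : R) : 0 < s -> heat s z <= (2 * s) `^ (- (alpha + 1)).
Proof.
move=> s0; rewrite /heat ler_piMr ?powR_ge0// expR_le1 oppr_le0.
by rewrite divr_ge0 ?sqr_ge0// mulr_ge0 ?ltW.
Qed.

Lemma integral_heat (s : R) : 0 < s -> (\int[mA]_x (heat s x)%:E = 1)%E.
Proof.
move=> s0; have s4 : 0 < (4 * s)^-1 by rewrite invr_gt0 mulr_gt0.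
transitivity (((2 * s) `^ (- (alpha + 1)))%:E * \int[mA]_x (expR (- ((4 * s)^-1 * x ^+ 2)))%:E)%E.
  rewrite -(@ge0_integralZl _ (measurableTypeR R) R mA setT measurableT (fun x => (expR (- ((4 * s)^-1 * x ^+ 2)))%:E)); last 3 first.
  - by meas.
  - by move=> x _; rewrite lee_fin expR_ge0.
  - by rewrite lee_fin powR_ge0.
  by apply: eq_integral => x _; rewrite /heat -EFinM [x ^+ 2 / _]mulrC.
rewrite integral_gauss_hankel0// -EFinM -powRM ?mulr_ge0 ?invr_ge0 ?mulr_ge0 ?ltW//.
rewrite (_ : 2 * s * (2 * (4 * s)^-1) = 1) ?powR1//.
by field; rewrite gt_eqF.
Qed.

Definition heat_kernel (s x y : R) : R := translate alpha x (heat s) y.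

Lemma heat_kernelC (s x y : R) : heat_kernel s x y = heat_kernel s y x.
Proof. exact: translateC. Qed.

Lemma heat_kernel_ge0 (s x y : R) : 0 <= heat_kernel s x y.
Proof. by apply: Rintegral_ge0 => th _; exact: heat_ge0. Qed.

Lemma measurable_heat_kernel (s : R) : measurable_fun setT (fun z : R * R => heat_kernel s z.1 z.2).
Proof. exact: (measurable_translate alpha (measurable_heat s)). Qed.

Lemma measurable_heat_kernel2 (s x : R) : measurable_fun setT (heat_kernel s x).
Proof.
have mk := measurable_heat_kernel s.
by apply: (measurableT_comp mk (_ : measurable_fun setT (fun y : R => (x, y)))); meas.
Qed.

Lemma heat_gaussE (s z : R) : 0 < s ->
  heat s z = Rintegral mA setT (fun x => expR (- (s * x ^+ 2)) * J (x * z)).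
Proof. by move=> s0; rewrite hankel_gauss. Qed.

(** Writing [heat] as a Hankel transform and averaging over the angle inside, the product formula
    separates [x] and [y]. Nonnegativity is visible in the definition, the spectral action in this
    formula; both are used. *)
Lemma heat_kernelE (s x y : R) : 0 < s -> heat_kernel s x y =
  Rintegral mA setT (fun xi => expR (- (s * xi ^+ 2)) * (J (x * xi) * J (y * xi))).
Proof.
move=> s0; have mJ := measurable_bessel alpha.
have i1 : mS.-integrable setT (EFin \o (fun=> 1)).
  by apply: (integrable_mS ha) => //; exists 1 => _; rewrite normr1.
have mK : measurable_fun setT (fun z : R * R => J (rho x y z.2 * z.1)) by rewrite /rho; meas.
transitivity (Rintegral mS setT (fun th => 1 * Rintegral mA setT (fun xi => expR (- (s * xi ^+ 2)) * J (rho x y th * xi)))).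
  apply: eq_Rintegral => th _; rewrite mul1r (heat_gaussE _ s0).
  by apply: eq_Rintegral => xi _; rewrite [xi * _]mulrC.
apply: etrans (esym (@kernel_Fubini_line R mA mS _ (fun=> 1) (fun xi th => J (rho x y th * xi)) 1
  (integrable_gauss ha s0) i1 mK (fun _ _ => bessel_le1 ha _))) _.
apply: eq_Rintegral => xi _; congr (_ * _).
apply: etrans (bessel_product ha x y xi).
by apply: eq_Rintegral => th _; rewrite mul1r.
Qed.

Lemma integral_heat_kernel (s x : R) : 0 < s -> (\int[mA]_y (heat_kernel s x y)%:E = 1)%E.
Proof.
move=> s0; have mh := measurable_heat s.
rewrite -(integral_heat s0) -(@integral_translation _ _ ha (fun y => (heat s y)%:E) x)//; last 2 first.
- by move=> y; rewrite lee_fin heat_ge0.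
- by meas.
apply: eq_integral => y _; rewrite heat_kernelC /heat_kernel /translate fineK//.
apply: integrable_fin_num => //; apply: (integrable_mS ha); first by rewrite /rho; meas.
by exists ((2 * s) `^ (- (alpha + 1))) => th; rewrite ger0_norm ?heat_ge0 ?heat_le.
Qed.

Lemma integrable_heat_kernel (s x : R) (b : R -> R) (M : R) : 0 < s -> measurable_fun setT b ->
  (forall y, `|b y| <= M) -> mA.-integrable setT (fun y => (b y * heat_kernel s x y)%:E).
Proof.
move=> s0 mb bM; have mk := measurable_heat_kernel2 s x.
have M0 : 0 <= M by apply: le_trans (bM 0).
apply/integrableP; split; first by meas.
apply: (@le_lt_trans _ _ (\int[mA]_y (M%:E * (heat_kernel s x y)%:E))%E).
  apply: ge0_le_integral => //.
  - by apply/measurable_EFinP; meas.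
  - by apply/measurable_EFinP; meas.
  - by move=> y _; rewrite abse_EFin -EFinM lee_fin normrM (ger0_norm (heat_kernel_ge0 _ _ _)) ler_wpM2r ?heat_kernel_ge0.
rewrite ge0_integralZl//=; last 2 first.
- by meas.
- by move=> y _; rewrite lee_fin heat_kernel_ge0.
by rewrite integral_heat_kernel// mule1 ltry.
Qed.

Lemma integrable_gauss_bessel (s x : R) : 0 < s ->
  mA.-integrable setT (fun xi => (expR (- (s * xi ^+ 2)) * J (x * xi))%:E).
Proof.
move=> s0; have mJ := measurable_bessel alpha.
apply: (@le_integrable _ _ _ mA _ measurableT _ (fun xi => (expR (- (s * xi ^+ 2)))%:E)).
- by meas.
- by move=> xi _; rewrite /= lee_fin normrM ler_piMr// bessel_le1.
- exact: integrable_gauss.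
Qed.

(** Fubini turns the kernel into the multiplier [exp(-s xi^2)] on the transform side. *)
Lemma heat_kernel_apply (g : R -> R) (s x : R) : 0 < s ->
  mA.-integrable setT (EFin \o g) ->
  Rintegral mA setT (fun y => g y * heat_kernel s x y) =
  Rintegral mA setT (fun xi => expR (- (s * xi ^+ 2)) * J (x * xi) * rhankel alpha g xi).
Proof.
move=> s0 ig; have mJ := measurable_bessel alpha.
have mK : measurable_fun setT (fun z : R * R => J (z.1 * z.2)) by meas.
transitivity (Rintegral mA setT (fun y => g y * Rintegral mA setT (fun xi => expR (- (s * xi ^+ 2)) * J (x * xi) * J (y * xi)))).
  apply: eq_Rintegral => y _; rewrite (heat_kernelE _ _ s0); congr (_ * _).
  by apply: eq_Rintegral => xi _; rewrite mulrA.
exact: (@kernel_Fubini_line R mA mA g (fun xi => expR (- (s * xi ^+ 2)) * J (x * xi)) (fun y xi => J (y * xi)) 1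
  ig (integrable_gauss_bessel x s0) mK (fun _ _ => bessel_le1 ha _)).
Qed.

Lemma measurable_rhankel (g : R -> R) : measurable_fun setT g -> measurable_fun setT (rhankel alpha g).
Proof.
move=> mg; have mJ := measurable_bessel alpha.
have mF : measurable_fun setT (fun z : R * R => g z.2 * J (z.2 * z.1)) by meas.
exact: (@measurable_Rintegral1 _ _ (measurableTypeR R) (measurableTypeR R) R mA _ mF).
Qed.

Lemma rhankel_bound (g : R -> R) : mA.-integrable setT (EFin \o g) ->
  exists M : R, forall xi, `|rhankel alpha g xi| <= M.
Proof.
move=> ig; have mJ := measurable_bessel alpha.
have mg : measurable_fun setT g by apply/measurable_EFinP; exact: measurable_int ig.
exists (fine (\int[mA]_x `|g x|%:E)) => xi.
have /integrableP[_ fin] := ig.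
rewrite -lee_fin fineK; last by rewrite ge0_fin_numE//; apply: integral_ge0 => x _; rewrite lee_fin.
apply: le_trans (@le_abs_Rintegral _ (measurableTypeR R) R mA _ _) _; first by meas.
apply: ge0_le_integral => //.
- by apply/measurable_EFinP; meas.
- by apply/measurable_EFinP; meas.
- by move=> x _; rewrite lee_fin normrM ler_piMr// bessel_le1.
Qed.

Lemma integrable_gauss_mul (s : R) (b : R -> R) : 0 < s -> measurable_fun setT b ->
  (exists M : R, forall y, `|b y| <= M) ->
  mA.-integrable setT (fun xi => (expR (- (s * xi ^+ 2)) * b xi)%:E).
Proof.
move=> s0 mb [M bM].
have := @integrableZl _ _ _ mA setT measurableT M _ (integrable_gauss ha s0).
apply: le_integrable => //; first by meas.
move=> xi _; rewrite /= lee_fin normrM mulrC [leRHS]normrM.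
by rewrite ler_wpM2r//; apply: le_trans (bM _) (ler_norm _).
Qed.

(** A second Fubini pairs the remaining Bessel factor with [g] and yields its transform again, hence
    the square. *)
Lemma heat_quadratic (g : R -> R) (s : R) : 0 < s ->
  mA.-integrable setT (EFin \o g) ->
  Rintegral mA setT (fun x => g x * Rintegral mA setT (fun y => g y * heat_kernel s x y)) =
  Rintegral mA setT (fun xi => expR (- (s * xi ^+ 2)) * rhankel alpha g xi ^+ 2).
Proof.
move=> s0 ig; have mJ := measurable_bessel alpha.
have mK : measurable_fun setT (fun z : R * R => J (z.1 * z.2)) by meas.
have mg : measurable_fun setT g by apply/measurable_EFinP; exact: measurable_int ig.
have mH := measurable_rhankel mg.
transitivity (Rintegral mA setT (fun x => g x * Rintegral mA setT (fun xi => expR (- (s * xi ^+ 2)) * rhankel alpha g xi * J (x * xi)))).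
  apply: eq_Rintegral => x _; congr (_ * _); apply: etrans (heat_kernel_apply x s0 ig) _.
  by apply: eq_Rintegral => xi _; exact: mulrAC.
apply: etrans (@kernel_Fubini_line R mA mA g (fun xi => expR (- (s * xi ^+ 2)) * rhankel alpha g xi) (fun x xi => J (x * xi)) 1
  ig (integrable_gauss_mul s0 mH (rhankel_bound ig)) mK (fun _ _ => bessel_le1 ha _)) _.
by apply: eq_Rintegral => xi _; rewrite [rhankel _ _ _ ^+ 2]expr2; exact: (esym (mulrA _ _ _)).
Qed.

Definition gauss_heat (r s x : R) : R :=
  (1 + 4 * r * s) `^ (- (alpha + 1)) * expR (- (r * x ^+ 2 / (1 + 4 * r * s))).

(** The transform of [exp(-r y^2)] is a gaussian of parameter [1/(4 r)]; damping adds [s], and a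
    second transform gives a gaussian again. The prefactors multiply to a power of
    [2 r * 2 (s + 1/(4 r)) = 1 + 4 r s]. *)
Lemma heat_kernel_gauss (r s x : R) : 0 < r -> 0 < s ->
  Rintegral mA setT (fun y => expR (- (r * y ^+ 2)) * heat_kernel s x y) = gauss_heat r s x.
Proof.
move=> r0 s0; have mJ := measurable_bessel alpha.
have q0 : 0 < s + (4 * r)^-1 by rewrite addr_gt0// invr_gt0 mulr_gt0.
have d0 : 0 < 1 + 4 * r * s by rewrite addr_gt0// !mulr_gt0.
rewrite heat_kernel_apply//; last exact: integrable_gauss.
transitivity (Rintegral mA setT (fun xi => (2 * r) `^ (- (alpha + 1)) * (expR (- ((s + (4 * r)^-1) * xi ^+ 2)) * J (xi * x)))).
  apply: eq_Rintegral => xi _; rewrite /rhankel hankel_gauss//.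
  have -> : - ((s + (4 * r)^-1) * xi ^+ 2) = - (s * xi ^+ 2) + - (xi ^+ 2 / (4 * r)) by ring.
  rewrite expRD [xi * x]mulrC.
  by move: (expR _) (expR _) (J _) (_ `^ _) => u v w z; ring.
rewrite RintegralZl_line; last by meas.
rewrite hankel_gauss// mulrA -powRM ?mulr_ge0 ?ltW//; congr (_ `^ _ * expR (- _)).
  by field; rewrite gt_eqF.
by field; rewrite !gt_eqF// -?[_ * r * s]mulrA ?mulr_gt0//; move: d0; lra.
Qed.

Lemma integral_heat_kernel_gauss (r s x : R) : 0 < r -> 0 < s ->
  (\int[mA]_y (expR (- (r * y ^+ 2)) * heat_kernel s x y)%:E = (gauss_heat r s x)%:E)%E.
Proof.
move=> r0 s0; rewrite -heat_kernel_gauss// fineK//.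
apply: integrable_fin_num => //; apply: (@integrable_heat_kernel s x _ 1) => //; first by meas.
by move=> y; rewrite ger0_norm ?expR_ge0// expR_le1 oppr_le0 mulr_ge0 ?sqr_ge0// ltW.
Qed.

End heat.

(** * The heat kernel as approximate identity; Plancherel inequality *)

Section Plancherel.
Context (R : realType) (alpha : R).
Hypothesis ha : - 2^-1 < alpha.
Local Notation leb := (@lebesgue_measure R).
Local Notation mA := (hankel_measure alpha).
Local Notation J := (bessel alpha).
Local Notation k := (heat_kernel alpha).

Lemma gauss_heat_cvg (r x : R) : 0 < r ->
  gauss_heat alpha r n.+1%:R^-1 x @[n --> \oo] --> expR (- (r * x ^+ 2)).
Proof.
move=> r0; pose d n : R := 1 + 4 * r * n.+1%:R^-1.
have d0 n : 0 < d n by rewrite addr_gt0// !mulr_gt0// invr_gt0.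
have cd : d n @[n --> \oo] --> (1 : R).
  rewrite -[X in _ --> X]addr0 -[X in _ --> _ + X](mulr0 (4 * r)).
  by apply: cvgD; [exact: cvg_cst|apply: cvgM; [exact: cvg_cst|exact: cvg_harmonic]].
have cl : ln (d n) @[n --> \oo] --> (0 : R).
  by rewrite -ln1; apply: continuous_cvg => //; exact: continuous_ln.
have cv : (d n)^-1 @[n --> \oo] --> (1 : R).
  by rewrite -[X in _ --> X]invr1; apply: cvgV => //; exact: oner_neq0.
have -> : (fun n => gauss_heat alpha r n.+1%:R^-1 x) =
    (fun n => expR (- (alpha + 1) * ln (d n)) * expR (- (r * x ^+ 2 * (d n)^-1))).
  by apply/funext => n; rewrite /gauss_heat -/(d n) powR_expR.
have c1 : expR (- (alpha + 1) * ln (d n)) @[n --> \oo] --> (1 : R).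
  rewrite -[X in _ --> X]expR0 -[X in _ --> expR X](mulr0 (- (alpha + 1))).
  apply: continuous_cvg; first exact: continuous_expR.
  by apply: cvgM => //; exact: cvg_cst.
have c2 : expR (- (r * x ^+ 2 * (d n)^-1)) @[n --> \oo] --> expR (- (r * x ^+ 2 * 1)).
  apply: continuous_cvg; first exact: continuous_expR.
  by apply: cvgN; apply: cvgM => //; exact: cvg_cst.
rewrite (_ : expR (- (r * x ^+ 2)) = 1 * expR (- (r * x ^+ 2 * 1))); last by rewrite mul1r mulr1.
exact: cvgM.
Qed.

Lemma Rintegral_heat_kernelD (s x : R) (b1 b2 : R -> R) (M1 M2 : R) : 0 < s ->
  measurable_fun setT b1 -> measurable_fun setT b2 ->
  (forall y, `|b1 y| <= M1) -> (forall y, `|b2 y| <= M2) ->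
  Rintegral mA setT (fun y => (b1 y + b2 y) * k s x y) =
  Rintegral mA setT (fun y => b1 y * k s x y) + Rintegral mA setT (fun y => b2 y * k s x y).
Proof.
move=> s0 m1 m2 h1 h2.
have i1 := integrable_heat_kernel ha x s0 m1 h1.
have i2 := integrable_heat_kernel ha x s0 m2 h2.
rewrite -(@RintegralD _ (measurableTypeR R) R mA setT _ _ measurableT i1 i2).
by apply: eq_Rintegral => y _; rewrite mulrDl.
Qed.

Lemma Rintegral_heat_kernel_cst (s x c : R) : 0 < s -> Rintegral mA setT (fun y => c * k s x y) = c.
Proof.
move=> s0; have mk := measurable_heat_kernel2 alpha s x.
by rewrite RintegralZl_line// /Rintegral integral_heat_kernel// mulr1.
Qed.

Lemma gauss_le1 (r y : R) : 0 <= r -> `|expR (- (r * y ^+ 2))| <= 1.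
Proof.
by move=> r0; rewrite ger0_norm ?expR_ge0// expR_le1 oppr_le0 mulr_ge0 ?sqr_ge0.
Qed.

(** The average of [(exp(-x^2) - exp(-y^2))^2] over [y] under the heat kernel at [x], after
    expanding the square. *)
Definition heat_variance (s x : R) : R :=
  expR (- x ^+ 2) ^+ 2 - 2 * expR (- x ^+ 2) * gauss_heat alpha 1 s x + gauss_heat alpha 2 s x.

(* Chebyshev's inequality with the test function y |-> exp(-y^2), whose first two moments under the
   heat kernel are explicit. *)
Lemma heat_kernel_deviation (g : R -> R) (s x M eps D : R) : 0 < s -> measurable_fun setT g ->
  (forall y, `|g y| <= M) -> 0 <= eps -> 0 <= D ->
  (forall y, `|g y - g x| <= eps + D * (expR (- x ^+ 2) - expR (- y ^+ 2)) ^+ 2) ->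
  `|Rintegral mA setT (fun y => g y * k s x y) - g x| <= eps + D * heat_variance s x.
Proof.
move=> s0 mg gM e0 D0 H; set A := expR (- x ^+ 2).
have mk := measurable_heat_kernel2 alpha s x.
have A1 : `|A| <= 1 by have := @gauss_le1 1 x ler01; rewrite mul1r.
have -> : Rintegral mA setT (fun y => g y * k s x y) - g x =
   Rintegral mA setT (fun y => (g y + - g x) * k s x y).
  rewrite (@Rintegral_heat_kernelD s x g (fun=> - g x) M `|g x| s0)//; last by move=> y; rewrite normrN.
  by rewrite Rintegral_heat_kernel_cst.
have bg y : `|g y + - g x| <= M + M by apply: le_trans (ler_normB _ _) _; exact: lerD.
have i1 : mA.-integrable setT (fun y => ((g y + - g x) * k s x y)%:E).
  by apply: (integrable_heat_kernel ha x s0 _ bg); meas.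
have be (y : R) : `|expR (- y ^+ 2)| <= 1 by have := @gauss_le1 1 y ler01; rewrite mul1r.
have b2 y : `|eps + D * (A - expR (- y ^+ 2)) ^+ 2| <= eps + D * 4.
  apply: le_trans (ler_normD _ _) _; rewrite ger0_norm// lerD2l normrM ger0_norm// ler_wpM2l//.
  rewrite normrX (_ : 4 = 2 ^+ 2 :> R); last by ring.
  rewrite lerXn2r ?nnegrE//; apply: le_trans (ler_normB _ _) _.
  by have := be y; move: A1; lra.
have m2 : measurable_fun setT (fun y : R => eps + D * (A - expR (- y ^+ 2)) ^+ 2) by meas.
have i2 := integrable_heat_kernel ha x s0 m2 b2.
apply: (@le_trans _ _ (Rintegral mA setT (fun y => (eps + D * (A - expR (- y ^+ 2)) ^+ 2) * k s x y))).
  apply: le_trans (@le_normr_Rintegral _ (measurableTypeR R) R mA _ _ measurableT i1) _.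
  apply: le_Rintegral => //.
    exact: integrable_norm.
  move=> y _; rewrite normrM (ger0_norm (heat_kernel_ge0 _ _ _ _)) ler_wpM2r ?heat_kernel_ge0//.
rewrite le_eqVlt; apply/orP; left; apply/eqP.
have c0 (y : R) : `|eps + D * A ^+ 2| <= `|eps + D * A ^+ 2| by [].
have c1 (y : R) : `|- (2 * D * A) * expR (- (1 * y ^+ 2))| <= `|2 * D * A|.
  by rewrite normrM normrN ler_piMr// gauss_le1.
have c2 (y : R) : `|D * expR (- (2 * y ^+ 2))| <= D.
  by rewrite normrM ger0_norm// ler_piMr// gauss_le1.
transitivity (Rintegral mA setT (fun y => ((eps + D * A ^+ 2) +
     ((- (2 * D * A)) * expR (- (1 * y ^+ 2)) + D * expR (- (2 * y ^+ 2)))) * k s x y)).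
  apply: eq_Rintegral => y _; congr (_ * _).
  have -> : expR (- (2 * y ^+ 2)) = expR (- y ^+ 2) ^+ 2.
    by rewrite -expRM_natl; congr expR; ring.
  by rewrite mul1r; move: (expR _) => w; ring.
rewrite (@Rintegral_heat_kernelD s x _ _ _ (`|2 * D * A| + D) s0 _ _ c0); last 3 first.
- by meas.
- by meas.
- by move=> y; apply: le_trans (ler_normD _ _) _; exact: lerD.
rewrite Rintegral_heat_kernel_cst//.
rewrite (@Rintegral_heat_kernelD s x _ _ _ _ s0 _ _ c1 c2); last 2 first.
- by meas.
- by meas.
have -> : Rintegral mA setT (fun y => - (2 * D * A) * expR (- (1 * y ^+ 2)) * k s x y) =
    - (2 * D * A) * gauss_heat alpha 1 s x.
  rewrite -(heat_kernel_gauss ha x ltr01 s0) -RintegralZl_line; last by meas.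
  by apply: eq_Rintegral => y _; rewrite mulrA.
have -> : Rintegral mA setT (fun y => D * expR (- (2 * y ^+ 2)) * k s x y) =
    D * gauss_heat alpha 2 s x.
  rewrite -(heat_kernel_gauss ha x (ltr0Sn _ 1) s0) -RintegralZl_line; last by meas.
  by apply: eq_Rintegral => y _; rewrite mulrA.
by rewrite /heat_variance -/A; ring.
Qed.

(** For [u >= 0] the function [exp(-u^2)] decreases strictly, and [d < x] keeps [x - d] positive.
    The two gaps, at [x - d] and [x + d], give the constant; [|y|] appears because the test function
    is even. *)
Lemma gauss_separation (x d : R) : 0 < d < x -> exists2 c : R, 0 < c &
  forall y, d <= `| `|y| - x| -> c <= (expR (- x ^+ 2) - expR (- y ^+ 2)) ^+ 2.
Proof.
move=> /andP[d0 dx]; have x0 := lt_trans d0 dx.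
pose c1 := expR (- (x - d) ^+ 2) - expR (- x ^+ 2).
pose c2 := expR (- x ^+ 2) - expR (- (x + d) ^+ 2).
have sq (u v : R) : 0 <= u -> u <= v -> expR (- v ^+ 2) <= expR (- u ^+ 2).
  by move=> u0 uv; rewrite ler_expR lerN2 lerXn2r ?nnegrE// (le_trans u0).
have sqs (u v : R) : 0 <= u -> u < v -> expR (- v ^+ 2) < expR (- u ^+ 2).
  by move=> u0 uv; rewrite ltr_expR ltrN2 ltrXn2r ?nnegrE// ltW// (le_lt_trans u0).
have c10 : 0 < c1 by rewrite subr_gt0; apply: sqs; lra.
have c20 : 0 < c2 by rewrite subr_gt0; apply: sqs; lra.
exists (Num.min c1 c2 ^+ 2); first by rewrite exprn_gt0// lt_min c10.
move=> y; rewrite ler_normr => h.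
have m0 : 0 <= Num.min c1 c2 by rewrite le_min !ltW.
have -> : y ^+ 2 = `|y| ^+ 2 by rewrite real_normK ?num_real.
case/orP: h => h.
- have h1 : Num.min c1 c2 <= expR (- x ^+ 2) - expR (- `|y| ^+ 2).
    rewrite ge_min; apply/orP; right; rewrite lerB//; apply: sq; first lra.
    by move: h; lra.
  by rewrite lerXn2r ?nnegrE// (le_trans m0).
- have h1 : Num.min c1 c2 <= expR (- `|y| ^+ 2) - expR (- x ^+ 2).
    rewrite ge_min; apply/orP; left; rewrite lerB//; apply: sq => //.
    by move: h; lra.
  by rewrite -[leRHS]sqrrN opprB lerXn2r ?nnegrE// (le_trans m0).
Qed.

(** Near [x], in the sense of [|y|], continuity and evenness bound the increment of [g] by [e/2].
    Elsewhere it is at most [2 M], which [gauss_separation] bounds by a multiple of the squared gap.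
    The deviation bound then applies, and its variance tends to 0. *)
Lemma heat_kernel_cvg (g : R -> R) (x M : R) : continuous g -> (forall y, g (- y) = g y) ->
  (forall y, `|g y| <= M) -> 0 < x ->
  Rintegral mA setT (fun y => g y * k n.+1%:R^-1 x y) @[n --> \oo] --> g x.
Proof.
move=> cg ge gM x0; have mg := continuous_measurable_fun cg.
have M0 : 0 <= M by apply: le_trans (gM 0).
apply/cvgrPdist_le => e e0; have e20 : 0 < e / 2 by rewrite divr_gt0.
have /cvgrPdist_le/(_ _ e20) := cg x.
rewrite near_nbhs => -[d /= d0 hd].
(* The cap [x / 2] makes the radius smaller than [x], as the separation of gaussians requires. *)
pose d' := Num.min d (x / 2).
have d'0 : 0 < d' by rewrite lt_min d0 divr_gt0.
have d'x : 0 < d' < x by rewrite d'0 gt_min; apply/orP; right; lra.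
have [c c0 hc] := gauss_separation d'x.
have D0 : 0 <= (M + M) / c by rewrite divr_ge0 ?addr_ge0// ltW.
have H y : `|g y - g x| <= e / 2 + (M + M) / c * (expR (- x ^+ 2) - expR (- y ^+ 2)) ^+ 2.
  have [hy|hy] := ltP `| `|y| - x| d'.
    apply: (@le_trans _ _ (e / 2)); last by rewrite lerDl mulr_ge0 ?sqr_ge0.
    have -> : g y = g `|y| by have [//|//] := ger0P y; rewrite ge.
    rewrite distrC; apply: hd; rewrite /ball_/= distrC (lt_le_trans hy)// ge_min lexx//.
  apply: (@le_trans _ _ ((M + M) / c * c)).
    rewrite divfK ?gt_eqF//; apply: le_trans (ler_normB _ _) _; exact: lerD.
  by apply: ler_wpDl; [exact: ltW|rewrite ler_wpM2l// hc].
have cV : (M + M) / c * heat_variance n.+1%:R^-1 x @[n --> \oo] --> 0.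
  rewrite -[X in _ --> X](mulr0 ((M + M) / c)); apply: cvgM; first exact: cvg_cst.
  have -> : (0 : R) = expR (- x ^+ 2) ^+ 2 - 2 * expR (- x ^+ 2) * expR (- (1 * x ^+ 2)) + expR (- (2 * x ^+ 2)).
    have -> : expR (- (2 * x ^+ 2)) = expR (- x ^+ 2) ^+ 2.
      by rewrite -expRM_natl; congr expR; ring.
    by rewrite mul1r; move: (expR _) => w; ring.
  apply: cvgD; last by apply: gauss_heat_cvg.
  apply: cvgB; first exact: cvg_cst.
  by apply: cvgM; [exact: cvg_cst|exact: gauss_heat_cvg].
have /cvgrPdist_le/(_ _ e20) := cV.
apply: filterS => n; rewrite sub0r normrN => hn.
have s0 : 0 < n.+1%:R^-1 :> R by rewrite invr_gt0.
rewrite distrC; apply: le_trans (heat_kernel_deviation s0 mg gM (ltW e20) D0 H) _.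
by have := le_trans (ler_norm _) hn; lra.
Qed.

Lemma integrable_sqr (g : R -> R) (M : R) : measurable_fun setT g -> (forall y, `|g y| <= M) ->
  mA.-integrable setT (EFin \o g) -> mA.-integrable setT (fun x => (g x ^+ 2)%:E).
Proof.
move=> mg gM ig; have := @integrableZl _ _ _ mA setT measurableT M _ ig.
apply: le_integrable => //; first by meas.
move=> x _; rewrite /= lee_fin expr2 normrM [leRHS]normrM ler_wpM2r//.
by apply: le_trans (gM _) (ler_norm _).
Qed.

(** The heat quadratic form of [g] is at most the spectral integral, because [exp(-s xi^2) <= 1]. As
    [s] tends to 0 it converges to the integral of [g^2], by dominated convergence with majorant
    [M |g|]. *)
Lemma Plancherel_le (g : R -> R) (M : R) : continuous g -> (forall y, g (- y) = g y) ->
  (forall y, `|g y| <= M) -> mA.-integrable setT (EFin \o g) ->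
  (\int[mA]_x (g x ^+ 2)%:E <= \int[mA]_xi (rhankel alpha g xi ^+ 2)%:E)%E.
Proof.
move=> cg ge gM ig; have mg := continuous_measurable_fun cg.
have M0 : 0 <= M by apply: le_trans (gM 0).
have mH : measurable_fun setT (rhankel alpha g) by exact: measurable_rhankel.
have mP := @measurable_posind R.
have i2 := integrable_sqr mg gM ig.
set B := (\int[mA]_xi (rhankel alpha g xi ^+ 2)%:E)%E; case EB : B => [L| |]; last 2 first.
- by rewrite leey.
- have : (0 <= B)%E by apply: integral_ge0 => x _; rewrite lee_fin sqr_ge0.
  by rewrite EB.
pose s n : R := n.+1%:R^-1.
have s0 n : 0 < s n by rewrite invr_gt0.
pose P n x := Rintegral mA setT (fun y => g y * k (s n) x y).
have mPn n : measurable_fun setT (P n).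
  have mk := measurable_heat_kernel alpha (s n).
  have mF : measurable_fun setT (fun z : R * R => g z.2 * k (s n) z.1 z.2).
    apply: (@measurable_funM _ _ _ _ (fun z : R * R => g z.2) (fun z => k (s n) z.1 z.2)) => //.
    by meas.
  exact: (@measurable_Rintegral1 _ _ (measurableTypeR R) (measurableTypeR R) R mA _ mF).
have bP n x : `|P n x| <= M.
  have ik : mA.-integrable setT (fun y => (M * k (s n) x y)%:E).
    by apply: (@integrable_heat_kernel _ _ ha _ _ (fun=> M) M) => // _; rewrite ger0_norm.
  have ig' := integrable_heat_kernel ha x (s0 n) mg gM.
  apply: le_trans (@le_normr_Rintegral _ (measurableTypeR R) R mA _ _ measurableT ig') _.
  rewrite -[leRHS](Rintegral_heat_kernel_cst x M (s0 n)); apply: le_Rintegral => //.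
    exact: integrable_norm.
  by move=> y _; rewrite normrM (ger0_norm (heat_kernel_ge0 _ _ _ _)) ler_wpM2r ?heat_kernel_ge0.
pose u n := Rintegral mA setT (fun x => g x * P n x).
have uL n : u n <= L.
  rewrite /u heat_quadratic// -lee_fin -EB.
  have iq : mA.-integrable setT (fun xi => (expR (- (s n * xi ^+ 2)) * rhankel alpha g xi ^+ 2)%:E).
    apply: (@integrable_gauss_mul _ _ ha (s n) (fun xi => rhankel alpha g xi ^+ 2)) => //; first by meas.
    have [N hN] := rhankel_bound ha ig; exists (N ^+ 2) => y; rewrite normrX lerXn2r ?nnegrE//.
    by apply: le_trans (hN y).
  rewrite fineK; last exact: integrable_fin_num.
  apply: ge0_le_integral => //.
  - by move=> x _; rewrite lee_fin mulr_ge0 ?expR_ge0 ?sqr_ge0.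
  - by meas.
  - by meas.
  - move=> x _; rewrite lee_fin ler_piMl ?sqr_ge0//.
    by apply: le_trans (ler_norm _) (gauss_le1 _ _); exact: ltW.
have cu : u n @[n --> \oo] --> Rintegral mA setT (fun x => g x ^+ 2).
  (* Convergence of [P n] to [g] is known for [x > 0] only. The factor [posind] changes no integral
     and makes the convergence hold at every point. *)
  have -> : Rintegral mA setT (fun x => g x ^+ 2) = Rintegral mA setT (fun x => g x ^+ 2 * posind x).
    by apply: eq_Rintegral_hankel; [meas|meas|move=> x x0; rewrite posind_gt0// mulr1].
  have -> : u = (fun n => Rintegral mA setT (fun x => g x * P n x * posind x)).
    apply/funext => n; apply: eq_Rintegral_hankel; last by move=> x x0; rewrite posind_gt0// mulr1.
    - by have mPn' := mPn n; meas.
    - by have mPn' := mPn n; meas.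
  apply: (@Rintegral_dominated_cvg _ (measurableTypeR R) R mA _ _ (fun x => M * `|g x|)).
  - by move=> n; have mPn' := mPn n; meas.
  - by meas.
  - move=> x; have [x0|x0] := ltP 0 x; last first.
      rewrite posind_le0// mulr0; under eq_fun do rewrite mulr0; exact: cvg_cst.
    rewrite posind_gt0// mulr1 expr2; under eq_fun do rewrite mulr1.
    by apply: cvgM; [exact: cvg_cst|exact: heat_kernel_cvg].
  - have := @integrableZl _ _ _ mA setT measurableT M _ (integrable_norm ig).
    by apply: eq_integrable => // x _.
  - move=> n x; rewrite normrM normrM mulrAC mulrC; apply: ler_pM => //.
      by rewrite posindE; case: (0 < x)%R; rewrite ?normr1 ?normr0 ?mulr1 ?mulr0// ; move: (bP n x); rewrite ?mulr1.
have -> : (\int[mA]_x (g x ^+ 2)%:E = (Rintegral mA setT (fun x => g x ^+ 2))%:E)%E.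
  by rewrite fineK//; exact: integrable_fin_num.
rewrite lee_fin -(cvg_lim (@Rhausdorff R) cu); apply: limr_le; first exact: (cvgP _ cu).
exact: nearW.
Qed.

End Plancherel.

(** * Pitt's inequality by a Schur test *)

Section Pitt.
Context (R : realType) (alpha beta : R).
Hypotheses (ha : - 2^-1 < alpha) (b0 : 0 < beta) (ba : beta < alpha + 1).
Local Notation leb := (@lebesgue_measure R).
Local Notation mA := (hankel_measure alpha).
Local Notation J := (bessel alpha).
Local Notation k := (heat_kernel alpha).

Let a1 : 0 < alpha + 1. Proof. by move: ha; lra. Qed.

Lemma ge0_integralZl_hankel (f : R -> \bar R) (c : R) : (forall x, (0 <= f x)%E) ->
  measurable_fun setT f -> 0 <= c -> (\int[mA]_x (c%:E * f x) = c%:E * \int[mA]_x f x)%E.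
Proof.
by move=> f0 mf c0; apply: (@ge0_integralZl _ (measurableTypeR R) R mA setT measurableT) => // x _.
Qed.

(** Absolute values may be moved inside the quadratic form without touching the kernel, which is
    nonnegative. From here on everything is nonnegative. *)
Lemma heat_quadratic_le (g : R -> R) (s : R) : 0 < s -> mA.-integrable setT (EFin \o g) ->
  (\int[mA]_xi (expR (- (s * xi ^+ 2)) * rhankel alpha g xi ^+ 2)%:E <=
   \int[mA]_x \int[mA]_y (`|g x| * `|g y| * k s x y)%:E)%E.
Proof.
move=> s0 ig.
have mg : measurable_fun setT g by apply/measurable_EFinP; exact: measurable_int ig.
have mH : measurable_fun setT (rhankel alpha g) by exact: measurable_rhankel.
have mq : measurable_fun setT (fun xi => rhankel alpha g xi ^+ 2) by meas.
have mk := measurable_heat_kernel alpha s.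
have mk2 := measurable_heat_kernel2 alpha s.
have iq : mA.-integrable setT (fun xi => (expR (- (s * xi ^+ 2)) * rhankel alpha g xi ^+ 2)%:E).
  apply: (@integrable_gauss_mul _ _ ha s (fun xi => rhankel alpha g xi ^+ 2)); [exact: s0|exact: mq|].
  have [N hN] := rhankel_bound ha ig; exists (N ^+ 2) => y; rewrite normrX lerXn2r ?nnegrE//.
  by apply: le_trans (hN y).
have mgk : measurable_fun setT (fun z : R * R => g z.2 * k s z.1 z.2).
  by apply: (@measurable_funM _ _ _ _ (fun z : R * R => g z.2) (fun z => k s z.1 z.2)) => //; meas.
have mP : measurable_fun setT (fun x => Rintegral mA setT (fun y => g y * k s x y)).
  exact: (@measurable_Rintegral1 _ _ (measurableTypeR R) (measurableTypeR R) R mA _ mgk).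
have mgkx x : measurable_fun setT (fun y => g y * k s x y).
  by have mkx := mk2 x; meas.
apply: (@le_trans _ _ (`|Rintegral mA setT (fun xi => expR (- (s * xi ^+ 2)) * rhankel alpha g xi ^+ 2)|)%:E).
  by rewrite ger0_norm ?fineK//; [exact: integrable_fin_num|
    apply: Rintegral_ge0 => x _; rewrite mulr_ge0 ?expR_ge0 ?sqr_ge0].
rewrite -(heat_quadratic ha s0 ig).
have mgP : measurable_fun setT (fun x => g x * Rintegral mA setT (fun y => g y * k s x y)).
  exact: (@measurable_funM _ _ _ _ g _ mg mP).
apply: le_trans (@le_abs_Rintegral _ (measurableTypeR R) R mA _ mgP) _.
apply: ge0_le_integral => //.
- by apply/measurable_EFinP; apply: (measurableT_comp (@normr_measurable _ _)); exact: mgP.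
- apply: (@measurable_tonelli1 _ _ (measurableTypeR R) (measurableTypeR R) R mA (fun x y => (`|g x| * `|g y| * k s x y)%:E)).
    by move=> x y; rewrite lee_fin !mulr_ge0 ?heat_kernel_ge0.
  apply/measurable_EFinP; apply: (@measurable_funM _ _ _ _ (fun z : R * R => `|g z.1| * `|g z.2|) (fun z => k s z.1 z.2)) => //.
  by meas.
move=> x _; rewrite normrM EFinM.
apply: (@le_trans _ _ (`|g x|%:E * \int[mA]_y `|g y * k s x y|%:E)%E).
  apply: lee_wpmul2l; first by rewrite lee_fin.
  exact: (@le_abs_Rintegral _ (measurableTypeR R) R mA _ (mgkx x)).
rewrite -ge0_integralZl_hankel//; last by apply/measurable_EFinP; apply: (measurableT_comp (@normr_measurable _ _)); exact: mgkx.
rewrite le_eqVlt; apply/orP; left; apply/eqP; apply: eq_integral => y _.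
by rewrite -EFinM normrM (ger0_norm (heat_kernel_ge0 _ _ _ _)) mulrA.
Qed.

(** By the inequality of means, [|g x| |g y|] is at most half the sum of [g(x)^2 h(x)/h(y)] and
    [g(y)^2 h(y)/h(x)]. For a symmetric kernel the two halves have equal integrals. The quotient is
    written with the power [-1], which is measurable on the whole line. *)
Lemma Schur_test (g h : R -> R) (K : R -> R -> R) :
  measurable_fun setT g -> measurable_fun setT h -> measurable_fun setT (fun z : R * R => K z.1 z.2) ->
  (forall x y, 0 <= K x y) -> (forall x y, K x y = K y x) -> (forall x, 0 < x -> 0 < h x) ->
  (forall x, 0 <= h x) ->
  (\int[mA]_x \int[mA]_y (`|g x| * `|g y| * K x y)%:E <=
   \int[mA]_x \int[mA]_y (g x ^+ 2 * h x * (h y) `^ (-1) * K x y)%:E)%E.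
Proof.
move=> mg mh mK K0 KC h0 hge.
pose F x y : R := g x ^+ 2 * h x * (h y) `^ (-1) * K x y.
have F0 x y : 0 <= F x y by rewrite /F mulr_ge0// mulr_ge0 ?powR_ge0// mulr_ge0 ?sqr_ge0.
have mF : measurable_fun setT (fun z : R * R => (F z.1 z.2)%:E).
  apply/measurable_EFinP; apply: (@measurable_funM _ _ _ _ (fun z : R * R => g z.1 ^+ 2 * h z.1 * h z.2 `^ (-1)) (fun z => K z.1 z.2)) => //.
  by meas.
have mF' : measurable_fun setT (fun z : R * R => (F z.2 z.1)%:E).
  by apply: (measurableT_comp mF (_ : measurable_fun setT (fun z : R * R => (z.2, z.1)))); meas.
have mG : measurable_fun setT (fun z : R * R => (`|g z.1| * `|g z.2| * K z.1 z.2)%:E).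
  apply/measurable_EFinP; apply: (@measurable_funM _ _ _ _ (fun z : R * R => `|g z.1| * `|g z.2|) (fun z => K z.1 z.2)) => //.
  by meas.
have mFx x : measurable_fun setT (fun y => (F x y)%:E).
  by apply: (measurableT_comp mF (_ : measurable_fun setT (fun y : R => (x, y)))); meas.
have mFy y : measurable_fun setT (fun x => (F x y)%:E).
  by apply: (measurableT_comp mF (_ : measurable_fun setT (fun x : R => (x, y)))); meas.
have mGx x : measurable_fun setT (fun y => (`|g x| * `|g y| * K x y)%:E).
  by apply: (measurableT_comp mG (_ : measurable_fun setT (fun y : R => (x, y)))); meas.
pose t1 := @measurable_tonelli1 _ _ (measurableTypeR R) (measurableTypeR R) R mA.
have mIF : measurable_fun setT (fun x => \int[mA]_y (F x y)%:E)%E.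
  by apply: (t1 (fun x y => (F x y)%:E)) => [x y|//]; rewrite lee_fin.
have mIF' : measurable_fun setT (fun x => \int[mA]_y (F y x)%:E)%E.
  by apply: (t1 (fun x y => (F y x)%:E)) => [x y|//]; rewrite lee_fin.
apply: (@le_trans _ _ (\int[mA]_x (2^-1%:E * (\int[mA]_y (F x y)%:E + \int[mA]_y (F y x)%:E)))%E).
  apply: le_integral_hankel.
  - by move=> x; apply: integral_ge0 => y _; rewrite lee_fin !mulr_ge0.
  - by move=> x; rewrite mule_ge0 ?lee_fin// adde_ge0//; apply: integral_ge0 => y _; rewrite lee_fin.
  - by apply: (t1 (fun x y => (`|g x| * `|g y| * K x y)%:E)) => // x y; rewrite lee_fin !mulr_ge0.
  - by apply: emeasurable_funM => //; apply: emeasurable_funD.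
  move=> x x0; rewrite -(@ge0_integralD _ (measurableTypeR R) R mA setT measurableT (fun y => (F x y)%:E) (fun y => (F y x)%:E)); last 4 first.
  - by move=> y _; rewrite lee_fin.
  - exact: mFx.
  - by move=> y _; rewrite lee_fin.
  - exact: mFy.
  rewrite -ge0_integralZl_hankel//; last 2 first.
  - by move=> y; rewrite -EFinD lee_fin addr_ge0.
  - by apply: emeasurable_funD.
  apply: le_integral_hankel.
  - by move=> y; rewrite lee_fin !mulr_ge0.
  - by move=> y; rewrite -EFinD -EFinM lee_fin mulr_ge0// addr_ge0.
  - by [].
  - by apply: emeasurable_funM => //; apply: emeasurable_funD.
  move=> y y0; rewrite -EFinD -EFinM lee_fin /F (KC y x) (powR_inv1 (hge x)) (powR_inv1 (hge y)).
  rewrite -mulrDl [2^-1 * (_ * _)]mulrA ler_wpM2r//.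
  have hx := h0 x x0; have hy := h0 y y0.
  move: (h x) (h y) hx hy => p q p0 q0.
  rewrite -[g x ^+ 2](real_normK (num_real _)) -[g y ^+ 2](real_normK (num_real _)).
  move: (`|g x|) (`|g y|) => u v.
  rewrite -subr_ge0.
  have -> : 2^-1 * (u ^+ 2 * p / q + v ^+ 2 * q / p) - u * v = (u * p - v * q) ^+ 2 / (2 * p * q).
    by field; rewrite !gt_eqF.
  by rewrite divr_ge0 ?sqr_ge0// !mulr_ge0// ltW.
rewrite ge0_integralZl_hankel//; last 2 first.
- by move=> x; rewrite adde_ge0//; apply: integral_ge0 => y _; rewrite lee_fin.
- by apply: emeasurable_funD.
rewrite (@ge0_integralD _ (measurableTypeR R) R mA setT measurableT); last 4 first.
- by move=> x _; apply: integral_ge0 => y _; rewrite lee_fin.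
- by [].
- by move=> x _; apply: integral_ge0 => y _; rewrite lee_fin.
- by [].
rewrite (@tonelli _ _ (measurableTypeR R) (measurableTypeR R) R mA mA (fun x y => (F y x)%:E))//; last by move=> x y; rewrite lee_fin.
set I := (\int[mA]_x \int[mA]_y (F x y)%:E)%E.
have I0 : (0 <= I)%E by apply: integral_ge0 => x _; apply: integral_ge0 => y _; rewrite lee_fin.
case: (I) I0 => [i| |]//= _.
- by rewrite -EFinD -EFinM lee_fin; lra.
- by rewrite leey.
Qed.

Let gam := alpha + 1 + beta.
Let del := alpha + 1 - beta.
Let gam0 : 0 < gam. Proof. by rewrite /gam; move: a1 b0; lra. Qed.
Let del0 : 0 < del. Proof. by rewrite /del; move: ba; lra. Qed.
Let gam20 : 0 < gam / 2. Proof. by rewrite divr_gt0. Qed.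
Let del20 : 0 < del / 2. Proof. by rewrite divr_gt0. Qed.

(* Integrand in r of y^(-gam) averaged against the heat kernel, y^(-gam) being written as a superposition
   of the gaussians exp(-r y^2). *)
Definition subordination (s x r : R) : R := r `^ (gam / 2 - 1) * posind r *
  ((1 + 4 * r * s) `^ (- (alpha + 1)) * expR (- (r * x ^+ 2 * (1 + 4 * r * s) `^ (-1)))).

Lemma subordination_ge0 s x r : 0 <= subordination s x r.
Proof. by rewrite /subordination mulr_ge0// ?mulr_ge0 ?posind_ge0 ?powR_ge0 ?expR_ge0. Qed.

Lemma measurable_subordination : measurable_fun setT (fun z : R * R * R => subordination z.1.1 z.1.2 z.2).
Proof. by have mP := @measurable_posind R; rewrite /subordination; meas. Qed.

Lemma powR_sqr (y p : R) : 0 <= y -> (y ^+ 2) `^ p = y `^ (2 * p).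
Proof. by move=> y0; rewrite powRrM (powR_mulrn 2 y0). Qed.

(** The power [y^(-gam)] is [1 / Gamma (gam / 2)] times the integral of [r^(gam/2 - 1) exp(-r y^2)].
    After Tonelli the heat kernel acts on each gaussian explicitly. *)
Lemma integral_heat_kernel_power (s x : R) : 0 < s ->
  (\int[mA]_y (y `^ (- gam) * k s x y)%:E =
   (Gamma (gam / 2))^-1%:E * \int[leb]_r (subordination s x r)%:E)%E.
Proof.
move=> s0; have mP := @measurable_posind R.
have G0 : 0 < (Gamma (gam / 2))^-1 by rewrite invr_gt0 Gamma_gt0.
have mk2 := measurable_heat_kernel2 alpha s x.
have k0 := @heat_kernel_ge0 R alpha s x.
have mS : measurable_fun setT (fun r => subordination s x r).
  by rewrite /subordination; meas.
pose F y r : R := (Gamma (gam / 2))^-1 * (r `^ (gam / 2 - 1) * posind r) * (expR (- (r * y ^+ 2)) * k s x y).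
have F0 y r : 0 <= F y r.
  by rewrite /F mulr_ge0//; [rewrite mulr_ge0 ?mulr_ge0 ?posind_ge0 ?powR_ge0// ltW|rewrite mulr_ge0 ?expR_ge0].
have mF : measurable_fun setT (fun z : R * R => (F z.1 z.2)%:E) by rewrite /F; meas.
transitivity (\int[mA]_y \int[leb]_r (F y r)%:E)%E.
  apply: eq_integral_hankel.
  - by move=> y; rewrite lee_fin mulr_ge0 ?powR_ge0.
  - by move=> y; apply: integral_ge0 => r _; rewrite lee_fin.
  - by meas.
  - by apply: (@measurable_tonelli1 _ _ (measurableTypeR R) (measurableTypeR R) R leb (fun y r => (F y r)%:E)) => [y r|//]; rewrite lee_fin.
  move=> y y0.
  transitivity (((Gamma (gam / 2))^-1 * k s x y)%:E *
     \int[leb]_r (r `^ (gam / 2 - 1) * expR (- (y ^+ 2 * r)) * posind r)%:E)%E.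
    rewrite Gamma_scaled ?exprn_gt0// -EFinM powR_sqr ?ltW//; congr EFin.
    rewrite (_ : 2 * - (gam / 2) = - gam); last by field.
    have := Gamma_gt0 gam20; move: (Gamma _) (_ `^ _) (k _ _ _) => u v w u0.
    by field; rewrite gt_eqF.
  rewrite -ge0_integralZEFin.
  - by apply: eq_integral => r _; rewrite -EFinM /F [y ^+ 2 * r]mulrC; congr EFin; ring.
  - by move=> r; rewrite lee_fin mulr_ge0 ?posind_ge0// mulr_ge0 ?powR_ge0 ?expR_ge0.
  - by clear mk2; meas.
  - by rewrite mulr_ge0// ltW.
rewrite (@tonelli _ _ (measurableTypeR R) (measurableTypeR R) R mA leb (fun y r => (F y r)%:E)); last 2 first.
- by move=> y r; rewrite lee_fin.
- exact: mF.
rewrite -ge0_integralZEFin; last 3 first.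
- by move=> r; rewrite lee_fin subordination_ge0.
- by meas.
- exact: ltW.
apply: eq_integral => r _; have [r0|r0] := ltP 0 r; last first.
  rewrite /subordination posind_le0// mulr0 mul0r mule0.
  under eq_integral do rewrite /F posind_le0// mulr0 mulr0 mul0r.
  by rewrite integral0.
transitivity (((Gamma (gam / 2))^-1 * (r `^ (gam / 2 - 1) * posind r))%:E *
   \int[mA]_y (expR (- (r * y ^+ 2)) * k s x y)%:E)%E.
  rewrite -ge0_integralZl_hankel.
  - by apply: eq_integral => y _; rewrite -EFinM.
  - by move=> y; rewrite lee_fin mulr_ge0 ?expR_ge0.
  - by meas.
  - by rewrite mulr_ge0 ?mulr_ge0 ?powR_ge0 ?posind_ge0// ltW.
rewrite integral_heat_kernel_gauss// -!EFinM /subordination /gauss_heat.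
rewrite powR_inv1; last by rewrite addr_ge0// !mulr_ge0// ltW.
by congr EFin; rewrite !mulrA.
Qed.

(** With [d = 2 alpha + 2] this is the classical constant of Pitt's inequality in dimension [d],
    namely [2^(-beta) Gamma((d - 2 beta)/4) / Gamma((d + 2 beta)/4)]. *)
Definition pitt_const : R := 2 `^ (- beta) * (Gamma (del / 2) / Gamma (gam / 2)).

(** In the variable [q = 4 r s] the two integrations separate: a Gamma integral in [r] and then a
    Beta integral in [q]. Each produces one [Gamma (del / 2)], and [4^(-beta)] is the square of
    [2^(-beta)], so the constant appears squared. *)
Lemma integral_subordination (x : R) : 0 < x ->
  (\int[leb]_s ((s `^ (beta - 1) * posind s)%:E * \int[leb]_r (subordination s x r)%:E) =
   (Gamma (gam / 2) * Gamma beta * pitt_const ^+ 2 * x `^ (- del))%:E)%E.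
Proof.
move=> x0; have mP := @measurable_posind R.
have Gg := Gamma_gt0 gam20; have Gd := Gamma_gt0 del20; have Gb := Gamma_gt0 b0.
have mS : measurable_fun setT (fun z : R * R => subordination z.1 x z.2).
  by rewrite /subordination; meas.
have mS1 s : measurable_fun setT (fun r => subordination s x r).
  by rewrite /subordination; meas.
pose F s r : R := s `^ (beta - 1) * posind s * subordination s x r.
have c0 s : 0 <= s `^ (beta - 1) * posind s by rewrite mulr_ge0 ?powR_ge0 ?posind_ge0.
have F0 s r : 0 <= F s r by rewrite /F mulr_ge0 ?subordination_ge0.
have mF : measurable_fun setT (fun z : R * R => (F z.1 z.2)%:E).
  by rewrite /F /subordination; meas.
pose H r q : R := 4 `^ (- beta) * (q `^ (beta - 1) * posind q * (1 + q) `^ (- (alpha + 1))) *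
   (r `^ (del / 2 - 1) * expR (- (x ^+ 2 * (1 + q) `^ (-1) * r)) * posind r).
have H0 r q : 0 <= H r q.
  rewrite /H mulr_ge0//; first by rewrite mulr_ge0 ?powR_ge0// mulr_ge0 ?powR_ge0.
  by rewrite mulr_ge0 ?posind_ge0// mulr_ge0 ?powR_ge0 ?expR_ge0.
have mH : measurable_fun setT (fun z : R * R => (H z.1 z.2)%:E) by rewrite /H; meas.
transitivity (\int[leb]_s \int[leb]_r (F s r)%:E)%E.
  apply: eq_integral => s _; rewrite -ge0_integralZEFin//.
  - by move=> r; rewrite lee_fin subordination_ge0.
  - by have mS1' := mS1 s; meas.
rewrite (@tonelli _ _ (measurableTypeR R) (measurableTypeR R) R leb leb (fun s r => (F s r)%:E)); last 2 first.
- by move=> y r; rewrite lee_fin.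
- exact: mF.
transitivity (\int[leb]_r \int[leb]_q (H r q)%:E)%E.
  apply: eq_integral => r _; have [r0|r0] := ltP 0 r; last first.
    under eq_integral do rewrite /F /subordination [posind r]posind_le0// !(mulr0, mul0r).
    under [RHS]eq_integral do rewrite /H [posind r]posind_le0// !(mulr0, mul0r).
    by rewrite integral0.
  have r40 : 0 < 4 * r by rewrite mulr_gt0.
  (* At fixed [r] the variable [s] becomes [q / (4 r)], so that [1 + 4 r s] turns into [1 + q]. The
     Jacobian and [s^(beta - 1)] give [4^(-beta) r^(-beta)], which lowers the power of [r] from
     [gam/2 - 1] to [del/2 - 1]. *)
  rewrite [LHS](@ge0_integral_affine _ (4 * r)^-1 0) ?gt_eqF ?invr_gt0//; last 2 first.
  - by move=> s; rewrite lee_fin.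
  - by rewrite /F /subordination; meas.
  apply: eq_integral => q _; rewrite addr0 -EFinM; congr EFin.
  have [q0|q0] := ltP 0 q; last first.
    by rewrite /F /H !(@posind_le0 _ q)// (@posind_le0 _ (_ * q)) ?pmulr_rle0 ?invr_gt0// !(mulr0, mul0r).
  rewrite /F /H /subordination !posind_gt0 ?mulr_gt0 ?invr_gt0//.
  have i0 : 0 < (4 * r)^-1 by rewrite invr_gt0.
  rewrite mulVKf ?gt_eqF// gtr0_norm//.
  rewrite (powRM _ (ltW i0) (ltW q0)) -{1}(powR_inv1 (ltW r40)) -powRrM.
  have -> : (4 * r) `^ (-1 * (beta - 1)) = (4 * r) * (4 `^ (- beta) * r `^ (- beta)).
    rewrite -powRM ?ltW// (_ : -1 * (beta - 1) = 1 - beta); last by ring.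
    rewrite powRB; last by apply/implyP => _; rewrite gt_eqF.
    by rewrite powRr1 ?ltW// powRN.
  have q1 : 0 < 1 + q by rewrite addr_gt0.
  rewrite !(powR_inv1 (ltW q1)).
  have -> : r `^ (del / 2 - 1) = r `^ (- beta) * r `^ (gam / 2 - 1).
    rewrite -powRD; last by apply/implyP => _; rewrite gt_eqF.
    by congr (_ `^ _); rewrite /gam /del; field.
  rewrite (_ : x ^+ 2 / (1 + q) * r = r * x ^+ 2 / (1 + q)); last by ring.
  move: (expR _) (r `^ _) (r `^ _) (q `^ _) (4 `^ _) ((1 + q) `^ _) => e A B C D E.
  by field; rewrite !gt_eqF// addr_gt0.
rewrite (@tonelli _ _ (measurableTypeR R) (measurableTypeR R) R leb leb (fun r q => (H r q)%:E)); last 2 first.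
- by move=> y r; rewrite lee_fin.
- exact: mH.
pose c := 4 `^ (- beta) * (Gamma (del / 2) * x `^ (- del)).
have c00 : 0 <= c.
  by apply: mulr_ge0; [exact: powR_ge0|apply: mulr_ge0; [exact: ltW|exact: powR_ge0]].
transitivity (\int[leb]_q (c%:E * (q `^ (beta - 1) * (1 + q) `^ (- (gam / 2)) * posind q)%:E))%E.
  apply: eq_integral => q _; have [q0|q0] := ltP 0 q; last first.
    rewrite posind_le0// mulr0 mule0.
    under eq_integral do rewrite /H [posind q]posind_le0// !(mulr0, mul0r).
    by rewrite integral0.
  have q1 : 0 < 1 + q by rewrite addr_gt0.
  transitivity ((4 `^ (- beta) * (q `^ (beta - 1) * posind q * (1 + q) `^ (- (alpha + 1))))%:E *
      \int[leb]_r (r `^ (del / 2 - 1) * expR (- (x ^+ 2 * (1 + q) `^ (-1) * r)) * posind r)%:E)%E.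
    rewrite -ge0_integralZEFin.
    - by apply: eq_integral => r _; rewrite -EFinM.
    - by move=> r; rewrite lee_fin mulr_ge0 ?posind_ge0// mulr_ge0 ?powR_ge0 ?expR_ge0.
    - by meas.
    - by rewrite mulr_ge0 ?powR_ge0// mulr_ge0 ?powR_ge0// mulr_ge0 ?powR_ge0 ?posind_ge0.
  rewrite Gamma_scaled//; last by rewrite mulr_gt0 ?exprn_gt0 ?powR_gt0.
  rewrite -!EFinM; congr EFin.
  rewrite powRM ?sqr_ge0 ?powR_ge0// powR_sqr ?ltW// -powRrM posind_gt0//.
  rewrite (_ : 2 * - (del / 2) = - del); last by field.
  (* The scale [x^2 / (1 + q)] of the Gamma integral contributes [(1 + q)^(del/2)]; the exponent
     left is [- (alpha + 1) + del/2 = - gam/2]. *)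
  have -> : (1 + q) `^ (- (gam / 2)) = (1 + q) `^ (- (alpha + 1)) * (1 + q) `^ (-1 * - (del / 2)).
    rewrite -powRD; last by apply/implyP => _; rewrite gt_eqF.
    by congr (_ `^ _); rewrite /gam /del; field.
  by rewrite /c; ring.
rewrite ge0_integralZEFin//; last 2 first.
- by move=> q; rewrite lee_fin mulr_ge0 ?posind_ge0// mulr_ge0 ?powR_ge0.
- by meas.
(* The Beta integral converges at infinity exactly when [beta < gam / 2], that is
   [beta < alpha + 1]. *)
have bg : beta < gam / 2 by rewrite /gam; move: ba; lra.
rewrite (Beta_second_kind b0 bg) -EFinM; congr EFin.
have -> : gam / 2 - beta = del / 2 by rewrite /gam /del; field.
rewrite /c /pitt_const.
have -> : 4 `^ (- beta) = (2 `^ (- beta)) ^+ 2 :> R.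
  by rewrite (_ : 4 = 2 * 2 :> R); [rewrite powRM// expr2|ring].
move: Gg Gd Gb; move: (Gamma (gam / 2)) (Gamma (del / 2)) (Gamma beta) (2 `^ _) (x `^ _) => u v w p q u0 v0 w0.
by field; rewrite gt_eqF.
Qed.

(** The weight [xi^(-2 beta)] is averaged from [exp(-s xi^2)] with weight [s^(beta - 1)]. For each
    [s] the Schur test replaces the double integral by one of [g^2] against an explicit function;
    integrating that in [s] for fixed [x] gives the constant. *)
Lemma Pitt_inequality (g : R -> R) : mA.-integrable setT (EFin \o g) ->
  (\int[mA]_xi (xi `^ (- (2 * beta)) * rhankel alpha g xi ^+ 2)%:E <=
   (pitt_const ^+ 2)%:E * \int[mA]_x (x `^ (2 * beta) * g x ^+ 2)%:E)%E.
Proof.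
move=> ig; have mP := @measurable_posind R.
have mg : measurable_fun setT g by apply/measurable_EFinP; exact: measurable_int ig.
have mH : measurable_fun setT (rhankel alpha g) by exact: measurable_rhankel.
have mq : measurable_fun setT (fun xi => rhankel alpha g xi ^+ 2) by meas.
have Gg := Gamma_gt0 gam20; have Gd := Gamma_gt0 del20; have Gb := Gamma_gt0 b0.
have Gbi : 0 <= (Gamma beta)^-1 by rewrite invr_ge0 ltW.
have Ggi : 0 <= (Gamma (gam / 2))^-1 by apply: ltW; rewrite invr_gt0.
have c0 s : 0 <= s `^ (beta - 1) * posind s by rewrite mulr_ge0 ?powR_ge0 ?posind_ge0.
move: (mq); set q := (fun xi => rhankel alpha g xi ^+ 2) => {}mq.
have q0 xi : 0 <= q xi by rewrite /q sqr_ge0.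
pose F xi s : R := (s `^ (beta - 1) * posind s) * (expR (- (s * xi ^+ 2)) * q xi).
have F0 xi s : 0 <= F xi s by rewrite /F mulr_ge0// mulr_ge0 ?expR_ge0.
have mF : measurable_fun setT (fun z : R * R => (F z.1 z.2)%:E) by rewrite /F; clear mH mg; meas.
pose I s : \bar R := (\int[mA]_xi (expR (- (s * xi ^+ 2)) * q xi)%:E)%E.
have E1 : (\int[mA]_xi (xi `^ (- (2 * beta)) * q xi)%:E =
    (Gamma beta)^-1%:E * \int[leb]_s ((s `^ (beta - 1) * posind s)%:E * I s))%E.
  transitivity (\int[mA]_xi ((Gamma beta)^-1%:E * \int[leb]_s (F xi s)%:E))%E.
    apply: eq_integral_hankel.
    - by move=> xi; rewrite lee_fin mulr_ge0 ?powR_ge0.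
    - by move=> xi; rewrite mule_ge0 ?lee_fin//; apply: integral_ge0 => s _; rewrite lee_fin.
    - by clear mH mg mF; meas.
    - apply: emeasurable_funM; first exact: measurable_cst.
      by apply: (@measurable_tonelli1 _ _ (measurableTypeR R) (measurableTypeR R) R leb (fun xi s => (F xi s)%:E)) => [y r|//]; rewrite lee_fin.
    move=> xi xi0.
    transitivity ((Gamma beta)^-1%:E * ((q xi)%:E * \int[leb]_s (s `^ (beta - 1) * expR (- (xi ^+ 2 * s)) * posind s)%:E))%E.
      rewrite Gamma_scaled ?exprn_gt0// -!EFinM powR_sqr ?ltW// mulrN; congr EFin.
      move: Gb; move: (Gamma _) (_ `^ _) (q _) => u v w u0.
      by field; rewrite gt_eqF.
    congr (_ * _)%E; rewrite -ge0_integralZEFin//.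
    - by apply: eq_integral => s _; rewrite -EFinM /F [xi ^+ 2 * s]mulrC; congr EFin; ring.
    - by move=> s; rewrite lee_fin mulr_ge0 ?posind_ge0// mulr_ge0 ?powR_ge0 ?expR_ge0.
    - by clear mH mg mF mq; meas.
  rewrite ge0_integralZl_hankel//; last 2 first.
  - by move=> xi; apply: integral_ge0 => s _; rewrite lee_fin.
  - by apply: (@measurable_tonelli1 _ _ (measurableTypeR R) (measurableTypeR R) R leb (fun xi s => (F xi s)%:E)) => [y r|//]; rewrite lee_fin.
  congr (_ * _)%E.
  rewrite (@tonelli _ _ (measurableTypeR R) (measurableTypeR R) R mA leb (fun xi s => (F xi s)%:E)); last 2 first.
  - by move=> y r; rewrite lee_fin.
  - exact: mF.
  apply: eq_integral => s _; rewrite -ge0_integralZl_hankel//.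
  - by move=> xi; rewrite lee_fin mulr_ge0 ?expR_ge0.
  - by clear mH mg mF; meas.
rewrite E1.
pose Q s x : \bar R := ((Gamma (gam / 2))^-1%:E * \int[leb]_r (subordination s x r)%:E)%E.
have Q0 s x : (0 <= Q s x)%E.
  apply: mule_ge0; first by rewrite lee_fin; exact: Ggi.
  apply: integral_ge0 => r _; by rewrite lee_fin subordination_ge0.
have mQ : measurable_fun setT (fun z : R * R => Q z.1 z.2).
  apply: emeasurable_funM; first exact: measurable_cst.
  apply: (@measurable_tonelli1 _ _ _ (measurableTypeR R) R leb (fun z r => (subordination z.1 z.2 r)%:E)).
    by move=> z r; rewrite lee_fin subordination_ge0.
  by apply/measurable_EFinP; exact: measurable_subordination.
have mQ2 s : measurable_fun setT (Q s).
  by apply: (measurableT_comp mQ (_ : measurable_fun setT (fun x : R => (s, x)))); meas.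
have mQ1 x : measurable_fun setT (fun s => Q s x).
  by apply: (measurableT_comp mQ (_ : measurable_fun setT (fun s : R => (s, x)))); meas.
(* The Schur weight: its inverse is the power whose heat average is known, and after integration in
   [s] the product of [h x] with [x^(-del)] is [x^(2 beta)]. *)
pose h (x : R) := x `^ gam.
pose w x : R := g x ^+ 2 * h x.
have w0 x : 0 <= w x by rewrite /w mulr_ge0 ?sqr_ge0 ?powR_ge0.
have mw : measurable_fun setT w by clear mH mq mF mQ mQ2 mQ1; rewrite /w /h; meas.
have I_le s : 0 < s -> (I s <= \int[mA]_x ((w x)%:E * Q s x))%E.
  move=> s0; apply: le_trans (heat_quadratic_le s0 ig) _.
  have mk := measurable_heat_kernel alpha s.
  have mh : measurable_fun setT h by exact: measurable_powR.
  apply: le_trans (@Schur_test g h (k s) mg mh mk _ _ _ _) _.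
  - exact: heat_kernel_ge0.
  - exact: heat_kernelC.
  - by move=> x x0; exact: powR_gt0.
  - by move=> x; exact: powR_ge0.
  rewrite le_eqVlt; apply/orP; left; apply/eqP; apply: eq_integral => x _.
  rewrite /Q -integral_heat_kernel_power//.
  have mkx := measurable_heat_kernel2 alpha s x.
  have mkp : measurable_fun setT (fun y => (y `^ (- gam) * k s x y)%:E).
    by apply/measurable_EFinP; apply: measurable_funM => //; exact: measurable_powR.
  rewrite -ge0_integralZl_hankel; last 3 first.
  - by move=> y; rewrite lee_fin mulr_ge0 ?powR_ge0 ?heat_kernel_ge0.
  - exact: mkp.
  - exact: w0.
  by apply: eq_integral => y _; rewrite -EFinM /w /h -powRrM mulrN1 mulrA.
apply: (@le_trans _ _ ((Gamma beta)^-1%:E *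
    \int[leb]_s ((s `^ (beta - 1) * posind s)%:E * \int[mA]_x ((w x)%:E * Q s x)))%E).
  apply: lee_wpmul2l; first by rewrite lee_fin.
  have mwQ : measurable_fun setT (fun z : R * R => (w z.2)%:E * Q z.1 z.2)%E.
    apply: emeasurable_funM => //; apply/measurable_EFinP.
    exact: (measurableT_comp mw measurable_snd).
  apply: ge0_le_integral => //.
  - by move=> s _; apply: mule_ge0; [rewrite lee_fin|apply: integral_ge0 => x _; rewrite lee_fin mulr_ge0 ?expR_ge0].
  - apply: emeasurable_funM; first by clear mH mq mF mQ mQ2 mQ1 mw; meas.
    apply: (@measurable_tonelli1 _ _ (measurableTypeR R) (measurableTypeR R) R mA (fun s xi => (expR (- (s * xi ^+ 2)) * q xi)%:E)).
      by move=> s xi; rewrite lee_fin mulr_ge0 ?expR_ge0.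
    by clear mH mg mF mQ mQ2 mQ1 mw; meas.
  - apply: emeasurable_funM; first by clear mH mq mF mQ mQ2 mQ1 mw mwQ; meas.
    apply: (@measurable_tonelli1 _ _ (measurableTypeR R) (measurableTypeR R) R mA (fun s x => (w x)%:E * Q s x)%E) => //.
    by move=> s x; rewrite mule_ge0 ?lee_fin.
  - move=> s _; have [s0|s0] := ltP 0 s; last by rewrite posind_le0// mulr0 !mul0e.
    by apply: lee_wpmul2l; [rewrite lee_fin|exact: I_le].
pose T s x : \bar R := ((s `^ (beta - 1) * posind s)%:E * ((w x)%:E * Q s x))%E.
have T0 s x : (0 <= T s x)%E by rewrite /T mule_ge0 ?lee_fin// mule_ge0 ?lee_fin.
have mT : measurable_fun setT (fun z : R * R => T z.1 z.2).
  apply: emeasurable_funM; first by clear mH mq mF mQ mQ2 mQ1 mw; meas.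
  apply: emeasurable_funM => //; apply/measurable_EFinP.
  exact: (measurableT_comp mw measurable_snd).
rewrite (_ : (\int[leb]_s _)%E = (\int[leb]_s \int[mA]_x T s x)%E); last first.
  apply: eq_integral => s _; rewrite -ge0_integralZl_hankel; last exact: c0.
  - by [].
  - by move=> x; rewrite mule_ge0 ?lee_fin.
  - by apply: emeasurable_funM; [exact/measurable_EFinP|exact: mQ2].
rewrite (@tonelli _ _ (measurableTypeR R) (measurableTypeR R) R leb mA T T0 mT).
pose cc := Gamma beta * pitt_const ^+ 2.
have cc0 : 0 <= cc by apply: mulr_ge0; [exact: ltW|exact: sqr_ge0].
have mx : measurable_fun setT (fun x => (x `^ (2 * beta) * g x ^+ 2)%:E).
  by clear mH mq mF mQ mQ2 mQ1 mw mT; meas.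
have -> : (\int[mA]_x \int[leb]_s T s x = \int[mA]_x (cc%:E * (x `^ (2 * beta) * g x ^+ 2)%:E))%E.
  apply: eq_integral_hankel.
  - by move=> x; apply: integral_ge0.
  - by move=> x; rewrite -EFinM lee_fin mulr_ge0// mulr_ge0 ?powR_ge0 ?sqr_ge0.
  - apply: (@measurable_tonelli1 _ _ (measurableTypeR R) (measurableTypeR R) R leb (fun x s => T s x)).
      by move=> x s; exact: T0.
    by apply: (measurableT_comp mT (_ : measurable_fun setT (fun z : R * R => (z.2, z.1)))); meas.
  - by apply: emeasurable_funM.
  move=> x x0.
  transitivity ((w x)%:E * ((Gamma (gam / 2))^-1%:E * \int[leb]_s ((s `^ (beta - 1) * posind s)%:E * \int[leb]_r (subordination s x r)%:E)))%E.
    have m1 : measurable_fun setT (fun s => \int[leb]_r (subordination s x r)%:E)%E.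
      apply: (@measurable_tonelli1 _ _ (measurableTypeR R) (measurableTypeR R) R leb (fun s r => (subordination s x r)%:E)).
        by move=> s r; rewrite lee_fin subordination_ge0.
      by clear mH mq mF mQ mQ2 mQ1 mw mT mx mg; rewrite /subordination; meas.
    have i0 s : (0 <= \int[leb]_r (subordination s x r)%:E)%E.
      by apply: integral_ge0 => r _; rewrite lee_fin subordination_ge0.
    have m2 : measurable_fun setT (fun s => (s `^ (beta - 1) * posind s)%:E * \int[leb]_r (subordination s x r)%:E)%E.
      by apply: emeasurable_funM => //; clear mH mq mF mQ mQ2 mQ1 mw mT mx mg m1; meas.
    rewrite -ge0_integralZEFin; last 3 first.
    - by move=> s; rewrite mule_ge0 ?lee_fin.
    - exact: m2.
    - exact: Ggi.
    rewrite -ge0_integralZEFin; last 3 first.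
    - move=> s; apply: mule_ge0; last by rewrite mule_ge0 ?lee_fin.
      by rewrite lee_fin; exact: Ggi.
    - by apply: emeasurable_funM.
    - exact: w0.
    apply: eq_integral => s _; rewrite /T /Q.
    by rewrite muleCA; congr (_ * _)%E; rewrite muleCA.
  rewrite integral_subordination// -!EFinM; congr EFin.
  rewrite /w /h /cc (_ : 2 * beta = gam - del); last by rewrite /gam /del; ring.
  rewrite powRD; last by apply/implyP => _; rewrite gt_eqF.
  move: Gg; move: (Gamma (gam / 2)) (Gamma beta) (x `^ gam) (x `^ (- del)) (pitt_const) => u v A B C u0.
  by field; rewrite gt_eqF.
rewrite ge0_integralZl_hankel//; last first.
  by move=> x; rewrite lee_fin mulr_ge0 ?powR_ge0 ?sqr_ge0.
rewrite muleA -EFinM /cc mulrA mulVf ?gt_eqF// mul1r.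
exact: lexx.
Qed.

End Pitt.

(** * Wavelet transform *)

Section translation_convolution.
Context (R : realType) (alpha : R).
Hypothesis ha : - 2^-1 < alpha.
Local Notation leb := (@lebesgue_measure R).
Local Notation mA := (hankel_measure alpha).
Local Notation mS := (sine_measure alpha).
Local Notation J := (bessel alpha).

Let a1 : 0 < alpha + 1. Proof. by move: ha; lra. Qed.

(** The Hankel convolution of [u] and [v]; the wavelet transform at a fixed scale is made of four of
    these. *)
Definition wconv (u v : R -> R) (x : R) := Rintegral mA setT (fun t => u t * translate alpha x v t).

(** Integrating in [x] first, translation does not increase the [L^1] norm, so the product of the
    two norms is a bound. *)
Lemma integrable_wconv (u v : R -> R) :
  mA.-integrable setT (EFin \o u) -> mA.-integrable setT (EFin \o v) ->
  (mA \x mA)%E.-integrable setT (fun z => (u z.2 * translate alpha z.1 v z.2)%:E).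
Proof.
move=> iu iv.
have mu : measurable_fun setT u by apply/measurable_EFinP; exact: measurable_int iu.
have mv : measurable_fun setT v by apply/measurable_EFinP; exact: measurable_int iv.
have mT := measurable_translate alpha mv.
have mF : measurable_fun setT (fun z : R * R => u z.2 * translate alpha z.1 v z.2).
  apply: (@measurable_funM _ _ _ _ (fun z : R * R => u z.2) (fun z => translate alpha z.1 v z.2)) => //.
  exact: (measurableT_comp mu measurable_snd).
have mFa : measurable_fun setT (fun z : R * R => `|u z.2 * translate alpha z.1 v z.2|%:E).
  by apply/measurable_EFinP; apply: (measurableT_comp (@normr_measurable _ _)).
apply/integrable12ltyP; first exact/measurable_EFinP.
have E := @tonelli _ _ (measurableTypeR R) (measurableTypeR R) R mA mA (fun x t => `|u t * translate alpha x v t|%:E) (fun _ _ => normr_ge0 _) mFa.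
rewrite [X in (X < _)%E](_ : _ = \int[mA]_t \int[mA]_x `|u t * translate alpha x v t|%:E)%E; last exact: E.
apply: (@le_lt_trans _ _ (\int[mA]_t (`|u t|%:E * \int[mA]_x `|v x|%:E))%E).
  apply: (@ge0_le_integral _ (measurableTypeR R) R mA setT measurableT).
  - by move=> t _; apply: integral_ge0 => x _; rewrite lee_fin.
  - apply: (@measurable_tonelli1 _ _ (measurableTypeR R) (measurableTypeR R) R mA (fun t x => `|u t * translate alpha x v t|%:E)).
      by move=> t x; rewrite lee_fin.
    by apply: (measurableT_comp mFa (_ : measurable_fun setT (fun z : R * R => (z.2, z.1)))); meas.
  - apply: emeasurable_funM; last exact: measurable_cst.
    by apply/measurable_EFinP; exact: (measurableT_comp (@normr_measurable _ _) mu).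
  move=> t _; apply: (@le_trans _ _ (`|u t|%:E * \int[mA]_x `|translate alpha x v t|%:E)%E); last first.
    by apply: lee_wpmul2l; [rewrite lee_fin|exact: (@integral_abs_translate _ _ ha v t mv)].
  rewrite -ge0_integralZl_hankel; last 3 first.
  - by move=> x; rewrite lee_fin.
  - apply/measurable_EFinP; apply: (measurableT_comp (@normr_measurable _ _)).
    by apply: (measurableT_comp mT (_ : measurable_fun setT (fun x : R => (x, t)))); meas.
  - by [].
  rewrite le_eqVlt; apply/orP; left; apply/eqP; apply: eq_integral => x _.
  by rewrite -EFinM normrM.
have /integrableP[_ fu] := iu; have /integrableP[_ fv] := iv.
rewrite (@ge0_integralZr _ (measurableTypeR R) R mA setT measurableT (fun t => `|u t|%:E)); last 3 first.
- by apply/measurable_EFinP; exact: (measurableT_comp (@normr_measurable _ _) mu).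
- by move=> t _; rewrite lee_fin.
- by apply: integral_ge0 => x _; rewrite lee_fin.
apply: lte_mul_pinfty; last exact: fv.
- by apply: integral_ge0 => x _; rewrite lee_fin.
- rewrite ge0_fin_numE; first exact: fu.
  by apply: integral_ge0 => x _; rewrite lee_fin.
Qed.

Lemma integrable_wconv1 (u v : R -> R) :
  mA.-integrable setT (EFin \o u) -> mA.-integrable setT (EFin \o v) ->
  mA.-integrable setT (EFin \o wconv u v).
Proof.
move=> iu iv.
exact: (@integrable_Rintegral1 _ _ (measurableTypeR R) (measurableTypeR R) R mA mA _ (integrable_wconv iu iv)).
Qed.

(** After Fubini the inner integral is the transform of a translate, which [hankel_translate]
    factors. *)
Lemma rhankel_wconv (u v : R -> R) (xi : R) :
  mA.-integrable setT (EFin \o u) -> mA.-integrable setT (EFin \o v) ->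
  rhankel alpha (wconv u v) xi = rhankel alpha u xi * rhankel alpha v xi.
Proof.
move=> iu iv; have iF := integrable_wconv iu iv.
have mu : measurable_fun setT u by apply/measurable_EFinP; exact: measurable_int iu.
have mv : measurable_fun setT v by apply/measurable_EFinP; exact: measurable_int iv.
have mJ := measurable_bessel alpha.
have mJxi : measurable_fun setT (fun x : R => J (x * xi)) by meas.
have mJ1 : measurable_fun setT (fun z : R * R => J (z.1 * xi)) by meas.
have mT := measurable_translate alpha mv.
have mTx x : measurable_fun setT (translate alpha x v).
  by apply: (measurableT_comp mT (_ : measurable_fun setT (fun t : R => (x, t)))); meas.
have mTt t : measurable_fun setT (fun x => translate alpha x v t).
  by apply: (measurableT_comp mT (_ : measurable_fun setT (fun x : R => (x, t)))); meas.
have iG : (mA \x mA)%E.-integrable setT (fun z : R * R => (u z.2 * translate alpha z.1 v z.2 * J (z.1 * xi))%:E).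
  apply: le_integrable (iF) => //.
    have /measurable_EFinP mF := measurable_int _ iF.
    by apply/measurable_EFinP; apply: measurable_funM.
  by move=> z _; rewrite !abse_EFin lee_fin normrM ler_piMr// bessel_le1.
transitivity (Rintegral mA setT (fun x => Rintegral mA setT (fun t => u t * translate alpha x v t * J (x * xi)))).
  apply: eq_Rintegral => x _; rewrite /wconv -RintegralZr_line//.
  exact: (@measurable_funM _ _ _ _ u _ mu (mTx x)).
rewrite (@Rintegral_Fubini _ _ (measurableTypeR R) (measurableTypeR R) R mA mA (fun z => u z.2 * translate alpha z.1 v z.2 * J (z.1 * xi)) iG).
rewrite [LHS](_ : _ = Rintegral mA setT (fun t => u t * J (t * xi) * rhankel alpha v xi)); last first.
  apply: eq_Rintegral => t _ /=.
  transitivity (Rintegral mA setT (fun x => u t * (translate alpha x v t * J (x * xi)))).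
    by apply: eq_Rintegral => x _; exact: (esym (mulrA _ _ _)).
  rewrite RintegralZl_line; last exact: (@measurable_funM _ _ _ _ _ _ (mTt t) mJxi).
  by rewrite -mulrA; congr (_ * _); exact: (hankel_translate ha t xi mv iv).
by rewrite RintegralZr_line//; exact: (@measurable_funM _ _ _ _ u _ mu mJxi).
Qed.

(** Fubini gives integrability in [t] only for almost every [x]. Boundedness of [u] gives it for
    every [x], so the wavelet transform can be split into real integrals pointwise. *)
Lemma integrable_wconv_section (u v : R -> R) (M x : R) :
  measurable_fun setT u -> (forall t, `|u t| <= M) -> mA.-integrable setT (EFin \o v) ->
  mA.-integrable setT (fun t => (u t * translate alpha x v t)%:E).
Proof.
move=> mu uM iv; have M0 : 0 <= M by apply: le_trans (uM 0).
have mv : measurable_fun setT v by apply/measurable_EFinP; exact: measurable_int iv.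
have mT := measurable_translate alpha mv.
have mTx : measurable_fun setT (translate alpha x v).
  by apply: (measurableT_comp mT (_ : measurable_fun setT (fun t : R => (x, t)))); meas.
have iT : mA.-integrable setT (EFin \o translate alpha x v).
  apply/integrableP; split; first exact/measurable_EFinP.
  have /integrableP[_] := iv; apply: le_lt_trans.
  apply: le_trans (integral_abs_translate ha x mv).
  rewrite le_eqVlt; apply/orP; left; apply/eqP; apply: eq_integral => t _.
  by rewrite /= translateC.
have := @integrableZl _ _ _ mA setT measurableT M _ iT.
apply: le_integrable => //.
  by apply/measurable_EFinP; exact: (@measurable_funM _ _ _ _ u _ mu mTx).
move=> t _; rewrite /= lee_fin normrM [leRHS]normrM ler_wpM2r//.
by apply: le_trans (uM t) (ler_norm _).
Qed.

(** The measure is homogeneous of degree [2 alpha + 2]: the power of the density plus one for the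
    Jacobian. *)
Lemma ge0_integral_hankel_dil (a : R) (f : R -> \bar R) : 0 < a -> (forall x, (0 <= f x)%E) ->
  measurable_fun setT f ->
  (\int[mA]_x f x = (a `^ (2 * alpha + 2))%:E * \int[mA]_x f (a * x)%R)%E.
Proof.
move=> a0 f0 mf; have mw := measurable_hankel_weight alpha.
have w0 := @hankel_weight_ge0 R alpha.
have mfa : measurable_fun setT (fun x : R => f (a * x)) by clear mw; meas.
rewrite !ge0_integral_hankel//.
rewrite [LHS](@ge0_integral_affine _ a 0) ?gt_eqF//; last 2 first.
- by move=> x; rewrite mule_ge0 ?lee_fin.
- by apply: emeasurable_funM => //; apply/measurable_EFinP.
rewrite -ge0_integralZEFin ?powR_ge0//; last 2 first.
- by move=> x; rewrite mule_ge0 ?lee_fin.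
- by apply: emeasurable_funM => //; apply/measurable_EFinP.
apply: eq_integral => x _; rewrite addr0 -muleA [RHS]muleCA; congr (_ * _)%E.
rewrite -!EFinM gtr0_norm//; congr EFin.
have [x0|x0] := ltP 0 x; last first.
  by rewrite !hankel_weight_le0 ?pmulr_rle0// mul0r mulr0.
rewrite !hankel_weight_gt0 ?mulr_gt0// /mu_dens powRM ?ltW//.
rewrite (_ : 2 * alpha + 2 = 2 * alpha + 1 + 1); last by ring.
rewrite [in RHS]powRD; last by apply/implyP => _; rewrite gt_eqF.
by rewrite powRr1 ?ltW//; move: (_^-1) (x `^ _) (a `^ _) => u v w; ring.
Qed.

Lemma Rintegral_hankel_dil (a : R) (f : R -> R) : 0 < a -> measurable_fun setT f ->
  Rintegral mA setT f = a `^ (2 * alpha + 2) * Rintegral mA setT (fun x => f (a * x)).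
Proof.
move=> a0 mf.
have mfa : measurable_fun setT (fun x : R => f (a * x)) by meas.
have mEfa : measurable_fun setT (fun x => (f (a * x))%:E) by exact/measurable_EFinP.
have mEf : measurable_fun setT (EFin \o f) by exact/measurable_EFinP.
rewrite -RintegralZl_line// /Rintegral integralE [in RHS]integralE; congr (fine (_ - _)%E).
- rewrite (ge0_integral_hankel_dil a0)//; last by apply: measurable_funepos; exact/measurable_EFinP.
  rewrite -ge0_integralZl_hankel ?powR_ge0//.
  + apply: eq_integral => x _; rewrite !funeposE/= EFinM.
    by rewrite maxe_pMr ?mule0// lee_fin powR_ge0.
  + rewrite (_ : (fun x => _) = (fun x => maxe ((f (a * x))%:E) 0)%E); last first.
      by apply/funext => x; rewrite funeposE.
    by apply: measurable_maxe => //; exact: mEfa.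
- rewrite (ge0_integral_hankel_dil a0)//; last by apply: measurable_funeneg; exact/measurable_EFinP.
  rewrite -ge0_integralZl_hankel ?powR_ge0//.
  + apply: eq_integral => x _; rewrite !funenegE/= -mulrN EFinM.
    by rewrite maxe_pMr ?mule0// lee_fin powR_ge0.
  + rewrite (_ : (fun x => _) = (fun x => maxe (- (f (a * x))%:E) 0)%E); last first.
      by apply/funext => x; rewrite funenegE.
    by apply: measurable_maxe => //; apply: measurableT_comp => //; exact: mEfa.
Qed.

Definition rdil (a : R) (v : R -> R) (x : R) := a `^ (alpha + 1) * v (a * x).

Lemma integrable_rdil (a : R) (v : R -> R) : 0 < a ->
  mA.-integrable setT (EFin \o v) -> mA.-integrable setT (EFin \o rdil a v).
Proof.
move=> a0 iv; have mv : measurable_fun setT v by apply/measurable_EFinP; exact: measurable_int iv.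
have mva : measurable_fun setT (fun x : R => v (a * x)) by meas.
have ia : mA.-integrable setT (fun x => (v (a * x))%:E).
  apply/integrableP; split; first exact/measurable_EFinP.
  have /integrableP[_] := iv.
  rewrite (ge0_integral_hankel_dil a0 (fun _ => abse_ge0 _)); last first.
    by apply: measurableT_comp => //; exact/measurable_EFinP.
  set I := (\int[mA]_x _)%E; have I0 : (0 <= I)%E by exact: integral_ge0.
  case: (I) I0 => [i| |]//= _; first by move=> _; exact: ltry.
  by rewrite mulry gtr0_sg ?powR_gt0// mul1e.
exact: (@integrableZl _ _ _ mA setT measurableT _ _ ia).
Qed.

Lemma rhankel_rdil (a : R) (v : R -> R) (xi : R) : 0 < a -> measurable_fun setT v ->
  rhankel alpha (rdil a v) xi = a `^ (- (alpha + 1)) * rhankel alpha v (xi / a).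
Proof.
move=> a0 mv; have mJ := measurable_bessel alpha.
rewrite /rhankel (@Rintegral_hankel_dil a (fun x => v x * J (x * (xi / a))))//; last by meas.
rewrite mulrA (_ : a `^ (- (alpha + 1)) * a `^ (2 * alpha + 2) = a `^ (alpha + 1)); last first.
  rewrite -powRD; last by apply/implyP => _; rewrite gt_eqF.
  by congr (_ `^ _); ring.
rewrite -RintegralZl_line; last by meas.
apply: eq_Rintegral => x _; rewrite /rdil -mulrA; congr (_ * (_ * J _)).
by field; rewrite gt_eqF.
Qed.

End translation_convolution.

(** * Complex definitions as real integrals *)

Section complex_formulas.
Context (R : realType) (alpha : R).
Hypothesis ha : - 2^-1 < alpha.
Local Open Scope complex_scope.
Local Notation leb := (@lebesgue_measure R).
Local Notation mA := (hankel_measure alpha).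
Local Notation mS := (sine_measure alpha).

(** As [2 alpha + 1 > 0], the density vanishes at the origin, so the closed half-line of the
    definitions and the open one of [posind] carry the same weight at every point. *)
Lemma mu_dens0 : mu_dens alpha 0 = 0.
Proof.
by rewrite /mu_dens powR0 ?mul0r//; apply/eqP => h; move: ha; lra.
Qed.

Lemma Rintegral_Rplus (h : R -> R) : measurable_fun setT h ->
  Rintegral leb (@Rplus R) (fun x => h x * mu_dens alpha x) = Rintegral mA setT h.
Proof.
move=> mh; rewrite Rintegral_hankel// Rintegral_mkcond; apply: eq_Rintegral => x _.
rewrite patchE /hankel_weight; case: ifPn; rewrite ?inE ?notin_setE /Rplus/= => x0.
  move: x0; rewrite le_eqVlt => /orP[/eqP<-|x0]; first by rewrite mu_dens0 mul0r.
  by rewrite posind_gt0// mulr1.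
rewrite posind_le0 ?mulr0//; by move/negP: x0; rewrite -ltNge => /ltW.
Qed.

Lemma ReM_real (z : R[i]) (r : R) : complex.Re (z * r%:C) = complex.Re z * r.
Proof. by case: z => x y /=; rewrite mulr0 subr0. Qed.

Lemma ImM_real (z : R[i]) (r : R) : complex.Im (z * r%:C) = complex.Im z * r.
Proof. by case: z => x y /=; rewrite mulr0 add0r. Qed.

Lemma realM_complex (r x y : R) : r%:C * (x +i* y) = (r * x) +i* (r * y).
Proof. by simpc. Qed.

Lemma cintegralE (D : set R) (g : R -> R[i]) : cintegral D g =
  Rintegral leb D (fun x => complex.Re (g x)) +i* Rintegral leb D (fun x => complex.Im (g x)).
Proof. by rewrite /cintegral; simpc. Qed.

Lemma cint_muE (g : R -> R[i]) :
  measurable_fun setT (fun x => complex.Re (g x)) -> measurable_fun setT (fun x => complex.Im (g x)) ->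
  cint_mu alpha g = Rintegral mA setT (fun x => complex.Re (g x)) +i* Rintegral mA setT (fun x => complex.Im (g x)).
Proof.
move=> m1 m2; rewrite /cint_mu cintegralE; congr (_ +i* _).
- by rewrite -Rintegral_Rplus//; apply: eq_Rintegral => x _; rewrite ReM_real.
- by rewrite -Rintegral_Rplus//; apply: eq_Rintegral => x _; rewrite ImM_real.
Qed.

Lemma hankelE (g : R -> R[i]) (xi : R) :
  measurable_fun setT (fun x => complex.Re (g x)) -> measurable_fun setT (fun x => complex.Im (g x)) ->
  hankel alpha g xi = rhankel alpha (fun x => complex.Re (g x)) xi +i* rhankel alpha (fun x => complex.Im (g x)) xi.
Proof.
move=> m1 m2; have mJ := measurable_bessel alpha.
have e1 x : complex.Re (g x * (j_alpha alpha (x * xi))%:C) = complex.Re (g x) * bessel alpha (x * xi).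
  by rewrite ReM_real j_alphaE.
have e2 x : complex.Im (g x * (j_alpha alpha (x * xi))%:C) = complex.Im (g x) * bessel alpha (x * xi).
  by rewrite ImM_real j_alphaE.
rewrite /hankel cint_muE.
- by congr (_ +i* _); apply: eq_Rintegral => x _.
- by rewrite (funext e1); meas.
- by rewrite (funext e2); meas.
Qed.

Lemma Rintegral_sine_itv (h : R -> R) : measurable_fun setT h ->
  sine_const alpha * Rintegral leb `[0, pi] (fun th => h th * (sin th) `^ (2 * alpha)) = Rintegral mS setT h.
Proof.
move=> mh; have mU := @measurable_uhalf R.
have mg : measurable_fun setT (fun th => h th * (sin th) `^ (2 * alpha)) by meas.
rewrite Rintegral_sine//.
have -> : Rintegral leb `[0, pi] (fun th => h th * (sin th) `^ (2 * alpha)) =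
    Rintegral leb setT (fun th => h th * (sin th) `^ (2 * alpha) * uhalf th).
  rewrite /Rintegral; congr fine.
  rewrite [LHS](@integral_itv_bndoo _ 0 pi (fun th => (h th * (sin th) `^ (2 * alpha))%:E) true false); last first.
    by apply/measurable_funTS/measurable_EFinP.
  rewrite [LHS]integral_mkcond; apply: eq_integral => th _.
  by rewrite patchE mem_setE in_itv/= uhalfE; case: ifP; rewrite ?mulr1 ?mulr0.
rewrite -RintegralZl_line; last by meas.
by apply: eq_Rintegral => th _; rewrite /sine_weight; ring.
Qed.

Lemma htransE (x : R) (g : R -> R[i]) (y : R) :
  measurable_fun setT (fun t => complex.Re (g t)) -> measurable_fun setT (fun t => complex.Im (g t)) ->
  htrans alpha x g y = translate alpha x (fun t => complex.Re (g t)) y +i* translate alpha x (fun t => complex.Im (g t)) y.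
Proof.
move=> m1 m2; rewrite /htrans cintegralE -/(sine_const alpha).
have mr : measurable_fun setT (fun th => rho x y th) by rewrite /rho; meas.
have e1 : sine_const alpha * Rintegral leb `[0, pi] (fun th => complex.Re (g (rho x y th) * (sin th `^ (2 * alpha))%:C)) =
   translate alpha x (fun t => complex.Re (g t)) y.
  rewrite /translate -Rintegral_sine_itv; last exact: (measurableT_comp m1 mr).
  by congr (_ * _); apply: eq_Rintegral => th _; rewrite ReM_real.
have e2 : sine_const alpha * Rintegral leb `[0, pi] (fun th => complex.Im (g (rho x y th) * (sin th `^ (2 * alpha))%:C)) =
   translate alpha x (fun t => complex.Im (g t)) y.
  rewrite /translate -Rintegral_sine_itv; last exact: (measurableT_comp m2 mr).
  by congr (_ * _); apply: eq_Rintegral => th _; rewrite ImM_real.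
by rewrite -e1 -e2; exact: realM_complex.
Qed.

(** Expansion of [(f1 + i f2) (p1 - i p2)] under the integral. Boundedness of [f] makes the four
    real integrals converge for every [x], hence they can be added. *)
Lemma hwtE (psi f : R -> R[i]) (a x : R) (M : R) :
  measurable_fun setT (fun t => complex.Re (f t)) -> measurable_fun setT (fun t => complex.Im (f t)) ->
  (forall t, `|complex.Re (f t)| <= M) -> (forall t, `|complex.Im (f t)| <= M) ->
  mA.-integrable setT (fun t => (complex.Re (psi t))%:E) ->
  mA.-integrable setT (fun t => (complex.Im (psi t))%:E) -> 0 < a ->
  let f1 t := complex.Re (f t) in let f2 t := complex.Im (f t) in
  let p1 := rdil alpha a (fun t => complex.Re (psi t)) in
  let p2 := rdil alpha a (fun t => complex.Im (psi t)) in
  let c := (Num.sqrt (fine (c_psi alpha psi)))^-1 in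
  hwt alpha psi f a x = (c * (wconv alpha f1 p1 x + wconv alpha f2 p2 x)) +i*
     (c * (wconv alpha f2 p1 x - wconv alpha f1 p2 x)).
Proof.
move=> m1 m2 b1 b2 i1 i2 a0 f1 f2 p1 p2 c.
have mq1 : measurable_fun setT (fun t => complex.Re (psi t)) by apply/measurable_EFinP; exact: measurable_int i1.
have mq2 : measurable_fun setT (fun t => complex.Im (psi t)) by apply/measurable_EFinP; exact: measurable_int i2.
have ip1 : mA.-integrable setT (EFin \o p1) by exact: integrable_rdil.
have ip2 : mA.-integrable setT (EFin \o p2) by exact: integrable_rdil.
have mp1 : measurable_fun setT p1 by apply/measurable_EFinP; exact: measurable_int ip1.
have mp2 : measurable_fun setT p2 by apply/measurable_EFinP; exact: measurable_int ip2.
have d1 t : complex.Re (dil alpha a psi t) = p1 t by rewrite /dil mulrC ReM_real mulrC.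
have d2 t : complex.Im (dil alpha a psi t) = p2 t by rewrite /dil mulrC ImM_real mulrC.
have hE t : htrans alpha x (dil alpha a psi) t = translate alpha x p1 t +i* translate alpha x p2 t.
  rewrite htransE.
  - by congr (_ +i* _); apply: eq_Rintegral => th _.
  - by under eq_fun do rewrite d1.
  - by under eq_fun do rewrite d2.
have r1 t : complex.Re (f t * (htrans alpha x (dil alpha a psi) t)^*) =
   f1 t * translate alpha x p1 t + f2 t * translate alpha x p2 t.
  by rewrite hE /f1 /f2; case: (f t) => u v /=; ring.
have r2 t : complex.Im (f t * (htrans alpha x (dil alpha a psi) t)^*) =
   f2 t * translate alpha x p1 t - f1 t * translate alpha x p2 t.
  by rewrite hE /f1 /f2; case: (f t) => u v /=; ring.
have I11 := integrable_wconv_section ha x m1 b1 ip1.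
have I22 := integrable_wconv_section ha x m2 b2 ip2.
have I21 := integrable_wconv_section ha x m2 b2 ip1.
have I12 := integrable_wconv_section ha x m1 b1 ip2.
have M11 : measurable_fun setT (fun t => f1 t * translate alpha x p1 t) by apply/measurable_EFinP; exact: measurable_int I11.
have M22 : measurable_fun setT (fun t => f2 t * translate alpha x p2 t) by apply/measurable_EFinP; exact: measurable_int I22.
have M21 : measurable_fun setT (fun t => f2 t * translate alpha x p1 t) by apply/measurable_EFinP; exact: measurable_int I21.
have M12 : measurable_fun setT (fun t => f1 t * translate alpha x p2 t) by apply/measurable_EFinP; exact: measurable_int I12.
rewrite /hwt cint_muE; last 2 first.
- under eq_fun do rewrite r1; exact: measurable_funD.
- under eq_fun do rewrite r2; exact: measurable_funB.
have -> : Rintegral mA setT (fun t => complex.Re (f t * (htrans alpha x (dil alpha a psi) t)^*)) =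
    wconv alpha f1 p1 x + wconv alpha f2 p2 x.
  rewrite /wconv -(@RintegralD _ (measurableTypeR R) R mA setT _ _ measurableT I11 I22).
  by apply: eq_Rintegral => t _; exact: r1.
have -> : Rintegral mA setT (fun t => complex.Im (f t * (htrans alpha x (dil alpha a psi) t)^*)) =
    wconv alpha f2 p1 x - wconv alpha f1 p2 x.
  rewrite /wconv -(@RintegralB _ (measurableTypeR R) R mA setT _ _ measurableT I21 I12).
  by apply: eq_Rintegral => t _; exact: r2.
exact: realM_complex.
Qed.

End complex_formulas.

Section Schwartz_real.
Context (R : realType) (alpha : R).
Hypothesis ha : - 2^-1 < alpha.
Local Notation leb := (@lebesgue_measure R).
Local Notation mA := (hankel_measure alpha).

Lemma schwartzR_continuous (u : R -> R) : schwartzR u -> continuous u.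
Proof.
move=> [d _] x; apply: differentiable_continuous; apply/derivable1_diffP.
exact: (d 0%N x).
Qed.

Lemma schwartzR_bounded (u : R -> R) k : schwartzR u -> exists M : R, forall x, `|x ^+ k * u x| <= M.
Proof. by move=> [_ b]; have [M hM] := b k 0%N; exists M. Qed.

(** The bounds on [u] and [x^K u] give decay like [(1 + x)^(-K)]. For [K > 2 alpha + 2] this is
    integrable by [Beta_second_kind]. *)
Lemma schwartzR_integrable (u : R -> R) : schwartzR u -> mA.-integrable setT (EFin \o u).
Proof.
move=> su; have mu := continuous_measurable_fun (schwartzR_continuous su).
have mP := @measurable_posind R.
pose K := (Num.truncn (2 * alpha + 2)).+1.
have hK : 2 * alpha + 2 < K%:R by exact: truncnS_gt.
have b0 : 0 < 2 * alpha + 2 by move: ha; lra.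
have [M0 h0] := schwartzR_bounded 0 su; have [M1 h1] := schwartzR_bounded K su.
have M00 : 0 <= M0 by apply: le_trans (h0 0).
have M10 : 0 <= M1 by apply: le_trans (h1 0).
(* The factor [2^K] comes from [1 + x <= 2] for [x <= 1] and [1 + x <= 2 x] for [x > 1]. *)
pose D := 2 ^+ K * (M0 + M1).
have D0 : 0 <= D by rewrite mulr_ge0 ?exprn_ge0 ?addr_ge0.
have bd x : 0 < x -> `|u x| <= D * (1 + x) `^ (- K%:R).
  move=> x0; have x10 : 0 < 1 + x by rewrite addr_gt0.
  rewrite powRN (powR_mulrn K (ltW x10)) ler_pdivlMr ?exprn_gt0// mulrC.
  have [x1|x1] := leP x 1.
    apply: (@le_trans _ _ (2 ^+ K * M0)); last by rewrite ler_wpM2l ?exprn_ge0// lerDl.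
    apply: ler_pM => //; first by rewrite exprn_ge0// ltW.
      by apply: lerXn2r; rewrite ?nnegrE; [exact: ltW|by []|lra].
    by have := h0 x; rewrite expr0 mul1r.
  apply: (@le_trans _ _ (2 ^+ K * M1)); last by rewrite ler_wpM2l ?exprn_ge0// lerDr.
  apply: (@le_trans _ _ (2 ^+ K * (x ^+ K * `|u x|))).
    rewrite mulrA -exprMn ler_wpM2r//.
    by apply: lerXn2r; rewrite ?nnegrE; [exact: ltW|by rewrite mulr_ge0// ltW|lra].
  rewrite ler_wpM2l ?exprn_ge0//; apply: le_trans (h1 x).
  by rewrite normrM normrX (gtr0_norm x0).
apply/integrableP; split; first exact/measurable_EFinP.
apply: (@le_lt_trans _ _ (\int[mA]_x (D * (1 + x) `^ (- K%:R))%:E)%E).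
  apply: le_integral_hankel.
  - by [].
  - by move=> x; rewrite lee_fin mulr_ge0 ?powR_ge0.
  - by apply: measurableT_comp => //; exact/measurable_EFinP.
  - by meas.
  - by move=> x x0; rewrite /= lee_fin bd.
rewrite ge0_integral_hankel; last 2 first.
- by move=> x; rewrite lee_fin mulr_ge0 ?powR_ge0.
- by meas.
pose E := D / (2 `^ alpha * Gamma (alpha + 1)).
have E0 : 0 <= E by rewrite divr_ge0// mulr_ge0 ?powR_ge0 ?Gamma_ge0.
rewrite [X in (X < _)%E](_ : _ = (E%:E * \int[leb]_x (x `^ (2 * alpha + 2 - 1) * (1 + x) `^ (- K%:R) * posind x)%:E)%E); last first.
  rewrite -ge0_integralZEFin//; last 2 first.
  - by move=> x; rewrite lee_fin mulr_ge0 ?posind_ge0// mulr_ge0 ?powR_ge0.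
  - by meas.
  apply: eq_integral => x _; rewrite -!EFinM /hankel_weight /mu_dens /E; congr EFin.
  rewrite (_ : 2 * alpha + 2 - 1 = 2 * alpha + 1); last by ring.
  by move: ((2 `^ alpha * _)^-1) (x `^ _) ((1 + x) `^ _) => p q r; ring.
by rewrite Beta_second_kind// -EFinM ltry.
Qed.

End Schwartz_real.

(** * Energy of the wavelet transform over all scales *)

Section wavelet_energy.
Context (R : realType) (alpha : R).
Hypothesis ha : - 2^-1 < alpha.
Local Notation leb := (@lebesgue_measure R).
Local Notation mA := (hankel_measure alpha).
Local Notation J := (bessel alpha).
Local Notation H := (rhankel alpha).

Lemma rhankelZ (c : R) (u : R -> R) (xi : R) : measurable_fun setT u ->
  H (fun x => c * u x) xi = c * H u xi.
Proof.
move=> mu; have mJ := measurable_bessel alpha.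
rewrite /rhankel -RintegralZl_line; last by meas.
by apply: eq_Rintegral => x _; rewrite mulrA.
Qed.

Lemma integrable_mul_bessel (u : R -> R) (xi : R) : mA.-integrable setT (EFin \o u) ->
  mA.-integrable setT (fun x => (u x * J (x * xi))%:E).
Proof.
move=> iu; have mJ := measurable_bessel alpha.
have mu : measurable_fun setT u by apply/measurable_EFinP; exact: measurable_int iu.
apply: le_integrable (iu) => //; first by meas.
by move=> x _; rewrite /= lee_fin normrM ler_piMr// bessel_le1.
Qed.

Lemma rhankelD (u v : R -> R) (xi : R) :
  mA.-integrable setT (EFin \o u) -> mA.-integrable setT (EFin \o v) ->
  H (fun x => u x + v x) xi = H u xi + H v xi.
Proof.
move=> iu iv; rewrite /rhankel.
rewrite -(@RintegralD _ (measurableTypeR R) R mA setT _ _ measurableT (integrable_mul_bessel xi iu) (integrable_mul_bessel xi iv)).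
by apply: eq_Rintegral => x _; rewrite mulrDl.
Qed.

Lemma rhankelB (u v : R -> R) (xi : R) :
  mA.-integrable setT (EFin \o u) -> mA.-integrable setT (EFin \o v) ->
  H (fun x => u x - v x) xi = H u xi - H v xi.
Proof.
move=> iu iv; rewrite /rhankel.
rewrite -(@RintegralB _ (measurableTypeR R) R mA setT _ _ measurableT (integrable_mul_bessel xi iu) (integrable_mul_bessel xi iv)).
by apply: eq_Rintegral => x _; rewrite mulrBl.
Qed.

Lemma eq_rhankel (u v : R -> R) (xi : R) : measurable_fun setT u -> measurable_fun setT v ->
  (forall x, 0 < x -> u x = v x) -> H u xi = H v xi.
Proof.
move=> mu mv uv; have mJ := measurable_bessel alpha.
by apply: eq_Rintegral_hankel => [| |x x0]; [meas|meas|rewrite uv].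
Qed.

(** Joint measurability in scale and position, required by Tonelli on the half-plane. It comes from
    a measurable function of scale, position, integration variable and angle, by integrating out the
    last two. *)
Lemma measurable_wconv_rdil (u v : R -> R) : measurable_fun setT u -> measurable_fun setT v ->
  measurable_fun setT (fun z : R * R => wconv alpha u (rdil alpha z.1 v) z.2).
Proof.
move=> mu mv.
have m1 : measurable_fun setT (fun w : R * R * R * R => rdil alpha w.1.1.1 v (rho w.1.1.2 w.1.2 w.2)).
  by rewrite /rdil /rho; meas.
have m2 := @measurable_Rintegral1 _ _ _ (measurableTypeR R) R (sine_measure alpha) _ m1.
have m3 : measurable_fun setT (fun w : R * R * R => u w.2 * translate alpha w.1.2 (rdil alpha w.1.1 v) w.2).
  apply: (@measurable_funM _ _ _ _ (fun w : R * R * R => u w.2)); last exact: m2.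
  exact: (measurableT_comp mu measurable_snd).
exact: (@measurable_Rintegral1 _ _ _ (measurableTypeR R) R mA _ m3).
Qed.

(** The two-dimensional norm as an iterated integral. The domain contains the line [x = 0], where
    [hankel_weight] and [mu_dens] both vanish. *)
Lemma L2nuE (F : R -> R -> R[i]) (G1 G2 : R * R -> R) :
  measurable_fun setT G1 -> measurable_fun setT G2 ->
  (forall a x, 0 < a -> F a x = Complex (G1 (a, x)) (G2 (a, x))) ->
  L2nu alpha F = poweR (\int[leb]_a ((a `^ (2 * alpha + 1) * posind a)%:E *
     \int[mA]_x (G1 (a, x) ^+ 2 + G2 (a, x) ^+ 2)%:E))%E 2^-1.
Proof.
move=> m1 m2 FG; have mP := @measurable_posind R; have mw := measurable_hankel_weight alpha.
have w0 := @hankel_weight_ge0 R alpha.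
rewrite /L2nu; congr poweR.
pose G (z : R * R) := (G1 z ^+ 2 + G2 z ^+ 2) * (z.1 `^ (2 * alpha + 1) * posind z.1) * hankel_weight alpha z.2.
have mG : measurable_fun setT G by rewrite /G; clear FG; meas.
have G0 z : 0 <= G z.
  rewrite /G mulr_ge0// mulr_ge0//; first by rewrite addr_ge0 ?sqr_ge0.
  by rewrite mulr_ge0 ?powR_ge0 ?posind_ge0.
transitivity (\int[(leb \x leb)%E]_z (G z)%:E)%E.
  rewrite integral_mkcond; apply: eq_integral => -[a x] _; rewrite patchE.
  case: ifPn; rewrite ?inE ?notin_setE /Rdom/= => h.
    case: h => a0 x0; rewrite FG// /G /= posind_gt0// /cabs2/= mulr1; congr EFin.
    move: x0; rewrite le_eqVlt => /orP[/eqP<-|x0]; last by rewrite hankel_weight_gt0.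
    by rewrite (mu_dens0 ha) hankel_weight_le0// !mulr0.
  rewrite /G/=; have [a0|a0] := ltP 0 a; last by rewrite (posind_le0 a0) !(mulr0, mul0r).
  have [x0|x0] := leP 0 x; first by exfalso; apply: h.
  by rewrite hankel_weight_le0 ?mulr0// ltW.
have mEG : measurable_fun setT (EFin \o G) by exact/measurable_EFinP.
rewrite [LHS](@fubini_tonelli1 _ _ (measurableTypeR R) (measurableTypeR R) R leb leb (EFin \o G) mEG); last first.
  by move=> z; rewrite /= lee_fin.
apply: eq_integral => a _; rewrite /fubini_F.
have mx1 : measurable_fun setT (fun x => G1 (a, x)).
  by apply: (measurableT_comp m1 (_ : measurable_fun setT (fun x : R => (a, x)))); meas.
have mx2 : measurable_fun setT (fun x => G2 (a, x)).
  by apply: (measurableT_comp m2 (_ : measurable_fun setT (fun x : R => (a, x)))); meas.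
have m12 : measurable_fun setT (fun x => G1 (a, x) ^+ 2 + G2 (a, x) ^+ 2).
  by apply: measurable_funD; exact: measurable_funX.
have g0 x : 0 <= G1 (a, x) ^+ 2 + G2 (a, x) ^+ 2 by rewrite addr_ge0 ?sqr_ge0.
rewrite ge0_integral_hankel; last 2 first.
- by move=> x; rewrite lee_fin.
- exact/measurable_EFinP.
rewrite -ge0_integralZEFin; last 3 first.
- by move=> x; rewrite mule_ge0 ?lee_fin.
- by apply: emeasurable_funM; exact/measurable_EFinP.
- by rewrite mulr_ge0 ?powR_ge0 ?posind_ge0.
by apply: eq_integral => x _; rewrite -!EFinM /G/=; congr EFin; ring.
Qed.

(** The substitution [b = xi / a], carried out in logarithmic coordinates, where it is the
    reflection [u -> ln xi - u]. *)
Lemma mellin_scale (Psi : R -> R) (q xi : R) : 0 < xi -> (forall b, 0 <= Psi b) -> measurable_fun setT Psi ->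
  (\int[leb]_a (a `^ (- (2 * q) - 1) * Psi (xi * a `^ (-1)) * posind a)%:E =
   (xi `^ (- (2 * q)))%:E * \int[leb]_b (b `^ (2 * q - 1) * Psi b * posind b)%:E)%E.
Proof.
move=> x0 P0 mPsi; have mP := @measurable_posind R.
under eq_integral do rewrite EFinM.
rewrite ge0_integral_expR; last 2 first.
- by move=> a; rewrite lee_fin mulr_ge0 ?powR_ge0.
- by meas.
under [in RHS]eq_integral do rewrite EFinM.
rewrite ge0_integral_expR; last 2 first.
- by move=> a; rewrite lee_fin mulr_ge0 ?powR_ge0.
- by meas.
rewrite [LHS](@ge0_integral_affine _ (-1) (ln xi)); last 3 first.
- by rewrite oppr_eq0 oner_eq0.
- by move=> u; rewrite -EFinM lee_fin mulr_ge0 ?expR_ge0// mulr_ge0 ?powR_ge0.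
- by meas.
rewrite -ge0_integralZEFin ?powR_ge0//; last 2 first.
- by move=> u; rewrite -EFinM lee_fin mulr_ge0 ?expR_ge0// mulr_ge0 ?powR_ge0.
- by meas.
apply: eq_integral => u _; rewrite normrN1 mule1 -!EFinM; congr EFin.
rewrite !powR_exp mulN1r.
have -> : xi * expR (-1 * (- u + ln xi)) = expR u.
  by rewrite -{1}(lnK x0) -expRD; congr expR; ring.
have -> : xi `^ (- (2 * q)) = expR (- (2 * q) * ln xi) by rewrite powR_expR.
rewrite [LHS]mulrAC -expRD.
have -> : (- (2 * q) - 1) * (- u + ln xi) + (- u + ln xi) = - (2 * q) * ln xi + (2 * q - 1) * u + u by ring.
by rewrite !expRD; move: (expR _) (expR _) (expR u) (Psi _) => w1 w2 w3 w4; ring.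
Qed.

Variables (f1 f2 p1 p2 : R -> R).
Hypotheses (if1 : mA.-integrable setT (EFin \o f1)) (if2 : mA.-integrable setT (EFin \o f2)).
Hypotheses (ip1 : mA.-integrable setT (EFin \o p1)) (ip2 : mA.-integrable setT (EFin \o p2)).
Variables (c : R).

Let Phi xi := H f1 xi ^+ 2 + H f2 xi ^+ 2.
Let Psi xi := H p1 xi ^+ 2 + H p2 xi ^+ 2.

Definition wre (a x : R) := c * (wconv alpha f1 (rdil alpha a p1) x + wconv alpha f2 (rdil alpha a p2) x).
Definition wim (a x : R) := c * (wconv alpha f2 (rdil alpha a p1) x - wconv alpha f1 (rdil alpha a p2) x).

(** What the Plancherel and Pitt inequalities use. It is imposed on a representative defined on the
    line, since the wavelet transform is only known to agree with an even Schwartz function for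
    [x >= 0]. *)
Definition test_function (g : R -> R) := [/\ continuous g, (forall x, g (- x) = g x),
  exists M : R, forall x, `|g x| <= M & mA.-integrable setT (EFin \o g)].

(* The squared modulus of the Hankel transform of W(a,.), see rhankel_wavelet. *)
Definition spectrum (a xi : R) := c ^+ 2 * a `^ (- (2 * alpha + 2)) * Phi xi * Psi (xi * a `^ (-1)).

Let mf1 : measurable_fun setT f1. Proof. by apply/measurable_EFinP; exact: measurable_int if1. Qed.
Let mf2 : measurable_fun setT f2. Proof. by apply/measurable_EFinP; exact: measurable_int if2. Qed.
Let mp1 : measurable_fun setT p1. Proof. by apply/measurable_EFinP; exact: measurable_int ip1. Qed.
Let mp2 : measurable_fun setT p2. Proof. by apply/measurable_EFinP; exact: measurable_int ip2. Qed.

(** Convolution becomes a product and dilation rescales the frequency. Real and imaginary parts then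
    combine by [(A C + B D)^2 + (B C - A D)^2 = (A^2 + B^2) (C^2 + D^2)]. *)
Lemma rhankel_wavelet (a xi : R) (g1 g2 : R -> R) : 0 < a -> test_function g1 -> test_function g2 ->
  (forall x, 0 < x -> wre a x = g1 x) -> (forall x, 0 < x -> wim a x = g2 x) ->
  H g1 xi ^+ 2 + H g2 xi ^+ 2 = spectrum a xi.
Proof.
move=> a0 [c1 _ _ _] [c2 _ _ _] e1 e2.
have i1 := integrable_rdil a0 ip1; have i2 := integrable_rdil a0 ip2.
have I11 := integrable_wconv1 ha if1 i1; have I22 := integrable_wconv1 ha if2 i2.
have I21 := integrable_wconv1 ha if2 i1; have I12 := integrable_wconv1 ha if1 i2.
have M11 := measurable_int _ I11; have M22 := measurable_int _ I22.
have M21 := measurable_int _ I21; have M12 := measurable_int _ I12.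
move: M11 M22 M21 M12 => /measurable_EFinP M11 /measurable_EFinP M22 /measurable_EFinP M21 /measurable_EFinP M12.
have mre : measurable_fun setT (fun x => wconv alpha f1 (rdil alpha a p1) x + wconv alpha f2 (rdil alpha a p2) x).
  exact: (@measurable_funD _ _ _ _ _ _ M11 M22).
have mim : measurable_fun setT (fun x => wconv alpha f2 (rdil alpha a p1) x - wconv alpha f1 (rdil alpha a p2) x).
  exact: (@measurable_funB _ _ _ _ _ _ M21 M12).
have -> : H g1 xi = c * (H f1 xi * (a `^ (- (alpha + 1)) * H p1 (xi / a)) + H f2 xi * (a `^ (- (alpha + 1)) * H p2 (xi / a))).
  rewrite -(@eq_rhankel (wre a) g1 xi); last 3 first.
  - exact: (@measurable_funM _ _ _ _ (fun=> c) _ (measurable_cst _) mre).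
  - exact: continuous_measurable_fun.
  - exact: e1.
  apply: etrans (rhankelZ c xi mre) _; congr (c * _); apply: etrans (rhankelD xi I11 I22) _.
  congr (_ + _).
    by apply: etrans (rhankel_wconv ha xi if1 i1) _; congr (_ * _); exact: rhankel_rdil.
  by apply: etrans (rhankel_wconv ha xi if2 i2) _; congr (_ * _); exact: rhankel_rdil.
have -> : H g2 xi = c * (H f2 xi * (a `^ (- (alpha + 1)) * H p1 (xi / a)) - H f1 xi * (a `^ (- (alpha + 1)) * H p2 (xi / a))).
  rewrite -(@eq_rhankel (wim a) g2 xi); last 3 first.
  - exact: (@measurable_funM _ _ _ _ (fun=> c) _ (measurable_cst _) mim).
  - exact: continuous_measurable_fun.
  - exact: e2.
  apply: etrans (rhankelZ c xi mim) _; congr (c * _); apply: etrans (rhankelB xi I21 I12) _.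
  congr (_ - _).
    by apply: etrans (rhankel_wconv ha xi if2 i1) _; congr (_ * _); exact: rhankel_rdil.
  by apply: etrans (rhankel_wconv ha xi if1 i2) _; congr (_ * _); exact: rhankel_rdil.
rewrite /spectrum /Phi /Psi powR_inv1 ?ltW//.
have -> : a `^ (- (2 * alpha + 2)) = a `^ (- (alpha + 1)) ^+ 2.
  by rewrite expr2 -powRD; [congr (_ `^ _); ring|apply/implyP => _; rewrite gt_eqF].
move: (a `^ _) (H f1 xi) (H f2 xi) (H p1 _) (H p2 _) => w x1 x2 y1 y2; ring.
Qed.

Let mPhi : measurable_fun setT Phi.
Proof.
have m1 := measurable_rhankel alpha mf1; have m2 := measurable_rhankel alpha mf2.
by apply: measurable_funD; apply: measurable_funX.
Qed.

Let mPsi : measurable_fun setT Psi.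
Proof.
have m1 := measurable_rhankel alpha mp1; have m2 := measurable_rhankel alpha mp2.
by apply: measurable_funD; apply: measurable_funX.
Qed.

Let Phi0 xi : 0 <= Phi xi. Proof. by rewrite /Phi addr_ge0 ?sqr_ge0. Qed.
Let Psi0 xi : 0 <= Psi xi. Proof. by rewrite /Psi addr_ge0 ?sqr_ge0. Qed.

Lemma spectrum_ge0 a xi : 0 <= spectrum a xi.
Proof.
apply: mulr_ge0; last exact: Psi0.
apply: mulr_ge0; last exact: Phi0.
by apply: mulr_ge0; [exact: sqr_ge0|exact: powR_ge0].
Qed.

Lemma measurable_spectrum : measurable_fun setT (fun z : R * R => spectrum z.1 z.2).
Proof.
rewrite /spectrum; apply: (@measurable_funM _ _ _ _ (fun z : R * R => c ^+ 2 * z.1 `^ (- (2 * alpha + 2)) * Phi z.2) (fun z => Psi (z.2 * z.1 `^ (-1)))).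
  apply: (@measurable_funM _ _ _ _ (fun z : R * R => c ^+ 2 * z.1 `^ (- (2 * alpha + 2)))); first by clear; meas.
  exact: (measurableT_comp mPhi measurable_snd).
by apply: (measurableT_comp mPsi (_ : measurable_fun setT (fun z : R * R => z.2 * z.1 `^ (-1)))); clear; meas.
Qed.

Lemma measurable_wre : measurable_fun setT (fun z : R * R => wre z.1 z.2).
Proof.
rewrite /wre; apply: (@measurable_funM _ _ _ _ (fun=> c)); first exact: measurable_cst.
by apply: measurable_funD; exact: measurable_wconv_rdil.
Qed.

Lemma measurable_wim : measurable_fun setT (fun z : R * R => wim z.1 z.2).
Proof.
rewrite /wim; apply: (@measurable_funM _ _ _ _ (fun=> c)); first exact: measurable_cst.
by apply: measurable_funB; exact: measurable_wconv_rdil.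
Qed.

(** At fixed [xi] the powers of [a] add up to [- 2 q - 1], and the scale integral is a Mellin
    integral of [Psi] times [xi^(-2 q)]. It serves twice: with [theta = xi^(-2 beta)], [q = 0], and
    with [theta = 1], [q = beta]. *)
Lemma integral_spectrum (theta : R -> R) (q : R) : (forall xi, 0 <= theta xi) -> measurable_fun setT theta ->
  (\int[leb]_a ((a `^ (- (2 * q)) * (a `^ (2 * alpha + 1) * posind a))%:E * \int[mA]_xi (theta xi * spectrum a xi)%:E) =
   (c ^+ 2)%:E * ((\int[mA]_xi (theta xi * Phi xi * xi `^ (- (2 * q)))%:E) *
   \int[leb]_b (b `^ (2 * q - 1) * Psi b * posind b)%:E))%E.
Proof.
move=> t0 mt; have mP := @measurable_posind R.
set I := (\int[leb]_b (b `^ (2 * q - 1) * Psi b * posind b)%:E)%E.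
have I0 : (0 <= I)%E.
  by apply: integral_ge0 => b _; rewrite lee_fin mulr_ge0 ?posind_ge0// mulr_ge0 ?powR_ge0.
pose A a : R := a `^ (- (2 * q)) * (a `^ (2 * alpha + 1) * posind a).
have A0 a : 0 <= A a by rewrite /A mulr_ge0 ?powR_ge0// mulr_ge0 ?powR_ge0 ?posind_ge0.
have mA' : measurable_fun setT A by clear -mP; rewrite /A; meas.
have ms := measurable_spectrum.
pose F a xi : R := A a * (theta xi * spectrum a xi).
have ts0 a xi : 0 <= theta xi * spectrum a xi by rewrite mulr_ge0// spectrum_ge0.
have F0 a xi : 0 <= F a xi by rewrite /F mulr_ge0.
have mts : measurable_fun setT (fun z : R * R => theta z.2 * spectrum z.1 z.2).
  apply: (@measurable_funM _ _ _ _ (fun z : R * R => theta z.2)); last exact: ms.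
  exact: (measurableT_comp mt measurable_snd).
have mF : measurable_fun setT (fun z : R * R => (F z.1 z.2)%:E).
  apply/measurable_EFinP; apply: (@measurable_funM _ _ _ _ (fun z : R * R => A z.1)); last exact: mts.
  exact: (measurableT_comp mA' measurable_fst).
transitivity (\int[leb]_a \int[mA]_xi (F a xi)%:E)%E.
  apply: eq_integral => a _; rewrite -ge0_integralZl_hankel.
  - by apply: eq_integral => xi _; rewrite -EFinM.
  - by move=> xi; rewrite lee_fin.
  - apply/measurable_EFinP.
    by apply: (measurableT_comp mts (_ : measurable_fun setT (fun x : R => (a, x)))); clear; meas.
  - exact: A0.
rewrite (@tonelli _ _ (measurableTypeR R) (measurableTypeR R) R leb mA (fun a xi => (F a xi)%:E)); last 2 first.
- by move=> a xi; rewrite lee_fin.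
- exact: mF.
pose k xi := theta xi * Phi xi * xi `^ (- (2 * q)).
have k0 xi : 0 <= k xi by rewrite /k mulr_ge0 ?powR_ge0// mulr_ge0.
have mk : measurable_fun setT k.
  apply: measurable_funM; last exact: measurable_powR.
  exact: measurable_funM.
transitivity (\int[mA]_xi ((c ^+ 2)%:E * ((k xi)%:E * I)))%E.
  apply: eq_integral_hankel.
  - by move=> xi; apply: integral_ge0 => a _; rewrite lee_fin.
  - by move=> xi; rewrite mule_ge0 ?lee_fin ?sqr_ge0// mule_ge0 ?lee_fin.
  - apply: (@measurable_tonelli1 _ _ (measurableTypeR R) (measurableTypeR R) R leb (fun xi a => (F a xi)%:E)).
      by move=> xi a; rewrite lee_fin.
    by apply: (measurableT_comp mF (_ : measurable_fun setT (fun z : R * R => (z.2, z.1)))); clear; meas.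
  - apply: emeasurable_funM; first exact: measurable_cst.
    by apply: emeasurable_funM; [exact/measurable_EFinP|exact: measurable_cst].
  move=> xi x0; transitivity ((c ^+ 2 * (theta xi * Phi xi))%:E *
     \int[leb]_a (a `^ (- (2 * q) - 1) * Psi (xi * a `^ (-1)) * posind a)%:E)%E.
    rewrite -ge0_integralZEFin; last 3 first.
    - by move=> a; rewrite lee_fin mulr_ge0 ?posind_ge0// mulr_ge0 ?powR_ge0.
    - apply/measurable_EFinP; apply: measurable_funM => //.
      apply: measurable_funM; first exact: measurable_powR.
      by apply: (measurableT_comp mPsi (_ : measurable_fun setT (fun a : R => xi * a `^ (-1)))); clear; meas.
    - by rewrite mulr_ge0 ?sqr_ge0// mulr_ge0.
    apply: eq_integral => a _; rewrite -EFinM /F /A /spectrum; congr EFin.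
    have [a0|a0] := ltP 0 a; last by rewrite (posind_le0 a0) !(mulr0, mul0r).
    rewrite (_ : - (2 * q) - 1 = - (2 * q) + (2 * alpha + 1) + - (2 * alpha + 2)); last by ring.
    rewrite !powRD; try by apply/implyP => _; rewrite gt_eqF.
    move: (Phi xi) (Psi _) (theta xi) (posind a) (a `^ _) (a `^ _) (a `^ _) => v1 v2 v3 v4 v5 v6 v7; ring.
  rewrite mellin_scale// -/I [in RHS]muleA -[RHS]muleA muleA -!EFinM muleA; congr (_%:E * _)%E.
  by rewrite /k; ring.
rewrite ge0_integralZl_hankel; last 3 first.
- by move=> xi; rewrite mule_ge0 ?lee_fin.
- by apply: emeasurable_funM; [exact/measurable_EFinP|exact: measurable_cst].
- exact: sqr_ge0.
congr (_ * _)%E.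
rewrite (@ge0_integralZr _ (measurableTypeR R) R mA setT measurableT (fun xi => (k xi)%:E))//.
- exact/measurable_EFinP.
- by move=> xi _; rewrite lee_fin.
Qed.

Section fixed_scale.
Variables (a : R) (g1 g2 : R -> R).
Hypotheses (a0 : 0 < a) (gg1 : test_function g1) (gg2 : test_function g2).
Hypotheses (e1 : forall x, 0 < x -> wre a x = g1 x) (e2 : forall x, 0 < x -> wim a x = g2 x).

Let mg1 : measurable_fun setT g1. Proof. by case: gg1 => h _ _ _; exact: continuous_measurable_fun. Qed.
Let mg2 : measurable_fun setT g2. Proof. by case: gg2 => h _ _ _; exact: continuous_measurable_fun. Qed.
Let mh1 : measurable_fun setT (H g1). Proof. exact: measurable_rhankel. Qed.
Let mh2 : measurable_fun setT (H g2). Proof. exact: measurable_rhankel. Qed.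
Let mre : measurable_fun setT (wre a).
Proof. by apply: (measurableT_comp measurable_wre (_ : measurable_fun setT (fun x : R => (a, x)))); clear; meas. Qed.
Let mim : measurable_fun setT (wim a).
Proof. by apply: (measurableT_comp measurable_wim (_ : measurable_fun setT (fun x : R => (a, x)))); clear; meas. Qed.

Lemma wavelet_Plancherel_le :
  (\int[mA]_x (wre a x ^+ 2 + wim a x ^+ 2)%:E <= \int[mA]_xi (spectrum a xi)%:E)%E.
Proof.
have [c1 ev1 [M1 b1] i1] := gg1; have [c2 ev2 [M2 b2] i2] := gg2.
have -> : (\int[mA]_xi (spectrum a xi)%:E = \int[mA]_xi (H g1 xi ^+ 2)%:E + \int[mA]_xi (H g2 xi ^+ 2)%:E)%E.
  rewrite -(@ge0_integralD _ (measurableTypeR R) R mA setT measurableT); last 4 first.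
  - by move=> xi _; rewrite lee_fin sqr_ge0.
  - by apply/measurable_EFinP; exact: measurable_funX.
  - by move=> xi _; rewrite lee_fin sqr_ge0.
  - by apply/measurable_EFinP; exact: measurable_funX.
  by apply: eq_integral => xi _; rewrite -EFinD -(rhankel_wavelet xi a0 gg1 gg2 e1 e2).
have -> : (\int[mA]_x (wre a x ^+ 2 + wim a x ^+ 2)%:E = \int[mA]_x (g1 x ^+ 2)%:E + \int[mA]_x (g2 x ^+ 2)%:E)%E.
  rewrite -(@ge0_integralD _ (measurableTypeR R) R mA setT measurableT); last 4 first.
  - by move=> xi _; rewrite lee_fin sqr_ge0.
  - by apply/measurable_EFinP; exact: measurable_funX.
  - by move=> xi _; rewrite lee_fin sqr_ge0.
  - by apply/measurable_EFinP; exact: measurable_funX.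
  apply: eq_integral_hankel.
  - by move=> x; rewrite lee_fin addr_ge0 ?sqr_ge0.
  - by move=> x; rewrite -EFinD lee_fin addr_ge0 ?sqr_ge0.
  - by apply/measurable_EFinP; apply: measurable_funD; exact: measurable_funX.
  - by apply/measurable_EFinP; apply: measurable_funD; exact: measurable_funX.
  - by move=> x x0; rewrite e1// e2.
by apply: leeD; [exact: (Plancherel_le ha c1 ev1 b1 i1)|exact: (Plancherel_le ha c2 ev2 b2 i2)].
Qed.

Lemma wavelet_Pitt_le (beta : R) : 0 < beta -> beta < alpha + 1 ->
  (\int[mA]_xi (xi `^ (- (2 * beta)) * spectrum a xi)%:E <=
   (pitt_const alpha beta ^+ 2)%:E * \int[mA]_x ((x `^ beta * wre a x) ^+ 2 + (x `^ beta * wim a x) ^+ 2)%:E)%E.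
Proof.
move=> b0 ba; have [c1 ev1 [M1 b1] i1] := gg1; have [c2 ev2 [M2 b2] i2] := gg2.
have mp q : measurable_fun setT (fun x : R => x `^ q) by exact: measurable_powR.
have -> : (\int[mA]_xi (xi `^ (- (2 * beta)) * spectrum a xi)%:E =
   \int[mA]_xi (xi `^ (- (2 * beta)) * H g1 xi ^+ 2)%:E + \int[mA]_xi (xi `^ (- (2 * beta)) * H g2 xi ^+ 2)%:E)%E.
  rewrite -(@ge0_integralD _ (measurableTypeR R) R mA setT measurableT); last 4 first.
  - by move=> xi _; rewrite lee_fin mulr_ge0 ?powR_ge0 ?sqr_ge0.
  - by apply/measurable_EFinP; apply: measurable_funM => //; exact: measurable_funX.
  - by move=> xi _; rewrite lee_fin mulr_ge0 ?powR_ge0 ?sqr_ge0.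
  - by apply/measurable_EFinP; apply: measurable_funM => //; exact: measurable_funX.
  by apply: eq_integral => xi _; rewrite -EFinD -(rhankel_wavelet xi a0 gg1 gg2 e1 e2) mulrDr.
have -> : (\int[mA]_x ((x `^ beta * wre a x) ^+ 2 + (x `^ beta * wim a x) ^+ 2)%:E =
   \int[mA]_x (x `^ (2 * beta) * g1 x ^+ 2)%:E + \int[mA]_x (x `^ (2 * beta) * g2 x ^+ 2)%:E)%E.
  rewrite -(@ge0_integralD _ (measurableTypeR R) R mA setT measurableT); last 4 first.
  - by move=> xi _; rewrite lee_fin mulr_ge0 ?powR_ge0 ?sqr_ge0.
  - by apply/measurable_EFinP; apply: measurable_funM => //; exact: measurable_funX.
  - by move=> xi _; rewrite lee_fin mulr_ge0 ?powR_ge0 ?sqr_ge0.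
  - by apply/measurable_EFinP; apply: measurable_funM => //; exact: measurable_funX.
  apply: eq_integral_hankel.
  - by move=> x; rewrite lee_fin addr_ge0 ?sqr_ge0.
  - by move=> x; rewrite -EFinD lee_fin addr_ge0// mulr_ge0 ?powR_ge0 ?sqr_ge0.
  - by apply/measurable_EFinP; apply: measurable_funD; apply: measurable_funX; exact: measurable_funM.
  - by apply/measurable_EFinP; apply: measurable_funD; apply: measurable_funM => //; exact: measurable_funX.
  - move=> x x0; rewrite e1// e2// -EFinD !exprMn.
    by rewrite -(powR_mulrn 2 (powR_ge0 x beta)) -powRrM [beta * _]mulrC.
rewrite ge0_muleDr; last 2 first.
- by apply: integral_ge0 => x _; rewrite lee_fin mulr_ge0 ?powR_ge0 ?sqr_ge0.
- by apply: integral_ge0 => x _; rewrite lee_fin mulr_ge0 ?powR_ge0 ?sqr_ge0.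
by apply: leeD; exact: Pitt_inequality.
Qed.

End fixed_scale.

(** Both energies are compared with the same integral of [xi^(-2 beta) Phi]. On the left it occurs
    with factor [c^2 m], on the right with factor [c^2 cc = 1]; nothing requires it to be finite. *)
Lemma wavelet_uncertainty (beta m cc : R) : 0 < beta -> beta < alpha + 1 ->
  (forall a, 0 < a -> exists g1 g2, [/\ test_function g1, test_function g2,
     forall x, 0 < x -> wre a x = g1 x & forall x, 0 < x -> wim a x = g2 x]) ->
  (\int[leb]_b (b `^ (2 * beta - 1) * Psi b * posind b)%:E = m%:E)%E -> 0 <= m ->
  (\int[leb]_b (b `^ (2 * 0 - 1) * Psi b * posind b)%:E = cc%:E)%E -> c ^+ 2 * cc = 1 ->
  (\int[leb]_a ((a `^ (2 * alpha + 1) * posind a)%:E *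
      \int[mA]_x ((a `^ (- beta) * wre a x) ^+ 2 + (a `^ (- beta) * wim a x) ^+ 2)%:E) <=
   (c ^+ 2 * m * pitt_const alpha beta ^+ 2)%:E *
   \int[leb]_a ((a `^ (2 * alpha + 1) * posind a)%:E *
      \int[mA]_x ((x `^ beta * wre a x) ^+ 2 + (x `^ beta * wim a x) ^+ 2)%:E))%E.
Proof.
move=> b0 ba Hg Em m0 Ec ccc; have mP := @measurable_posind R.
have mwre := measurable_wre; have mwim := measurable_wim.
have ms := measurable_spectrum.
pose A q (a : R) : R := a `^ (- (2 * q)) * (a `^ (2 * alpha + 1) * posind a).
have A0 q a : 0 <= A q a by rewrite /A mulr_ge0 ?powR_ge0// mulr_ge0 ?powR_ge0 ?posind_ge0.
have mA' q : measurable_fun setT (A q) by clear -mP; rewrite /A; meas.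
have mB : measurable_fun setT (fun a : R => a `^ (2 * alpha + 1) * posind a) by clear -mP; meas.
have B0 (a : R) : 0 <= a `^ (2 * alpha + 1) * posind a by rewrite mulr_ge0 ?powR_ge0 ?posind_ge0.
have t1 F := @measurable_tonelli1 _ _ (measurableTypeR R) (measurableTypeR R) R mA F.
pose th (xi : R) := xi `^ (- (2 * beta)).
have th0 xi : 0 <= th xi by exact: powR_ge0.
have mth : measurable_fun setT th by exact: measurable_powR.
have mwp1 : measurable_fun setT (fun z : R * R => (z.2 `^ beta * wre z.1 z.2) ^+ 2 + (z.2 `^ beta * wim z.1 z.2) ^+ 2).
  have mz : measurable_fun setT (fun z : R * R => z.2 `^ beta) by clear; meas.
  by apply: measurable_funD; apply: measurable_funX; exact: measurable_funM.
have mwp2 : measurable_fun setT (fun z : R * R => (z.1 `^ (- beta) * wre z.1 z.2) ^+ 2 + (z.1 `^ (- beta) * wim z.1 z.2) ^+ 2).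
  have mz : measurable_fun setT (fun z : R * R => z.1 `^ (- beta)) by clear; meas.
  by apply: measurable_funD; apply: measurable_funX; exact: measurable_funM.
pose T : \bar R := (\int[mA]_xi (th xi * Phi xi)%:E)%E.
pose B : \bar R := (\int[leb]_a ((a `^ (2 * alpha + 1) * posind a)%:E *
      \int[mA]_x ((x `^ beta * wre a x) ^+ 2 + (x `^ beta * wim a x) ^+ 2)%:E))%E.
(* Normalisation by [c_psi] makes [T] the energy over all scales of the spectrum weighted by
   [xi^(-2 beta)], to which Pitt's inequality applies one scale at a time. *)
have TB : (T <= (pitt_const alpha beta ^+ 2)%:E * B)%E.
  have -> : T = (\int[leb]_a ((A 0 a)%:E * \int[mA]_xi (th xi * spectrum a xi)%:E))%E.
    rewrite integral_spectrum// Ec.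
    have -> : (\int[mA]_xi (th xi * Phi xi * xi `^ (- (2 * 0)))%:E = T)%E.
      by apply: eq_integral => xi _; rewrite mulr0 oppr0 powRr0 mulr1.
    by rewrite [(T * _)%E]muleC muleA -EFinM ccc mul1e.
  rewrite -ge0_integralZEFin; last 3 first.
  - move=> a; apply: mule_ge0; first by rewrite lee_fin.
    by apply: integral_ge0 => x _; rewrite lee_fin addr_ge0 ?sqr_ge0.
  - apply: emeasurable_funM; first exact/measurable_EFinP.
    apply: (t1 (fun a x => ((x `^ beta * wre a x) ^+ 2 + (x `^ beta * wim a x) ^+ 2)%:E)).
      by move=> a x; rewrite lee_fin addr_ge0 ?sqr_ge0.
    exact/measurable_EFinP.
  - exact: sqr_ge0.
  apply: (@ge0_le_integral _ (measurableTypeR R) R leb setT measurableT).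
  - move=> a _; apply: mule_ge0; first by rewrite lee_fin.
    by apply: integral_ge0 => xi _; rewrite lee_fin mulr_ge0// spectrum_ge0.
  - apply: emeasurable_funM; first by apply/measurable_EFinP; exact: mA'.
    apply: (t1 (fun a xi => (th xi * spectrum a xi)%:E)).
      by move=> a xi; rewrite lee_fin mulr_ge0// spectrum_ge0.
    apply/measurable_EFinP; apply: measurable_funM => //.
    exact: (measurableT_comp mth measurable_snd).
  - apply: emeasurable_funM; first exact: measurable_cst.
    apply: emeasurable_funM; first exact/measurable_EFinP.
    apply: (t1 (fun a x => ((x `^ beta * wre a x) ^+ 2 + (x `^ beta * wim a x) ^+ 2)%:E)).
      by move=> a x; rewrite lee_fin addr_ge0 ?sqr_ge0.
    exact/measurable_EFinP.
  move=> a _; have [a0|a0] := ltP 0 a; last first.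
    by rewrite /A (posind_le0 a0) !mulr0 !mul0e mule0.
  have [g1 [g2 [gg1 gg2 e1 e2]]] := Hg a a0.
  rewrite muleCA /A mulr0 oppr0 powRr0 mul1r; apply: lee_wpmul2l; first by rewrite lee_fin.
  exact: (wavelet_Pitt_le a0 gg1 gg2 e1 e2 b0 ba).
apply: (@le_trans _ _ ((c ^+ 2)%:E * (T * m%:E))%E); last first.
  rewrite [(T * _)%E]muleC muleA -EFinM [X in (_ <= X * _)%E]EFinM -muleA.
  by apply: lee_wpmul2l => //; rewrite lee_fin mulr_ge0 ?sqr_ge0.
(* Here the power of [xi] is not put in by hand: it comes from the weight [a^(-2 beta)] through the
   rescaling of the Mellin integral. *)
have -> : ((c ^+ 2)%:E * (T * m%:E) = \int[leb]_a ((A beta a)%:E * \int[mA]_xi (1 * spectrum a xi)%:E))%E.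
  rewrite (@integral_spectrum (fun=> 1))// Em; congr (_ * (_ * _))%E.
  by apply: eq_integral => xi _; rewrite mul1r mulrC.
apply: (@ge0_le_integral _ (measurableTypeR R) R leb setT measurableT).
- move=> a _; apply: mule_ge0; first by rewrite lee_fin.
  by apply: integral_ge0 => x _; rewrite lee_fin addr_ge0 ?sqr_ge0.
- apply: emeasurable_funM; first exact/measurable_EFinP.
  apply: (t1 (fun a x => ((a `^ (- beta) * wre a x) ^+ 2 + (a `^ (- beta) * wim a x) ^+ 2)%:E)).
    by move=> a x; rewrite lee_fin addr_ge0 ?sqr_ge0.
  exact/measurable_EFinP.
- apply: emeasurable_funM; first by apply/measurable_EFinP; exact: mA'.
  apply: (t1 (fun a xi => (1 * spectrum a xi)%:E)).
    by move=> a xi; rewrite lee_fin mul1r spectrum_ge0.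
  by apply/measurable_EFinP; apply: measurable_funM.
move=> a _; have [a0|a0] := ltP 0 a; last first.
  by rewrite /A (posind_le0 a0) !mulr0 !mul0e.
have [g1 [g2 [gg1 gg2 e1 e2]]] := Hg a a0.
have -> : (\int[mA]_x ((a `^ (- beta) * wre a x) ^+ 2 + (a `^ (- beta) * wim a x) ^+ 2)%:E =
   (a `^ (- (2 * beta)))%:E * \int[mA]_x (wre a x ^+ 2 + wim a x ^+ 2)%:E)%E.
  rewrite -ge0_integralZl_hankel; last 3 first.
  - by move=> x; rewrite lee_fin addr_ge0 ?sqr_ge0.
  - apply/measurable_EFinP.
    have m12 : measurable_fun setT (fun z : R * R => wre z.1 z.2 ^+ 2 + wim z.1 z.2 ^+ 2).
      by apply: measurable_funD; exact: measurable_funX.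
    by apply: (measurableT_comp m12 (_ : measurable_fun setT (fun x : R => (a, x)))); clear; meas.
  - exact: powR_ge0.
  apply: eq_integral => x _; rewrite -EFinM !exprMn -mulrDr; congr (_ * _)%:E.
  by rewrite -(powR_mulrn 2 (powR_ge0 _ _)) -powRrM; congr (_ `^ _); ring.
rewrite muleA -EFinM [_ * a `^ (- (2 * beta))]mulrC -/(A beta a).
apply: lee_wpmul2l; first by rewrite lee_fin.
under [leRHS]eq_integral do rewrite mul1r.
exact: (wavelet_Plancherel_le a0 gg1 gg2 e1 e2).
Qed.

End wavelet_energy.

(** * Admissible wavelets and Schwartz data *)

Section wavelet_data.
Context (R : realType) (alpha : R).
Hypothesis ha : - 2^-1 < alpha.
Local Notation leb := (@lebesgue_measure R).
Local Notation mA := (hankel_measure alpha).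

Lemma test_function_schwartz (g : R -> R) : schwartzR g -> (forall x, g (- x) = g x) -> test_function alpha g.
Proof.
move=> sg ev; split => //.
- exact: schwartzR_continuous.
- by have [M hM] := schwartzR_bounded 0 sg; exists M => x; have := hM x; rewrite expr0 mul1r.
- exact: schwartzR_integrable.
Qed.

Lemma test_function_Re (g : R -> R[i]) : schwartz_even g -> test_function alpha (fun x => complex.Re (g x)).
Proof. by move=> [[s1 s2] ev]; apply: test_function_schwartz => // x; rewrite ev. Qed.

Lemma test_function_Im (g : R -> R[i]) : schwartz_even g -> test_function alpha (fun x => complex.Im (g x)).
Proof. by move=> [[s1 s2] ev]; apply: test_function_schwartz => // x; rewrite ev. Qed.

Lemma norm_part_le_cmod (z : R[i]) : `|complex.Re z| <= cmod z /\ `|complex.Im z| <= cmod z.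
Proof.
by split; rewrite -sqrtr_sqr /cmod /cabs2 ler_wsqrtr// ?lerDl ?lerDr sqr_ge0.
Qed.

(** Real and imaginary parts are dominated by the modulus, whose integrability over the closed
    half-line is part of admissibility. *)
Lemma integrable_admissible (psi : R -> R[i]) (u : R -> R) : admissible alpha psi ->
  measurable_fun setT u -> (forall x, `|u x| <= cmod (psi x)) -> mA.-integrable setT (EFin \o u).
Proof.
move=> [_ ip _ _ _] mu up; apply/(integrable_hankel alpha mu).
have mw := measurable_hankel_weight alpha.
have mR : measurable (@Rplus R).
  rewrite (_ : @Rplus R = `[0, +oo[%classic); first exact: measurable_itv.
  by apply/seteqP; split => x; rewrite /= in_itv/= andbT.
have := (@integrable_mkcond _ _ _ leb (@Rplus R) _ mR).1 ip.
apply: le_integrable => //; first by apply/measurable_EFinP; exact: measurable_funM.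
move=> x _; rewrite patchE; have [x0|x0] := ltP 0 x; last first.
  by rewrite hankel_weight_le0// mulr0 abse0 abse_ge0.
rewrite mem_set; last exact: ltW.
rewrite hankel_weight_gt0// /= lee_fin !normrM ler_wpM2r//.
by apply: le_trans (up x) (ler_norm _).
Qed.

Lemma integral_Rpos_div (h : R -> R) (p : R) :
  (\int[leb]_(a in @Rpos R) (a `^ p * h a / a)%:E = \int[leb]_b (b `^ (p - 1) * h b * posind b)%:E)%E.
Proof.
rewrite /Rpos integral_posind; apply: eq_integral => b _; rewrite -EFinM; congr EFin.
have [b0|b0] := ltP 0 b; last by rewrite (posind_le0 b0) !mulr0.
rewrite powRB; last by apply/implyP => _; rewrite gt_eqF.
by rewrite powRr1 ?ltW//; ring.
Qed.

Lemma poweR_half_le (A B : \bar R) (K : R) : (0 <= A)%E -> (0 <= B)%E -> 0 <= K ->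
  (A <= (K ^+ 2)%:E * B)%E -> (poweR A 2^-1 <= K%:E * poweR B 2^-1)%E.
Proof.
move=> A0 B0 K0 AB.
have -> : (K%:E * poweR B 2^-1 = poweR ((K ^+ 2)%:E * B) 2^-1)%E.
  by rewrite poweRM ?lee_fin ?sqr_ge0// poweR_EFin powR_sqr// mulfV ?pnatr_eq0// powRr1.
apply: gt0_ler_poweR => //; rewrite ?in_itv/= ?leey ?andbT//.
by rewrite mule_ge0// lee_fin sqr_ge0.
Qed.

End wavelet_data.

Local Open Scope complex_scope.

Theorem mainTheorem5 (R : realType) (alpha beta : R) (psi f : R -> R[i]) :
  - (2^-1) < alpha ->
  admissible alpha psi ->
  0 <= beta -> beta < alpha + 1 ->
  (mellin (fun a => cabs2 (hankel alpha psi a)) (- (2 * beta)) < +oo)%E ->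
  schwartz_even f ->
  (forall a : R, 0 < a -> restr_in_Se (fun x => hwt alpha psi f a x)) ->
  (L2nu alpha (fun a x => ((a `^ (- beta))%:C * hwt alpha psi f a x)%R)
   <= (Cab alpha beta psi)%:E
      * L2nu alpha (fun a x => ((x `^ beta)%:C * hwt alpha psi f a x)%R))%E.
Proof.
move=> ha adm be0 ba mel sf sW.
have [[mp1 mp2] _ _ _ /andP[cpos cfin]] := adm.
pose f1 x := complex.Re (f x); pose f2 x := complex.Im (f x).
pose p1 x := complex.Re (psi x); pose p2 x := complex.Im (psi x).
have ip1 : (hankel_measure alpha).-integrable setT (EFin \o p1).
  by apply: (integrable_admissible adm) => // x; exact: (norm_part_le_cmod _).1.
have ip2 : (hankel_measure alpha).-integrable setT (EFin \o p2).
  by apply: (integrable_admissible adm) => // x; exact: (norm_part_le_cmod _).2.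
have [cf1 _ [M1 bf1] if1] := test_function_Re ha sf.
have [cf2 _ [M2 bf2] if2] := test_function_Im ha sf.
have mf1 := continuous_measurable_fun cf1; have mf2 := continuous_measurable_fun cf2.
pose Psi xi := rhankel alpha p1 xi ^+ 2 + rhankel alpha p2 xi ^+ 2.
have PsiE xi : cabs2 (hankel alpha psi xi) = Psi xi by rewrite hankelE.
have Psi0 xi : 0 <= Psi xi by rewrite addr_ge0 ?sqr_ge0.
have cE : c_psi alpha psi = (\int[lebesgue_measure]_b (b `^ (2 * 0 - 1) * Psi b * posind b)%:E)%E.
  rewrite -(@integral_Rpos_div R Psi (2 * 0)).
  by apply: eq_integral => b _; rewrite PsiE mulr0 powRr0 mul1r.
have mE : mellin (fun a => cabs2 (hankel alpha psi a)) (- (2 * beta)) =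
    (\int[lebesgue_measure]_b (b `^ (2 * beta - 1) * Psi b * posind b)%:E)%E.
  rewrite -(@integral_Rpos_div R Psi (2 * beta)).
  by apply: eq_integral => b _; rewrite PsiE opprK.
set m := mellin _ _ in mel mE.
have m0 : (0 <= m)%E.
  rewrite mE; apply: integral_ge0 => b _.
  by rewrite lee_fin mulr_ge0 ?posind_ge0// mulr_ge0 ?powR_ge0.
have mfinE : m = (fine m)%:E by rewrite fineK// ge0_fin_numE.
have cfinE : c_psi alpha psi = (fine (c_psi alpha psi))%:E by rewrite fineK// ge0_fin_numE// ltW.
have c0 : 0 < fine (c_psi alpha psi) by rewrite -lte_fin -cfinE.
set cc := fine (c_psi alpha psi) in cfinE c0.
pose c := (Num.sqrt cc)^-1.
have c2 : c ^+ 2 = cc^-1 by rewrite exprVn sqr_sqrtr// ltW.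
(* One bound must serve both parts of [f], hence the maximum of [M1] and [M2]. *)
have hE a x : 0 < a -> hwt alpha psi f a x = wre alpha f1 f2 p1 p2 c a x +i* wim alpha f1 f2 p1 p2 c a x.
  move=> a0; apply: (@hwtE R alpha ha psi f a x (Num.max M1 M2)) => //.
  - by move=> t; rewrite le_max bf1.
  - by move=> t; rewrite le_max bf2 orbT.
(* At [beta = 0] the superposition with weight [s^(beta - 1)] diverges. But the Mellin value is then
   [c_psi], so the constant is 1, and both weights are 1, at the origin as well since [0 ^ 0 = 1]
   for [powR]. *)
have [beta0|beta0] := eqVneq beta 0.
  have -> : Cab alpha beta psi = 1.
    rewrite /Cab -/m -/cc.
    have -> : fine m = cc.
      by rewrite mE beta0 -cE.
    rewrite mulVf ?gt_eqF// sqrtr1 beta0 oppr0 powRr0 !mul1r !addr0 divff//.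
    by rewrite gt_eqF// Gamma_gt0//; move: ha; lra.
  rewrite mul1e beta0 oppr0.
  rewrite (_ : (fun a x => _) = (fun a x => ((x `^ 0)%:C * hwt alpha psi f a x)%R))//.
  by apply/funext => a; apply/funext => x; rewrite !powRr0.
have b0 : 0 < beta by rewrite lt_neqAle eq_sym beta0.
have mwre : measurable_fun setT (fun z : R * R => wre alpha f1 f2 p1 p2 c z.1 z.2).
  by apply: measurable_wre.
have mwim : measurable_fun setT (fun z : R * R => wim alpha f1 f2 p1 p2 c z.1 z.2).
  by apply: measurable_wim.
have mz1 : measurable_fun setT (fun z : R * R => z.1 `^ (- beta)) by clear; meas.
have mz2 : measurable_fun setT (fun z : R * R => z.2 `^ beta) by clear; meas.
rewrite (@L2nuE R alpha ha _ (fun z => z.1 `^ (- beta) * wre alpha f1 f2 p1 p2 c z.1 z.2)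
   (fun z => z.1 `^ (- beta) * wim alpha f1 f2 p1 p2 c z.1 z.2)); last 3 first.
- exact: measurable_funM.
- exact: measurable_funM.
- by move=> a x a0; rewrite hE// realM_complex.
rewrite (@L2nuE R alpha ha _ (fun z => z.2 `^ beta * wre alpha f1 f2 p1 p2 c z.1 z.2)
   (fun z => z.2 `^ beta * wim alpha f1 f2 p1 p2 c z.1 z.2)); last 3 first.
- exact: measurable_funM.
- exact: measurable_funM.
- by move=> a x a0; rewrite hE// realM_complex.
have main := @wavelet_uncertainty R alpha ha f1 f2 p1 p2 if1 if2 ip1 ip2 c beta (fine m) cc b0 ba.
have Hg a : 0 < a -> exists g1 g2, [/\ test_function alpha g1, test_function alpha g2,
     forall x, 0 < x -> wre alpha f1 f2 p1 p2 c a x = g1 x & forall x, 0 < x -> wim alpha f1 f2 p1 p2 c a x = g2 x].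
  move=> a0; have [g [sg eg]] := sW a a0.
  exists (fun x => complex.Re (g x)), (fun x => complex.Im (g x)); split.
  - exact: test_function_Re.
  - exact: test_function_Im.
  - by move=> x x0; rewrite -eg ?ltW// hE.
  - by move=> x x0; rewrite -eg ?ltW// hE.
have fm0 : 0 <= fine m by exact: fine_ge0.
have Em : (\int[lebesgue_measure]_b (b `^ (2 * beta - 1) * Psi b * posind b)%:E = (fine m)%:E)%E.
  by rewrite -mfinE -mE.
have Ec : (\int[lebesgue_measure]_b (b `^ (2 * 0 - 1) * Psi b * posind b)%:E = cc%:E)%E.
  by rewrite -cfinE -cE.
have ccc : c ^+ 2 * cc = 1 by rewrite c2 mulVf ?gt_eqF.
(* The energies are compared with the squared constant; [poweR_half_le] then takes square roots,
   which is why nonnegativity of [Cab] is needed. *)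
have CabE : c ^+ 2 * fine m * pitt_const alpha beta ^+ 2 = Cab alpha beta psi ^+ 2.
  rewrite /Cab -/m -/cc /pitt_const c2 !exprMn sqr_sqrtr; last by rewrite mulr_ge0// invr_ge0 ltW.
  rewrite (_ : (alpha + 1 - beta) / 2 = (alpha - beta + 1) / 2); last by ring.
  rewrite (_ : (alpha + 1 + beta) / 2 = (alpha + beta + 1) / 2); last by ring.
  by move: (Gamma _) (Gamma _) (2 `^ _) => u v w; ring.
have Cab0 : 0 <= Cab alpha beta psi.
  apply: mulr_ge0; last by apply: divr_ge0; exact: Gamma_ge0.
  by apply: mulr_ge0; [exact: sqrtr_ge0|exact: powR_ge0].
have w0 (a : R) : 0 <= a `^ (2 * alpha + 1) * posind a by rewrite mulr_ge0 ?powR_ge0 ?posind_ge0.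
apply: poweR_half_le.
- by move=> *; apply: integral_ge0 => a _; apply: mule_ge0; [rewrite lee_fin|apply: integral_ge0 => x _; rewrite lee_fin addr_ge0 ?sqr_ge0].
- by move=> *; apply: integral_ge0 => a _; apply: mule_ge0; [rewrite lee_fin|apply: integral_ge0 => x _; rewrite lee_fin addr_ge0 ?sqr_ge0].
- exact: Cab0.
- by rewrite -CabE; exact: (main Hg Em fm0 Ec ccc).
Qed.
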